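(* Let $\theta>0$ and assume that for every $\varepsilon>0$ we have $I_N(0,T)\ll_\varepsilon T^{1+\varepsilon}$ for all integers $N$ in the range $2\leq N\leq T^{\theta}$; that is, for every $\varepsilon>0$ there is a constant $C_\varepsilon>0$ (for the given $\theta$) such that $I_N(0,T)\leq C_\varepsilon T^{1+\varepsilon}$ for all $T\geq 2$ and all integers $N$ with $2\leq N\leq T^\theta$. Then the Riemann zeta-function $\zeta(s)$ has no zeros in the half-plane $\Re\, s>\frac12+\frac{1}{2\theta}$. In particular, if this assumption ($I_N(0,T)\ll_\varepsilon T^{1+\varepsilon}$ for $2\leq N\leq T^{\theta}$, for every $\varepsilon>0$) holds for arbitrarily large $\theta$, then the Riemann hypothesis is true.
   Context: For an integer $N\geq 2$ and $s\in\mathbb{C}$ define $$M_N(s):=\sum_{n\leq N}\frac{\mu(n)}{n^{s}}\Big(1-\frac{\log n}{\log N}\Big),$$ where $\mu$ is the Möbius function. For real $T_1\leq T_2$ define the mollified second moment $$I_N(T_1,T_2):=\int_{T_1}^{T_2}|M_N(\tfrac12+it)|^2\,|\zeta(\tfrac12+it)|^2\,dt,$$ where $\zeta$ is the Riemann zeta-function. The Riemann hypothesis is the statement that all non-trivial zeros of $\zeta(s)$ satisfy $\Re\, s=\frac12$. *)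

(* Defs.v *)
From Stdlib Require Import Reals.
From mathcomp Require seq prime.
From Coquelicot Require Import Coquelicot.

Open Scope R_scope.

(* [prime.logn p n] is the exponent of p in n and [prime.primes n] lists the
   distinct prime divisors of n.  Only n >= 1 is meaningful: at n = 0 the list is
   empty and the value is 1. *)
Definition mobius (n : nat) : R :=
  if seq.all (fun p => Nat.eqb (prime.logn p n) 1) (prime.primes n)
  then (-1) ^ seq.size (prime.primes n)
  else 0.

Definition Cexp (z : C) : C :=
  (exp (Re z) * cos (Im z), exp (Re z) * sin (Im z)).

(* n^s = exp (s log n) with the real logarithm, for n >= 1. *)
Definition ncpow (n : nat) (s : C) : C := Cexp (s * RtoC (ln (INR n)))%C.

Definition mollifier (N : nat) (s : C) : C :=
  sum_n_m (G := C_AbelianMonoid)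
    (fun n => (RtoC (mobius n) / ncpow n s
               * RtoC (1 - ln (INR n) / ln (INR N)))%C) 1 N.

Definition analytic_at (f : C -> C) (z0 : C) : Prop :=
  exists (a : nat -> C) (r : R), 0 < r /\
    forall z : C, Cmod (z - z0)%C < r ->
      is_pseries (K := C_AbsRing) (V := C_NormedModule) a (z - z0)%C (f z).

(* zeta is the analytic continuation of the Dirichlet series of n^(-s) to the
   punctured plane.  Because C \ {1} is connected, this determines zeta uniquely
   there; the value of the total function at the pole s = 1 is left unspecified,
   so the statements below never look at it. *)
Definition is_riemann_zeta (zeta : C -> C) : Prop :=
  (forall s : C, 1 < Re s ->
     is_series (K := C_AbsRing) (V := C_NormedModule)
       (fun n => (/ ncpow (S n) s)%C) (zeta s)) /\
  (forall s : C, s <> RtoC 1 -> analytic_at zeta s).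

Definition is_zero (zeta : C -> C) (s : C) : Prop :=
  s <> RtoC 1 /\ zeta s = RtoC 0.

(* The trivial zeros are the negative even integers. *)
Definition trivial_zero (s : C) : Prop :=
  exists n : nat, s = RtoC (- (2 * INR (S n))).

Definition riemann_hypothesis (zeta : C -> C) : Prop :=
  forall s : C, is_zero zeta s -> ~ trivial_zero s -> Re s = 1 / 2.

Definition mollified_moment (zeta : C -> C) (N : nat) (T1 T2 : R) : R :=
  RInt (fun t => Cmod (mollifier N (1 / 2, t)) ^ 2
                 * Cmod (zeta (1 / 2, t)) ^ 2) T1 T2.

(* I_N(0,T) <<_eps T^(1+eps), uniformly in integers 2 <= N <= T^theta. *)
Definition moment_bound (zeta : C -> C) (theta : R) : Prop :=
  forall eps : R, 0 < eps ->
    exists Ceps : R, 0 < Ceps /\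
      forall (T : R) (N : nat), 2 <= T -> (2 <= N)%nat ->
        INR N <= Rpower T theta ->
        mollified_moment zeta N 0 T <= Ceps * Rpower T (1 + eps).

(* Main.v *)
Require Import Defs.
From Stdlib Require Import Reals Lra Lia Psatz Arith Factorial ClassicalEpsilon.
From mathcomp Require all_boot.
From Coquelicot Require Import Coquelicot.

(** Fix a compact piece of the critical line and average over it with the weight |zeta|^2.  For
    fixed z and s on the line, summing by parts twice turns sum mu(n) n^(-z) into a series in the
    mollifiers M_N(s) whose coefficients are O(N^(s-z-1) log N).  The moment bound makes the averaged series
    converge locally uniformly for Re z > 1/2 + 1/(2 theta), while for large Re z it equals K / zeta(z),
    where K > 0 is the mean of |zeta|^2; by the identity theorem its product with zeta is K
    throughout, so zeta has no zeros there.

    For the Riemann hypothesis, zeros left of the critical line are reflected to the right.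
    Euler-Maclaurin to third order writes zeta on -2 < Re s < -1 as an integral of the periodic
    Bernoulli function B3; inserting its Fourier series gives zeta(s) = X(s) zeta(1 - s), where X
    is built from the Mellin transform of the sine.  That transform continues to the right with
    poles only at odd integers, so zeta(1 - w) = 0 forces zeta(w) = 0 unless w is an odd positive
    integer, and no information on the Gamma function is needed. *)

(** The hypothesis sees the mollifier only through a mean weighted by |zeta|^2. The weight may
    vanish at individual points, so no single s on the line can be used. The average is taken over
    [0, 1]: the integrand of the moment is nonnegative and T may be taken of size N^(1/theta), so
    the weighted mean square of M_N there is O(N^(1/theta + eps)). Thus M_N has mean size N^(1/(2
    theta) + eps), and against coefficients of size N^(1/2 - Re z - 1) this is summable for Re z >
    1/2 + 1/(2 theta). A second summation by parts is forced because M_N carries the weight log N -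
    log n, which is already a sum over the unweighted partial sums. The strip -2 < Re s < -1 is
    where the integral of B3({x}) x^(-s-3) over the whole half-line converges: at infinity since Re
    s > -2, at 0 since B3 has a simple zero there and Re s < -1. No contour or improper integral
    occurs. Taylor coefficients are estimated by averages over roots of unity, and improper
    integrals are limits of explicit antiderivatives, compared by a mean value inequality. *)

(** * Series and power series of complex numbers *)

(* Equalities in a Coquelicot structure over [R] are not recognized by [ring] and [field]. *)
Ltac toR := match goal with |- @eq _ ?x ?y => change (@eq R x y) end.

Lemma Ceq (z w : C) : Re z = Re w -> Im z = Im w -> z = w.
Proof. exact (injective_projections z w). Qed.

Lemma Re_plus (z w : C) : Re (z + w)%C = Re z + Re w. Proof. reflexivity. Qed.
Lemma Im_plus (z w : C) : Im (z + w)%C = Im z + Im w. Proof. reflexivity. Qed.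
Lemma Re_opp (z : C) : Re (- z)%C = - Re z. Proof. reflexivity. Qed.
Lemma Im_opp (z : C) : Im (- z)%C = - Im z. Proof. reflexivity. Qed.
Lemma Re_minus (z w : C) : Re (z - w)%C = Re z - Re w. Proof. reflexivity. Qed.
Lemma Im_minus (z w : C) : Im (z - w)%C = Im z - Im w. Proof. reflexivity. Qed.
Lemma Re_mult (z w : C) : Re (z * w)%C = Re z * Re w - Im z * Im w.
Proof. reflexivity. Qed.
Lemma Im_mult (z w : C) : Im (z * w)%C = Re z * Im w + Im z * Re w.
Proof. reflexivity. Qed.
Lemma Re_RtoC (x : R) : Re (RtoC x) = x. Proof. reflexivity. Qed.
Lemma Im_RtoC (x : R) : Im (RtoC x) = 0. Proof. reflexivity. Qed.

Lemma Re_pair (x y : R) : Re (x, y) = x. Proof. reflexivity. Qed.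
Lemma Im_pair (x y : R) : Im (x, y) = y. Proof. reflexivity. Qed.

#[export] Hint Rewrite Re_plus Im_plus Re_opp Im_opp Re_minus Im_minus Re_mult Im_mult
  Re_RtoC Im_RtoC Re_pair Im_pair : cre.

Lemma im_le_Cmod (z : C) : Rabs (Im z) <= Cmod z.
Proof. eapply Rle_trans; [apply Rmax_r|apply Rmax_Cmod]. Qed.

Lemma Re_le_Cmod (z : C) : Re z <= Cmod z.
Proof. generalize (re_le_Cmod z) (Rle_abs (Re z)); lra. Qed.

Lemma Cmod_le_abs (z : C) : Cmod z <= Rabs (Re z) + Rabs (Im z).
Proof.
replace z with (RtoC (Re z) + Ci * RtoC (Im z))%C at 1
  by (apply Ceq; autorewrite with cre; simpl; ring).
eapply Rle_trans; [apply Cmod_triangle|].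
rewrite Cmod_mult, Cmod_Ci, !Cmod_R; lra.
Qed.

Lemma Cmod_minus_sym (z w : C) : Cmod (z - w)%C = Cmod (w - z)%C.
Proof. rewrite <- Cmod_opp; f_equal; ring. Qed.

Lemma Cmod_minus_le (x y z : C) : Cmod (x - z)%C <= Cmod (x - y)%C + Cmod (y - z)%C.
Proof. replace (x - z)%C with ((x - y) + (y - z))%C by ring; apply Cmod_triangle. Qed.

Lemma Cmod_diag (z : C) : Cmod (z - z)%C = 0.
Proof. replace (z - z)%C with (RtoC 0) by ring. apply Cmod_0. Qed.

Lemma Re_near (z w : C) (r : R) : Cmod (z - w)%C < r -> Re w - r < Re z.
Proof.
intros H. generalize (re_le_Cmod (z - w)%C) (Rle_abs (- Re (z - w)%C)).
rewrite Rabs_Ropp, Re_minus. lra.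
Qed.

Lemma RtoC_nz (x : R) : x <> 0 -> RtoC x <> 0.
Proof. intros H E. apply H, RtoC_inj, E. Qed.

Lemma is_lim_seq_scal_0 (c : R) (e : nat -> R) :
  is_lim_seq e 0 -> is_lim_seq (fun n => c * e n) 0.
Proof.
intros H. replace (Finite 0) with (Rbar_mult c 0) by (simpl; f_equal; ring).
apply is_lim_seq_scal_l, H.
Qed.

Lemma is_lim_seq_inv_S : is_lim_seq (fun n => / INR (S n)) 0.
Proof.
apply (is_lim_seq_incr_1 (fun n => / INR n)).
replace (Finite 0) with (Rbar_inv p_infty) by reflexivity.
apply is_lim_seq_inv; [apply is_lim_seq_INR|discriminate].
Qed.

Lemma Rex_series_scal (c : R) (b : nat -> R) : ex_series b -> ex_series (fun n => c * b n).
Proof. exact (ex_series_scal (V := R_NormedModule) c b). Qed.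

Lemma Cmod_triangle_inv (x y : C) : Cmod x - Cmod y <= Cmod (x - y)%C.
Proof.
assert (H := Cmod_triangle (x - y)%C y). replace (x - y + y)%C with x in H by ring. lra.
Qed.

(** Convergence through the real sequence of distances, so that the limit lemmas for real sequences
    apply. *)
Definition Clim (u : nat -> C) (l : C) : Prop :=
  is_lim_seq (fun n => Cmod (u n - l)%C) 0.

Lemma Clim_squeeze_ev (u : nat -> C) (l : C) (e : nat -> R) (N : nat) :
  (forall n, (N <= n)%nat -> Cmod (u n - l)%C <= e n) -> is_lim_seq e 0 -> Clim u l.
Proof.
intros H He. apply (is_lim_seq_le_le_loc (fun _ => 0) _ e).
- exists N; intros n Hn; split; [apply Cmod_ge_0|apply H, Hn].
- apply is_lim_seq_const.
- exact He.
Qed.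

Lemma Clim_squeeze (u : nat -> C) (l : C) (e : nat -> R) :
  (forall n, Cmod (u n - l)%C <= e n) -> is_lim_seq e 0 -> Clim u l.
Proof. intros H; apply (Clim_squeeze_ev u l e 0); auto. Qed.

Lemma Clim_ext (u v : nat -> C) (l : C) :
  (forall n, u n = v n) -> Clim u l -> Clim v l.
Proof. intros H; apply is_lim_seq_ext; intros n; rewrite H; reflexivity. Qed.

Lemma Clim_comp (u : nat -> C) (l : C) :
  Clim u l <-> is_lim_seq (fun n => Re (u n)) (Re l) /\ is_lim_seq (fun n => Im (u n)) (Im l).
Proof.
split.
- assert (G : forall f : C -> R, (forall a b, f (a - b)%C = f a - f b) ->
    (forall z, Rabs (f z) <= Cmod z) -> Clim u l -> is_lim_seq (fun n => f (u n)) (f l)).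
  { intros f Hf Hle H.
    apply is_lim_seq_ext with (fun n => f (u n - l)%C + f l); [intros; rewrite Hf; ring|].
    replace (Finite (f l)) with (Finite (0 + f l)) by (f_equal; ring).
    apply is_lim_seq_plus'; [|apply is_lim_seq_const].
    apply is_lim_seq_abs_0.
    apply (is_lim_seq_le_le (fun _ => 0) _ (fun n => Cmod (u n - l)%C));
      [|apply is_lim_seq_const|exact H].
    intros n; split; [apply Rabs_pos|apply Hle]. }
  intros H; split; apply G; auto; [apply re_le_Cmod|apply im_le_Cmod].
- intros [H1 H2].
  apply Clim_squeeze with (fun n => Rabs (Re (u n) - Re l) + Rabs (Im (u n) - Im l)).
  + intros n; apply Cmod_le_abs.
  + assert (G : forall (v : nat -> R) (x : R), is_lim_seq v x ->
      is_lim_seq (fun n => Rabs (v n - x)) 0).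
    { intros v x Hv. replace (Finite 0) with (Rbar_abs (Finite (x - x)))
        by (simpl; f_equal; rewrite Rminus_eq_0; apply Rabs_R0).
      apply is_lim_seq_abs, is_lim_seq_minus'; [exact Hv|apply is_lim_seq_const]. }
    replace (Finite 0) with (Finite (0 + 0)) by (f_equal; ring).
    apply is_lim_seq_plus'; apply G; assumption.
Qed.

Lemma Clim_unique (u : nat -> C) (l m : C) : Clim u l -> Clim u m -> l = m.
Proof.
intros H1 H2. apply Clim_comp in H1; apply Clim_comp in H2.
destruct H1 as [A1 B1], H2 as [A2 B2].
apply Ceq.
- apply is_lim_seq_unique in A1; apply is_lim_seq_unique in A2; congruence.
- apply is_lim_seq_unique in B1; apply is_lim_seq_unique in B2; congruence.
Qed.

Lemma Clim_const (l : C) : Clim (fun _ => l) l.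
Proof.
apply Clim_squeeze with (fun _ => 0); [|apply is_lim_seq_const].
intros _; rewrite Cmod_diag; lra.
Qed.

Lemma Clim_plus (u v : nat -> C) (l m : C) :
  Clim u l -> Clim v m -> Clim (fun n => u n + v n)%C (l + m)%C.
Proof.
rewrite !Clim_comp; intros [A1 B1] [A2 B2]; split; autorewrite with cre;
  apply is_lim_seq_plus'; assumption.
Qed.

Lemma Clim_mult (u v : nat -> C) (l m : C) :
  Clim u l -> Clim v m -> Clim (fun n => u n * v n)%C (l * m)%C.
Proof.
rewrite !Clim_comp; intros [A1 B1] [A2 B2]; split; autorewrite with cre.
- apply is_lim_seq_minus'; apply is_lim_seq_mult'; assumption.
- apply is_lim_seq_plus'; apply is_lim_seq_mult'; assumption.
Qed.

Lemma Clim_scal (c : C) (u : nat -> C) (l : C) :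
  Clim u l -> Clim (fun n => c * u n)%C (c * l)%C.
Proof. apply Clim_mult, Clim_const. Qed.

Lemma Clim_minus (u v : nat -> C) (l m : C) :
  Clim u l -> Clim v m -> Clim (fun n => u n - v n)%C (l - m)%C.
Proof.
intros H1 H2. replace (l - m)%C with (l + (-(1)) * m)%C by ring.
apply Clim_ext with (fun n => u n + (-(1)) * v n)%C; [intros; ring|].
apply Clim_plus; [|apply Clim_scal]; assumption.
Qed.

Lemma Clim_incr (u : nat -> C) (l : C) : Clim (fun n => u (S n)) l <-> Clim u l.
Proof.
unfold Clim. symmetry. apply (is_lim_seq_incr_1 (fun n => Cmod (u n - l)%C)).
Qed.

Lemma Clim_incr_n (N : nat) (u : nat -> C) (l : C) :
  Clim (fun n => u (n + N)%nat) l <-> Clim u l.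
Proof.
unfold Clim. symmetry. apply (is_lim_seq_incr_n (fun n => Cmod (u n - l)%C)).
Qed.

Lemma Clim_bound (u : nat -> C) (l : C) (B : R) (N : nat) :
  Clim u l -> (forall n, (N <= n)%nat -> Cmod (u n) <= B) -> Cmod l <= B.
Proof.
intros H HB. apply Rnot_lt_le; intros Hlt.
apply is_lim_seq_spec in H.
assert (P : 0 < Cmod l - B) by lra.
destruct (H (mkposreal _ P)) as [M HM]; simpl in HM.
specialize (HM (N + M)%nat ltac:(lia)); specialize (HB (N + M)%nat ltac:(lia)).
rewrite Rminus_0_r, (Rabs_pos_eq _ (Cmod_ge_0 _)), Cmod_minus_sym in HM.
generalize (Cmod_triangle_inv l (u (N + M)%nat)); lra.
Qed.

(** Half-open sums concatenate and telescope without boundary cases; [sum_n f n] is [csum f (S n)],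
    hence the shifts below. *)
Fixpoint csum (f : nat -> C) (n : nat) : C :=
  match n with O => RtoC 0 | S m => (csum f m + f m)%C end.

Lemma csum_ext (f g : nat -> C) (n : nat) :
  (forall k, (k < n)%nat -> f k = g k) -> csum f n = csum g n.
Proof.
induction n as [|n IH]; intros H; simpl; [reflexivity|].
rewrite IH, H; [reflexivity|lia|intros; apply H; lia].
Qed.

Lemma csum_plus (f g : nat -> C) (n : nat) :
  csum (fun k => f k + g k)%C n = (csum f n + csum g n)%C.
Proof. induction n as [|n IH]; simpl; [|rewrite IH]; ring. Qed.

Lemma csum_scal (c : C) (f : nat -> C) (n : nat) :
  csum (fun k => c * f k)%C n = (c * csum f n)%C.
Proof. induction n as [|n IH]; simpl; [|rewrite IH]; ring. Qed.

Lemma csum_zero (n : nat) : csum (fun _ => RtoC 0) n = 0.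
Proof. induction n as [|n IH]; simpl; [|rewrite IH]; [reflexivity|ring]. Qed.

Lemma csum_add (f : nat -> C) (n m : nat) :
  csum f (n + m) = (csum f n + csum (fun k => f (n + k)%nat) m)%C.
Proof.
induction m as [|m IH]; simpl.
- rewrite Nat.add_0_r; ring.
- rewrite Nat.add_succ_r; simpl; rewrite IH; ring.
Qed.

Lemma csum_swap (f : nat -> nat -> C) (n m : nat) :
  csum (fun i => csum (fun j => f i j) m) n = csum (fun j => csum (fun i => f i j) n) m.
Proof.
induction n as [|n IH]; simpl.
- symmetry; apply csum_zero.
- rewrite IH, <- csum_plus; reflexivity.
Qed.

Lemma csum_telescope (f : nat -> C) (n : nat) :
  csum (fun k => f (S k) - f k)%C n = (f n - f 0%nat)%C.
Proof. induction n as [|n IH]; simpl; [|rewrite IH]; ring. Qed.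

Lemma csum_sum_n (f : nat -> C) (n : nat) :
  sum_n (G := C_AbelianMonoid) f n = csum f (S n).
Proof.
induction n as [|n IH].
- rewrite sum_O; simpl; symmetry; apply Cplus_0_l.
- rewrite sum_Sn, IH; reflexivity.
Qed.

Fixpoint rsum (f : nat -> R) (n : nat) : R :=
  match n with O => 0 | S m => rsum f m + f m end.

Lemma rsum_sum_n (f : nat -> R) (n : nat) : sum_n f n = rsum f (S n).
Proof.
induction n as [|n IH].
- rewrite sum_O; simpl; ring.
- rewrite sum_Sn, IH; reflexivity.
Qed.

Lemma rsum_ext (f g : nat -> R) (n : nat) :
  (forall k, (k < n)%nat -> f k = g k) -> rsum f n = rsum g n.
Proof.
induction n as [|n IH]; intros H; simpl; [reflexivity|].
rewrite IH, H; [reflexivity|lia|intros; apply H; lia].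
Qed.

Lemma rsum_le (f g : nat -> R) (n : nat) :
  (forall k, (k < n)%nat -> f k <= g k) -> rsum f n <= rsum g n.
Proof.
induction n as [|n IH]; intros H; simpl; [lra|].
apply Rplus_le_compat; [apply IH; intros|]; apply H; lia.
Qed.

Lemma rsum_scal (c : R) (f : nat -> R) (n : nat) :
  rsum (fun k => c * f k) n = c * rsum f n.
Proof. induction n as [|n IH]; simpl; [|rewrite IH]; ring. Qed.

Lemma Cmod_csum (f : nat -> C) (n : nat) : Cmod (csum f n) <= rsum (fun k => Cmod (f k)) n.
Proof.
induction n as [|n IH]; simpl; [rewrite Cmod_0; lra|].
eapply Rle_trans; [apply Cmod_triangle|lra].
Qed.

Lemma Re_csum (f : nat -> C) (n : nat) : Re (csum f n) = rsum (fun k => Re (f k)) n.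
Proof. induction n as [|n IH]; simpl; [|rewrite <- IH]; reflexivity. Qed.

Lemma Im_csum (f : nat -> C) (n : nat) : Im (csum f n) = rsum (fun k => Im (f k)) n.
Proof. induction n as [|n IH]; simpl; [|rewrite <- IH]; reflexivity. Qed.

Lemma is_series_rsum (a : nat -> R) (l : R) : is_series a l <-> is_lim_seq (rsum a) l.
Proof.
rewrite (is_lim_seq_incr_1 (rsum a)). split; intros H.
- apply is_lim_seq_ext with (sum_n a); [apply rsum_sum_n|exact H].
- change (is_lim_seq (sum_n a) l).
  apply is_lim_seq_ext with (fun n => rsum a (S n)); [intros; symmetry; apply rsum_sum_n|exact H].
Qed.

Lemma rsum_le_Series (a : nat -> R) (n : nat) :
  (forall k, 0 <= a k) -> ex_series a -> rsum a n <= Series a.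
Proof.
intros Ha He. apply Series_correct, is_series_rsum in He.
apply (is_lim_seq_incr_compare (rsum a) (Series a)); [exact He|].
intros k; simpl; generalize (Ha k); lra.
Qed.

Definition Csums (a : nat -> C) (l : C) : Prop := Clim (csum a) l.

Lemma is_series_Csums (a : nat -> C) (l : C) :
  is_series (K := C_AbsRing) (V := C_NormedModule) a l <-> Csums a l.
Proof.
unfold Csums; rewrite <- Clim_incr. unfold Clim, is_series.
rewrite (filterlim_locally_ball_norm (U := C_NormedModule)).
rewrite <- (is_lim_seq_spec _ (Finite 0)).
split; intros H eps; destruct (H eps) as [N HN]; exists N; intros n Hn; specialize (HN n Hn).
- rewrite Rminus_0_r, Rabs_pos_eq by apply Cmod_ge_0.
  rewrite <- csum_sum_n; exact HN.
- rewrite Rminus_0_r, Rabs_pos_eq in HN by apply Cmod_ge_0.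
  rewrite <- csum_sum_n in HN; exact HN.
Qed.

Lemma Csums_comp (a : nat -> C) (l : C) :
  Csums a l <-> is_series (fun n => Re (a n)) (Re l) /\ is_series (fun n => Im (a n)) (Im l).
Proof.
unfold Csums; rewrite Clim_comp, !is_series_rsum.
split; intros [H1 H2]; split.
- eapply is_lim_seq_ext; [|exact H1]; intros; apply Re_csum.
- eapply is_lim_seq_ext; [|exact H2]; intros; apply Im_csum.
- eapply is_lim_seq_ext; [|exact H1]; intros; symmetry; apply Re_csum.
- eapply is_lim_seq_ext; [|exact H2]; intros; symmetry; apply Im_csum.
Qed.

Lemma Csums_ext (a b : nat -> C) (l : C) :
  (forall n, a n = b n) -> Csums a l -> Csums b l.
Proof. intros H; apply Clim_ext; intros n; apply csum_ext; auto. Qed.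

Lemma Csums_unique (a : nat -> C) (l m : C) : Csums a l -> Csums a m -> l = m.
Proof. apply Clim_unique. Qed.

Lemma Csums_plus (a b : nat -> C) (l m : C) :
  Csums a l -> Csums b m -> Csums (fun n => a n + b n)%C (l + m)%C.
Proof.
intros H1 H2. apply Clim_ext with (fun n => csum a n + csum b n)%C.
- intros; symmetry; apply csum_plus.
- apply Clim_plus; assumption.
Qed.

Lemma Csums_scal (c : C) (a : nat -> C) (l : C) :
  Csums a l -> Csums (fun n => c * a n)%C (c * l)%C.
Proof.
intros H. apply Clim_ext with (fun n => c * csum a n)%C.
- intros; symmetry; apply csum_scal.
- apply Clim_scal; assumption.
Qed.

Lemma Csums_zero : Csums (fun _ => RtoC 0) 0.
Proof.
apply Clim_ext with (fun _ => RtoC 0); [intros; symmetry; apply csum_zero|apply Clim_const].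
Qed.

Lemma csum_head (a : nat -> C) (n : nat) :
  csum a (S n) = (a 0%nat + csum (fun k => a (S k)) n)%C.
Proof. induction n as [|n IH]; [simpl; ring|]. change (csum a (S (S n))) with (csum a (S n) + a (S n))%C; rewrite IH; simpl; ring. Qed.

Lemma Csums_tail (a : nat -> C) (l : C) :
  Csums (fun n => a (S n)) l <-> Csums a (a 0%nat + l)%C.
Proof.
unfold Csums. rewrite <- (Clim_incr (csum a)). split; intros H.
- apply Clim_ext with (fun n => a 0%nat + csum (fun k => a (S k)) n)%C;
    [intros; symmetry; apply csum_head|].
  apply Clim_plus; [apply Clim_const|exact H].
- apply Clim_ext with (fun n => csum a (S n) - a 0%nat)%C;
    [intros; rewrite csum_head; ring|].
  replace l with (a 0%nat + l - a 0%nat)%C by ring.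
  apply Clim_minus; [exact H|apply Clim_const].
Qed.

Lemma Csums_abs (a : nat -> C) (b : nat -> R) :
  (forall n, Cmod (a n) <= b n) -> ex_series b ->
  exists l, Csums a l /\ Cmod l <= Series b.
Proof.
intros H Hb.
assert (HR : ex_series (fun n => Re (a n))).
{ apply (ex_series_le (V := R_CompleteNormedModule)) with b; [|exact Hb].
  intros n; eapply Rle_trans; [apply re_le_Cmod|apply H]. }
assert (HI : ex_series (fun n => Im (a n))).
{ apply (ex_series_le (V := R_CompleteNormedModule)) with b; [|exact Hb].
  intros n; eapply Rle_trans; [apply im_le_Cmod|apply H]. }
destruct HR as [x Hx], HI as [y Hy].
assert (HS : Csums a (x, y)) by (apply Csums_comp; split; assumption).
exists (x, y); split; [exact HS|].
apply Clim_bound with (csum a) 0%nat; [exact HS|].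
intros n _. eapply Rle_trans; [apply Cmod_csum|].
apply Rle_trans with (rsum b n); [apply rsum_le; auto|].
apply rsum_le_Series; [|exact Hb].
intros k; eapply Rle_trans; [apply Cmod_ge_0|apply H].
Qed.

Lemma Csums_bound (a : nat -> C) (b : nat -> R) (l : C) :
  (forall n, Cmod (a n) <= b n) -> ex_series b -> Csums a l -> Cmod l <= Series b.
Proof.
intros H Hb Hl. destruct (Csums_abs a b H Hb) as [m [Hm Hm']].
rewrite (Csums_unique a l m Hl Hm); exact Hm'.
Qed.

Lemma ex_series_rtail (b : nat -> R) (N : nat) :
  ex_series b -> ex_series (fun k => b (N + k)%nat).
Proof. apply (ex_series_incr_n b N). Qed.

(** The tail of the dominating real series bounds the tail of the complex one, uniformly in every
    parameter on which [b] does not depend. *)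
Lemma Csums_partial_error (a : nat -> C) (b : nat -> R) (l : C) (N : nat) :
  (forall n, Cmod (a n) <= b n) -> ex_series b -> Csums a l ->
  Cmod (l - csum a N)%C <= Series b - rsum b N.
Proof.
intros H Hb Hl.
apply Clim_bound with (fun n => csum a (N + n) - csum a N)%C 0%nat.
- apply Clim_minus; [|apply Clim_const].
  apply Clim_ext with (fun n => csum a (n + N)); [intros; f_equal; lia|].
  apply Clim_incr_n, Hl.
- intros n _. rewrite csum_add.
  replace (csum a N + csum (fun k => a (N + k)%nat) n - csum a N)%C
    with (csum (fun k => a (N + k)%nat) n) by ring.
  assert (E : forall m, rsum b (N + m) = rsum b N + rsum (fun k => b (N + k)%nat) m).
  { induction m as [|m IH]; simpl; [rewrite Nat.add_0_r; ring|].
    rewrite Nat.add_succ_r; simpl; rewrite IH; ring. }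
  assert (L := rsum_le_Series b (N + n)
    (fun k => Rle_trans _ _ _ (Cmod_ge_0 (a k)) (H k)) Hb).
  rewrite E in L.
  eapply Rle_trans; [apply Cmod_csum|].
  apply Rle_trans with (rsum (fun k => b (N + k)%nat) n); [apply rsum_le; auto|lra].
Qed.

Lemma tail_lim (b : nat -> R) : ex_series b -> is_lim_seq (fun N => Series b - rsum b N) 0.
Proof.
intros Hb. apply Series_correct, is_series_rsum in Hb.
replace (Finite 0) with (Finite (Series b - Series b)) by (f_equal; ring).
apply is_lim_seq_minus'; [apply is_lim_seq_const|exact Hb].
Qed.

Definition cauchy_prod (a b : nat -> C) (n : nat) : C :=
  csum (fun k => a k * b (n - k)%nat)%C (S n).

Lemma rsum_sum_f_R0 (f : nat -> R) (n : nat) : sum_f_R0 f n = rsum f (S n).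
Proof. induction n as [|n IH]; simpl; [ring|rewrite IH; reflexivity]. Qed.

Lemma rsum_plus (f g : nat -> R) (n : nat) :
  rsum (fun k => f k + g k) n = rsum f n + rsum g n.
Proof. induction n as [|n IH]; simpl; [|rewrite IH]; ring. Qed.

(** Real and imaginary parts of the product are combinations of four Cauchy products of absolutely
    convergent real series. *)
Lemma Csums_mult (a b : nat -> C) (l m : C) :
  Csums a l -> Csums b m ->
  ex_series (fun n => Cmod (a n)) -> ex_series (fun n => Cmod (b n)) ->
  Csums (cauchy_prod a b) (l * m)%C.
Proof.
intros Ha Hb Aa Ab.
apply Csums_comp in Ha; apply Csums_comp in Hb.
destruct Ha as [Ha1 Ha2], Hb as [Hb1 Hb2].
assert (G : forall (f : C -> R) (u : nat -> C), (forall z, Rabs (f z) <= Cmod z) ->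
  ex_series (fun n => Cmod (u n)) -> ex_series (fun n => Rabs (f (u n)))).
{ intros f u Hf Hu. apply (ex_series_le (V := R_CompleteNormedModule)) with (2 := Hu).
  intros n; change (Rabs (Rabs (f (u n))) <= Cmod (u n)); rewrite Rabs_Rabsolu; apply Hf. }
assert (Q : forall (f g : C -> R) (x y : R), (forall z, Rabs (f z) <= Cmod z) ->
  (forall z, Rabs (g z) <= Cmod z) ->
  is_series (fun n => f (a n)) x -> is_series (fun n => g (b n)) y ->
  is_series (fun n => sum_f_R0 (fun k => f (a k) * g (b (n - k)%nat)) n) (x * y)).
{ intros f g x y Hf Hg Hx Hy.
  apply (is_series_mult (fun k => f (a k)) (fun k => g (b k)) x y Hx Hy); apply G; assumption. }
assert (B1 := re_le_Cmod). assert (B2 := im_le_Cmod).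
apply Csums_comp; split.
- rewrite Re_mult.
  apply is_series_ext with (fun n =>
    sum_f_R0 (fun k => Re (a k) * Re (b (n - k)%nat)) n
    - sum_f_R0 (fun k => Im (a k) * Im (b (n - k)%nat)) n).
  + intros n. unfold cauchy_prod. rewrite Re_csum, !rsum_sum_f_R0.
    rewrite (rsum_ext (fun k => Re (a k * b (n - k)%nat)%C)
      (fun k => Re (a k) * Re (b (n - k)%nat) + (-1) * (Im (a k) * Im (b (n - k)%nat))))
      by (intros k _; cbv beta; rewrite ?Re_mult, ?Im_mult; ring).
    rewrite rsum_plus, rsum_scal.
    toR; ring.
  + apply (is_series_minus (V := R_NormedModule)
      (fun n => sum_f_R0 (fun k => Re (a k) * Re (b (n - k)%nat)) n)
      (fun n => sum_f_R0 (fun k => Im (a k) * Im (b (n - k)%nat)) n)); apply Q; assumption.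
- rewrite Im_mult.
  apply is_series_ext with (fun n =>
    sum_f_R0 (fun k => Re (a k) * Im (b (n - k)%nat)) n
    + sum_f_R0 (fun k => Im (a k) * Re (b (n - k)%nat)) n).
  + intros n. unfold cauchy_prod. rewrite Im_csum, !rsum_sum_f_R0.
    rewrite (rsum_ext (fun k => Im (a k * b (n - k)%nat)%C)
      (fun k => Re (a k) * Im (b (n - k)%nat) + Im (a k) * Re (b (n - k)%nat)))
      by (intros k _; cbv beta; rewrite ?Re_mult, ?Im_mult; ring).
    symmetry; apply rsum_plus.
  + apply (is_series_plus (V := R_NormedModule)
      (fun n => sum_f_R0 (fun k => Re (a k) * Im (b (n - k)%nat)) n)
      (fun n => sum_f_R0 (fun k => Im (a k) * Re (b (n - k)%nat)) n)); apply Q; assumption.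
Qed.

(** * Complex-valued functions of a real variable and the complex exponential *)

Lemma exp_mono (x y : R) : x <= y -> exp x <= exp y.
Proof. intros [H|H]; [left; apply exp_increasing, H|rewrite H; lra]. Qed.

Lemma nondecreasing_of_derive (g g' : R -> R) (a b : R) :
  a <= b -> (forall x, a <= x <= b -> is_derive g x (g' x)) ->
  (forall x, a <= x <= b -> 0 <= g' x) -> g a <= g b.
Proof.
intros Hab Hg Hp.
destruct (MVT_gen g a b g') as [c [Hc E]].
- intros x Hx; rewrite Rmin_left, Rmax_right in Hx by lra; apply Hg; lra.
- intros x Hx; rewrite Rmin_left, Rmax_right in Hx by lra.
  apply continuity_pt_filterlim.
  apply (ex_derive_continuous g x). exists (g' x); apply Hg; lra.
- rewrite Rmin_left, Rmax_right in Hc by lra.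
  assert (0 <= g' c * (b - a)) by (apply Rmult_le_pos; [apply Hp|]; lra). lra.
Qed.

(** The derivative is taken componentwise, so that the calculus of real functions suffices. *)
Definition cder (f : R -> C) (x : R) (l : C) : Prop :=
  is_derive (fun t => Re (f t)) x (Re l) /\ is_derive (fun t => Im (f t)) x (Im l).

Lemma cder_eq (f : R -> C) (x : R) (l m : C) : cder f x l -> l = m -> cder f x m.
Proof. intros H <-; exact H. Qed.

Lemma cder_ext (f g : R -> C) (x : R) (l : C) :
  (forall t, f t = g t) -> cder f x l -> cder g x l.
Proof.
intros H [H1 H2]; split; eapply is_derive_ext; try eassumption;
  intros t; cbv beta; rewrite H; reflexivity.
Qed.


Lemma cder_const (c : C) (x : R) : cder (fun _ => c) x 0.
Proof.
split; [exact (is_derive_const (V := R_NormedModule) (Re c) x)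
  |exact (is_derive_const (V := R_NormedModule) (Im c) x)].
Qed.

Lemma cder_real (f : R -> R) (x l : R) : is_derive f x l -> cder (fun t => RtoC (f t)) x (RtoC l).
Proof. intros H; split; [exact H|exact (is_derive_const (V := R_NormedModule) 0 x)]. Qed.

Lemma cder_plus (f g : R -> C) (x : R) (l m : C) :
  cder f x l -> cder g x m -> cder (fun t => f t + g t)%C x (l + m)%C.
Proof.
intros [H1 H2] [H3 H4]; split.
- apply (is_derive_plus (V := R_NormedModule) (fun t => Re (f t)) (fun t => Re (g t)));
    assumption.
- apply (is_derive_plus (V := R_NormedModule) (fun t => Im (f t)) (fun t => Im (g t)));
    assumption.
Qed.

Lemma cder_mult (f g : R -> C) (x : R) (l m : C) :
  cder f x l -> cder g x m -> cder (fun t => f t * g t)%C x (l * g x + f x * m)%C.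
Proof.
intros [H1 H2] [H3 H4]; split.
- eapply is_derive_ext; [intros t; symmetry; apply Re_mult|].
  replace (Re (l * g x + f x * m)%C) with
    ((Re l * Re (g x) + Re (f x) * Re m) - (Im l * Im (g x) + Im (f x) * Im m))
    by (autorewrite with cre; ring).
  apply (is_derive_minus (V := R_NormedModule)
    (fun t => Re (f t) * Re (g t)) (fun t => Im (f t) * Im (g t)));
    apply Derive.is_derive_mult; assumption.
- eapply is_derive_ext; [intros t; symmetry; apply Im_mult|].
  replace (Im (l * g x + f x * m)%C) with
    ((Re l * Im (g x) + Re (f x) * Im m) + (Im l * Re (g x) + Im (f x) * Re m))
    by (autorewrite with cre; ring).
  apply (is_derive_plus (V := R_NormedModule)
    (fun t => Re (f t) * Im (g t)) (fun t => Im (f t) * Re (g t)));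
    apply Derive.is_derive_mult; assumption.
Qed.

Lemma cder_scal (c : C) (f : R -> C) (x : R) (l : C) :
  cder f x l -> cder (fun t => c * f t)%C x (c * l)%C.
Proof.
intros H. eapply cder_eq; [apply (cder_mult _ _ _ _ _ (cder_const c x) H)|]. ring.
Qed.

Lemma cder_minus (f g : R -> C) (x : R) (l m : C) :
  cder f x l -> cder g x m -> cder (fun t => f t - g t)%C x (l - m)%C.
Proof.
intros H1 H2. apply cder_ext with (fun t => f t + (-(1)) * g t)%C; [intros; ring|].
eapply cder_eq; [apply cder_plus; [exact H1|apply cder_scal, H2]|ring].
Qed.

Lemma cder_csum (f : nat -> R -> C) (x : R) (l : nat -> C) (n : nat) :
  (forall k, (k < n)%nat -> cder (f k) x (l k)) ->
  cder (fun t => csum (fun k => f k t) n) x (csum l n).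
Proof.
induction n as [|n IH]; intros H; simpl; [apply cder_const|].
apply cder_plus; [apply IH; intros|]; apply H; lia.
Qed.

Lemma cder_exp (f : R -> C) (x : R) (l : C) :
  cder f x l -> cder (fun t => Cexp (f t)) x (l * Cexp (f x))%C.
Proof.
intros [H1 H2].
assert (E : is_derive (fun t => exp (Re (f t))) x (Re l * exp (Re (f x)))).
{ apply (is_derive_comp exp (fun t => Re (f t))); [apply is_derive_exp|exact H1]. }
split.
- unfold Cexp.
  apply is_derive_ext with (fun t => exp (Re (f t)) * cos (Im (f t))); [reflexivity|].
  replace (Re (l * _)%C) with (Re l * exp (Re (f x)) * cos (Im (f x))
      + exp (Re (f x)) * (Im l * - sin (Im (f x))))
    by (autorewrite with cre; ring).
  apply (Derive.is_derive_mult (fun t => exp (Re (f t))) (fun t => cos (Im (f t)))); [exact E|].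
  apply (is_derive_comp cos (fun t => Im (f t))); [apply is_derive_cos|exact H2].
- unfold Cexp.
  apply is_derive_ext with (fun t => exp (Re (f t)) * sin (Im (f t))); [reflexivity|].
  replace (Im (l * _)%C) with (Re l * exp (Re (f x)) * sin (Im (f x))
      + exp (Re (f x)) * (Im l * cos (Im (f x))))
    by (autorewrite with cre; ring).
  apply (Derive.is_derive_mult (fun t => exp (Re (f t))) (fun t => sin (Im (f t)))); [exact E|].
  apply (is_derive_comp sin (fun t => Im (f t))); [apply is_derive_sin|exact H2].
Qed.

(** Cauchy-Schwarz in the plane, read off from the real part of conj(z) w. *)
Lemma Re_conj_le (z w : C) : Re z * Re w + Im z * Im w <= Cmod z * Cmod w.
Proof.
rewrite <- (Cmod_conj z), <- Cmod_mult.
eapply Rle_trans; [|apply Re_le_Cmod].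
unfold Cconj; rewrite Re_mult; unfold Re, Im; simpl; lra.
Qed.

(* The vector-valued function is projected onto the direction [f b - f a]. *)
Lemma cmvt (f f' : R -> C) (g g' : R -> R) (a b : R) :
  a <= b -> (forall x, a <= x <= b -> cder f x (f' x)) ->
  (forall x, a <= x <= b -> is_derive g x (g' x)) ->
  (forall x, a <= x <= b -> Cmod (f' x) <= g' x) ->
  Cmod (f b - f a)%C <= g b - g a.
Proof.
intros Hab Hf Hg Hle.
set (D := (f b - f a)%C).
assert (Hmon : g a <= g b).
{ apply nondecreasing_of_derive with g'; auto.
  intros x Hx; eapply Rle_trans; [apply Cmod_ge_0|apply Hle, Hx]. }
assert (H : Cmod D * g a - (Re D * Re (f a) + Im D * Im (f a))
         <= Cmod D * g b - (Re D * Re (f b) + Im D * Im (f b))).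
{ apply (nondecreasing_of_derive
    (fun x => Cmod D * g x - (Re D * Re (f x) + Im D * Im (f x)))
    (fun x => Cmod D * g' x - (Re D * Re (f' x) + Im D * Im (f' x)))); [exact Hab| |].
  - intros x Hx. destruct (Hf x Hx) as [H1 H2].
    apply (is_derive_minus (V := R_NormedModule) (fun x => Cmod D * g x)
      (fun x => Re D * Re (f x) + Im D * Im (f x))).
    + apply (is_derive_scal g); apply Hg, Hx.
    + apply (is_derive_plus (V := R_NormedModule) (fun x => Re D * Re (f x))
        (fun x => Im D * Im (f x))).
      * apply (is_derive_scal (fun x => Re (f x))); exact H1.
      * apply (is_derive_scal (fun x => Im (f x))); exact H2.
  - intros x Hx. generalize (Re_conj_le D (f' x)).
    assert (Cmod D * Cmod (f' x) <= Cmod D * g' x)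
      by (apply Rmult_le_compat_l; [apply Cmod_ge_0|apply Hle, Hx]). lra. }
assert (HD : Cmod D * Cmod D <= Cmod D * (g b - g a)).
{ replace (Cmod D * Cmod D) with (Re D * Re D + Im D * Im D)
    by (generalize (Cmod2_alt D); simpl; lra).
  replace (Re D) with (Re (f b) - Re (f a)) in * by (unfold D; autorewrite with cre; ring).
  replace (Im D) with (Im (f b) - Im (f a)) in * by (unfold D; autorewrite with cre; ring).
  lra. }
destruct (Cmod_ge_0 D) as [Hp|Hz].
- apply Rmult_le_reg_l with (Cmod D); assumption.
- rewrite <- Hz; lra.
Qed.

Lemma Cexp_plus (z w : C) : Cexp (z + w)%C = (Cexp z * Cexp w)%C.
Proof.
unfold Cexp; apply Ceq; autorewrite with cre; rewrite exp_plus; [rewrite cos_plus|rewrite sin_plus]; ring.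
Qed.

Lemma Cexp_0 : Cexp 0 = 1.
Proof. unfold Cexp; apply Ceq; simpl; rewrite exp_0, ?cos_0, ?sin_0; simpl; ring. Qed.

Lemma Cmod_Cexp (z : C) : Cmod (Cexp z) = exp (Re z).
Proof.
unfold Cmod, Cexp; simpl.
replace (_ + _) with (exp (Re z) * exp (Re z)).
- apply sqrt_square; left; apply exp_pos.
- generalize (sin2_cos2 (Im z)); unfold Rsqr; intros E.
  transitivity (exp (Re z) * exp (Re z) * (sin (Im z) * sin (Im z) + cos (Im z) * cos (Im z)));
    [rewrite E|]; ring.
Qed.

Lemma Cexp_nz (z : C) : Cexp z <> 0.
Proof. apply Cmod_gt_0; rewrite Cmod_Cexp; apply exp_pos. Qed.

Lemma Cexp_opp (z : C) : Cexp (- z)%C = (/ Cexp z)%C.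
Proof.
assert (H : (Cexp z * Cexp (- z))%C = 1)
  by (rewrite <- Cexp_plus, <- Cexp_0; f_equal; ring).
replace (Cexp (- z)) with (/ Cexp z * (Cexp z * Cexp (- z)))%C
  by (field; apply Cexp_nz). rewrite H; ring.
Qed.

Lemma Cexp_RtoC (x : R) : Cexp (RtoC x) = RtoC (exp x).
Proof. unfold Cexp; apply Ceq; simpl; rewrite ?cos_0, ?sin_0; simpl; ring. Qed.

Definition exp_term (z : C) (k : nat) : C := (z ^ k / RtoC (INR (fact k)))%C.

Lemma INR_fact_nz (k : nat) : RtoC (INR (fact k)) <> 0.
Proof. apply RtoC_nz, INR_fact_neq_0. Qed.

Lemma is_derive_pow_fact (c x : R) (j : nat) :
  is_derive (fun t => (t * c) ^ S j / INR (fact (S j))) x (c * ((x * c) ^ j / INR (fact j))).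
Proof.
assert (E : INR (fact (S j)) = INR (S j) * INR (fact j)) by (rewrite fact_simpl, mult_INR; reflexivity).
apply is_derive_ext with (fun t => / INR (fact (S j)) * (t * c) ^ S j);
  [intros; unfold Rdiv; apply Rmult_comm|].
replace (c * _) with (/ INR (fact (S j)) * (INR (S j) * c * (x * c) ^ pred (S j))).
- apply (is_derive_scal (fun t => (t * c) ^ S j)).
  apply (is_derive_pow (fun t => t * c) (S j)). auto_derive; [exact I|ring].
- rewrite E, Nat.pred_succ. field. split; [apply INR_fact_neq_0|apply not_0_INR; lia].
Qed.

(** Along the segment t z, the derivative in t of the remainder of order n + 1 is z times the
    remainder of order n. The claim is therefore proved for all t in [0, 1] by induction on n, with
    the mean value inequality in place of an integral. *)
Lemma Cexp_taylor (z : C) (n : nat) :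
  Cmod (Cexp z - csum (exp_term z) n)%C <= exp (Cmod z) * (Cmod z ^ n / INR (fact n)).
Proof.
assert (G : forall t, 0 <= t <= 1 ->
  Cmod (Cexp (t * z) - csum (fun k => RtoC (t ^ k / INR (fact k)) * z ^ k) n)%C
  <= exp (Cmod z) * ((t * Cmod z) ^ n / INR (fact n))).
{ induction n as [|n IH]; intros t Ht.
  - simpl. replace (Cexp (t * z) - 0)%C with (Cexp (t * z)) by ring.
    rewrite Cmod_Cexp, Rdiv_1_r, Rmult_1_r.
    apply exp_mono. autorewrite with cre.
    assert (0 <= Cmod z) by apply Cmod_ge_0.
    assert (Re z <= Cmod z) by apply Re_le_Cmod. nra.
  - pose (F := fun t : R => (Cexp (t * z) - csum (fun k => RtoC (t ^ k / INR (fact k)) * z ^ k) (S n))%C).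
    pose (G := fun t : R => exp (Cmod z) * ((t * Cmod z) ^ (S n) / INR (fact (S n)))).
    assert (F0 : F 0 = 0).
    { unfold F. rewrite csum_head, (csum_ext _ (fun _ => RtoC 0)), csum_zero.
      - replace (0 * z)%C with (RtoC 0) by ring. rewrite Cexp_0. simpl.
        unfold Rdiv; rewrite Rinv_1, Rmult_1_r; ring.
      - intros k _. simpl. rewrite Rmult_0_l. unfold Rdiv; rewrite Rmult_0_l; ring. }
    assert (G0 : G 0 = 0) by (unfold G; simpl; unfold Rdiv; ring).
    enough (Cmod (F t - F 0)%C <= G t - G 0).
    { rewrite F0, G0 in H. change (Cmod (F t) <= G t).
      replace (F t - 0)%C with (F t) in H by ring. lra. }
    apply cmvt with
      (fun t : R => z * (Cexp (t * z) - csum (fun k => RtoC (t ^ k / INR (fact k)) * z ^ k) n))%C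
      (fun t => Cmod z * (exp (Cmod z) * ((t * Cmod z) ^ n / INR (fact n)))); [lra| | |].
    + intros x Hx. unfold F.
      (* Differentiation kills the constant term and moves every other coefficient down by one. *)
      apply cder_eq with (z * Cexp (x * z) - csum (fun k => match k with
          | O => RtoC 0 | S j => RtoC (x ^ j / INR (fact j)) * z ^ S j end) (S n))%C.
      * apply cder_minus.
        -- apply cder_exp. apply cder_ext with (fun t : R => z * RtoC t)%C; [intros; ring|].
           apply cder_eq with (z * RtoC 1)%C; [|ring].
           apply cder_scal, (cder_real (fun t => t)), (is_derive_id (K := R_AbsRing)).
        -- apply (cder_csum (fun k t => RtoC (t ^ k / INR (fact k)) * z ^ k)%C).
           intros [|j] _.
           ++ apply cder_ext with (fun _ => RtoC 1); [|apply cder_const].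
              intros; simpl; unfold Rdiv; rewrite Rinv_1, Rmult_1_r; ring.
           ++ apply cder_ext with (fun t : R => z ^ S j * RtoC (t ^ S j / INR (fact (S j))))%C;
                [intros; ring|].
              apply cder_eq with (z ^ S j * RtoC (x ^ j / INR (fact j)))%C; [|ring].
              apply cder_scal, cder_real.
              generalize (is_derive_pow_fact 1 x j); rewrite Rmult_1_l, Rmult_1_r.
              apply is_derive_ext; intros t0; rewrite Rmult_1_r; reflexivity.
      * rewrite csum_head.
        rewrite (csum_ext _ (fun k => z * (RtoC (x ^ k / INR (fact k)) * z ^ k))%C)
          by (intros; rewrite Cpow_S; ring).
        rewrite csum_scal. ring.
    + intros x Hx. unfold G.
      replace (Cmod z * _) with
        (exp (Cmod z) * (Cmod z * ((x * Cmod z) ^ n / INR (fact n)))) by ring.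
      apply (is_derive_scal (fun t => (t * Cmod z) ^ S n / INR (fact (S n)))).
      apply is_derive_pow_fact.
    + intros x Hx. rewrite Cmod_mult. apply Rmult_le_compat_l; [apply Cmod_ge_0|apply IH; lra]. }
specialize (G 1 ltac:(lra)). rewrite Rmult_1_l in G.
replace (1 * z)%C with z in G by ring.
erewrite csum_ext; [exact G|].
intros k _. cbv beta. unfold exp_term. rewrite pow1, RtoC_div by apply INR_fact_neq_0. 
field. apply INR_fact_nz.
Qed.

(** * Functions given by a power series on a disc *)

Definition has_pser (a : nat -> C) (f : C -> C) (c : C) (r : R) : Prop :=
  forall z, Cmod (z - c)%C < r -> Csums (fun n => a n * (z - c) ^ n)%C (f z).

(** The radius is kept explicit because a limit of analytic functions is analytic only if all terms
    share one disc. *)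
Definition an (f : C -> C) (c : C) (r : R) : Prop := 0 < r /\ exists a, has_pser a f c r.

Lemma pow_n_Cpow (z : C) (n : nat) : pow_n (K := C_AbsRing) z n = (z ^ n)%C.
Proof. induction n as [|n IH]; [reflexivity|]. simpl; rewrite IH; reflexivity. Qed.

Lemma analytic_at_an (f : C -> C) (c : C) : analytic_at f c <-> exists r, an f c r.
Proof.
assert (G : forall a z l, is_pseries (K := C_AbsRing) (V := C_NormedModule) a z l <->
  Csums (fun n => a n * z ^ n)%C l).
{ intros a z l. unfold is_pseries. rewrite is_series_Csums.
  assert (E : forall n, scal (K := C_AbsRing) (V := C_NormedModule)
    (pow_n (K := C_AbsRing) z n) (a n) = (a n * z ^ n)%C)
    by (intros n; rewrite pow_n_Cpow; exact (Cmult_comm _ _)).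
  split; apply Csums_ext; intros n; [|symmetry]; apply E. }
split.
- intros (a & r & Hr & H). exists r; split; [exact Hr|]. exists a; intros z Hz.
  apply G, H, Hz.
- intros (r & Hr & a & H). exists a, r; split; [exact Hr|]. intros z Hz.
  apply G, H, Hz.
Qed.

Lemma an_shrink (f : C -> C) (c : C) (r s : R) : an f c r -> 0 < s <= r -> an f c s.
Proof.
intros [Hr [a Ha]] Hs; split; [lra|]. exists a; intros z Hz; apply Ha; lra.
Qed.

Lemma an_ext (f g : C -> C) (c : C) (r : R) :
  (forall z, Cmod (z - c)%C < r -> f z = g z) -> an f c r -> an g c r.
Proof.
intros E [Hr [a Ha]]; split; [exact Hr|]. exists a; intros z Hz.
rewrite <- E by exact Hz; apply Ha, Hz.
Qed.

Lemma Clim_bounded (u : nat -> C) (l : C) : Clim u l -> exists B, forall n, Cmod (u n) <= B.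
Proof.
intros H. apply is_lim_seq_Reals in H.
destruct (maj_by_pos _ (exist _ 0 H)) as [B [_ HB]].
exists (B + Cmod l); intros n. specialize (HB n).
rewrite Rabs_pos_eq in HB by apply Cmod_ge_0.
generalize (Cmod_triangle_inv (u n) l); lra.
Qed.

Lemma Csums_terms_bounded (a : nat -> C) (l : C) :
  Csums a l -> exists B, 0 <= B /\ forall n, Cmod (a n) <= B.
Proof.
intros H. destruct (Clim_bounded _ _ H) as [B HB].
exists (B + B); split.
- generalize (HB 0%nat) (Cmod_ge_0 (csum a 0)); lra.
- intros n. replace (a n) with (csum a (S n) - csum a n)%C by (simpl; ring).
  eapply Rle_trans; [apply Cmod_triangle|]. rewrite Cmod_opp.
  generalize (HB n) (HB (S n)); lra.
Qed.

Lemma ex_series_geom_scal (B q : R) : 0 <= q < 1 -> ex_series (fun n => B * q ^ n).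
Proof.
intros Hq. apply Rex_series_scal. exists (/ (1 - q)). apply is_series_geom. rewrite Rabs_pos_eq; lra.
Qed.

Lemma Rex_series_le (a b : nat -> R) :
  (forall n, 0 <= a n <= b n) -> ex_series b -> ex_series a.
Proof.
intros H. apply (ex_series_le (V := R_CompleteNormedModule)).
intros n; change (Rabs (a n) <= b n); rewrite Rabs_pos_eq; apply H.
Qed.

(** The terms are bounded at a radius halfway between [rho] and [r]; at [rho] they are then
    dominated by a geometric series. *)
Lemma has_pser_abs (a : nat -> C) (f : C -> C) (c : C) (r rho : R) :
  has_pser a f c r -> 0 <= rho < r -> ex_series (fun n => Cmod (a n) * rho ^ n).
Proof.
intros H Hrho. set (s := (rho + r) / 2).
assert (Hs : rho < s < r) by (unfold s; lra).
assert (E : (c + RtoC s - c)%C = RtoC s) by ring.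
assert (Hz : Cmod (c + RtoC s - c)%C < r) by (rewrite E, Cmod_R, Rabs_pos_eq; lra).
destruct (Csums_terms_bounded _ _ (H _ Hz)) as [B [HB0 HB]].
apply Rex_series_le with (fun n => B * (rho / s) ^ n).
- intros n; split.
  + apply Rmult_le_pos; [apply Cmod_ge_0|apply pow_le; lra].
  + specialize (HB n). rewrite E, Cmod_mult, Cmod_pow, Cmod_R, Rabs_pos_eq in HB by lra.
    replace (rho ^ n) with (s ^ n * (rho / s) ^ n)
      by (rewrite <- Rpow_mult_distr; f_equal; field; lra).
    rewrite <- Rmult_assoc. apply Rmult_le_compat_r; [|exact HB].
    apply pow_le, Rdiv_le_0_compat; lra.
- apply ex_series_geom_scal; split; [apply Rdiv_le_0_compat; lra|].
  apply Rlt_div_l; lra.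
Qed.

Lemma an_const (k c : C) (r : R) : 0 < r -> an (fun _ => k) c r.
Proof.
intros Hr; split; [exact Hr|]. exists (fun n => match n with O => k | _ => RtoC 0 end).
intros z _. apply Clim_incr. apply Clim_ext with (fun _ => k); [|apply Clim_const].
intros n. rewrite csum_head, (csum_ext _ (fun _ => RtoC 0)), csum_zero; [simpl; ring|].
intros; ring.
Qed.

Lemma an_plus (f g : C -> C) (c : C) (r : R) :
  an f c r -> an g c r -> an (fun z => f z + g z)%C c r.
Proof.
intros [Hr [a Ha]] [_ [b Hb]]; split; [exact Hr|]. exists (fun n => a n + b n)%C.
intros z Hz. apply Csums_ext with (fun n => a n * (z - c) ^ n + b n * (z - c) ^ n)%C;
  [intros; ring|]. apply Csums_plus; auto.
Qed.

Lemma an_mult (f g : C -> C) (c : C) (r : R) :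
  an f c r -> an g c r -> an (fun z => f z * g z)%C c r.
Proof.
intros [Hr [a Ha]] [_ [b Hb]]; split; [exact Hr|]. exists (cauchy_prod a b).
intros z Hz.
assert (P : 0 <= Cmod (z - c)%C < r) by (split; [apply Cmod_ge_0|exact Hz]).
apply Csums_ext with
  (cauchy_prod (fun n => a n * (z - c) ^ n)%C (fun n => b n * (z - c) ^ n)%C).
- intros n. unfold cauchy_prod. rewrite Cmult_comm, <- csum_scal.
  apply csum_ext; intros k Hk. replace n with (k + (n - k))%nat at 3 by lia.
  rewrite Cpow_add_r; ring.
- apply Csums_mult; auto.
  + eapply ex_series_ext; [|apply (has_pser_abs _ _ _ _ _ Ha P)].
    intros n; cbv beta; rewrite Cmod_mult, Cmod_pow; reflexivity.
  + eapply ex_series_ext; [|apply (has_pser_abs _ _ _ _ _ Hb P)].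
    intros n; cbv beta; rewrite Cmod_mult, Cmod_pow; reflexivity.
Qed.

Lemma an_scal (k : C) (f : C -> C) (c : C) (r : R) : an f c r -> an (fun z => k * f z)%C c r.
Proof. intros H; apply an_mult; [apply an_const, H|exact H]. Qed.

Lemma an_minus (f g : C -> C) (c : C) (r : R) :
  an f c r -> an g c r -> an (fun z => f z - g z)%C c r.
Proof.
intros Hf Hg. apply an_ext with (fun z => f z + (-(1)) * g z)%C; [intros; ring|].
apply an_plus; [exact Hf|apply an_scal, Hg].
Qed.

Lemma an_id (c : C) (r : R) : 0 < r -> an (fun z => z) c r.
Proof.
intros Hr; split; [exact Hr|].
exists (fun n => match n with O => c | 1%nat => RtoC 1 | _ => RtoC 0 end).
intros z _. apply (Clim_incr_n 2). apply Clim_ext with (fun _ => z); [|apply Clim_const].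
intros n. replace (n + 2)%nat with (S (S n)) by lia.
rewrite 2!csum_head, (csum_ext _ (fun _ => RtoC 0)), csum_zero; [simpl; ring|].
intros; ring.
Qed.

Lemma exp_series_lim (x : R) : is_lim_seq (fun n => x ^ n / INR (fact n)) 0.
Proof. apply is_lim_seq_Reals, cv_speed_pow_fact. Qed.

Lemma Cexp_series (z : C) : Csums (exp_term z) (Cexp z).
Proof.
apply Clim_squeeze with (fun n => exp (Cmod z) * (Cmod z ^ n / INR (fact n))).
- intros n; rewrite Cmod_minus_sym; apply Cexp_taylor.
- apply is_lim_seq_scal_0, exp_series_lim.
Qed.

Lemma an_exp (k c : C) (r : R) : 0 < r -> an (fun z => Cexp (k * z)) c r.
Proof.
intros Hr; split; [exact Hr|].
exists (fun n => Cexp (k * c) * (k ^ n / RtoC (INR (fact n))))%C.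
intros z _. replace (k * z)%C with (k * c + k * (z - c))%C by ring. rewrite Cexp_plus.
apply Csums_ext with (fun n => Cexp (k * c) * exp_term (k * (z - c)) n)%C.
- intros n. unfold exp_term. rewrite Cpow_mult_l. field. apply INR_fact_nz.
- apply Csums_scal, Cexp_series.
Qed.

Lemma csum_geom (q : C) (n : nat) : ((1 - q) * csum (fun k => q ^ k)%C n)%C = (1 - q ^ n)%C.
Proof. 
induction n as [|n IH]; simpl; [ring|]. 
rewrite Cmult_plus_distr_l, IH; ring.
Qed.

Lemma Csums_geom (q : C) : Cmod q < 1 -> Csums (fun n => q ^ n)%C (/ (1 - q))%C.
Proof.
intros Hq.
assert (Hn : (1 - q)%C <> 0).
{ intros E. assert (q = 1) by (replace q with (1 - (1 - q))%C by ring; rewrite E; ring).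
  subst q; rewrite Cmod_1 in Hq; lra. }
apply Clim_squeeze with (fun n => / Cmod (1 - q) * Cmod q ^ n).
- intros n.
  replace (csum (fun k => q ^ k)%C n - / (1 - q))%C with (- (/ (1 - q) * q ^ n))%C.
  + rewrite Cmod_opp, Cmod_mult, Cmod_pow, Cmod_inv by exact Hn; lra.
  + replace (csum (fun k => q ^ k)%C n) with (/ (1 - q) * ((1 - q) * csum (fun k => q ^ k)%C n))%C
      by (field; exact Hn). rewrite csum_geom. field; exact Hn.
- apply is_lim_seq_scal_0, is_lim_seq_geom.
  rewrite Rabs_pos_eq; [exact Hq|apply Cmod_ge_0].
Qed.

(** Geometric series in (z - c) / (p - c), valid up to the distance from the centre to the pole. *)
Lemma an_inv (p c : C) (r : R) : 0 < r <= Cmod (p - c)%C -> an (fun z => / (z - p))%C c r.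
Proof.
intros Hr; split; [lra|].
assert (Hn : (p - c)%C <> 0) by (apply Cmod_gt_0; lra).
exists (fun n => - / (p - c) * (/ (p - c)) ^ n)%C.
intros z Hz.
assert (Hq : Cmod ((z - c) / (p - c))%C < 1)
  by (rewrite Cmod_div by exact Hn; apply Rlt_div_l; lra).
apply Csums_ext with (fun n => - / (p - c) * ((z - c) / (p - c)) ^ n)%C.
- intros n. unfold Cdiv. rewrite Cpow_mult_l. ring.
- replace (/ (z - p))%C with (- / (p - c) * / (1 - (z - c) / (p - c)))%C.
  + apply Csums_scal, Csums_geom, Hq.
  + assert ((z - p)%C <> 0).
    { apply Cmod_gt_0. generalize (Cmod_minus_le p z c).
      rewrite (Cmod_minus_sym p z). lra. }
    field. repeat split; try assumption.
    intros E. apply H. replace (z - p)%C with (- (p - c - (z - c)))%C by ring.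
    rewrite E; ring.
Qed.

Lemma Csums_csum (g : nat -> nat -> C) (l : nat -> C) (K : nat) :
  (forall k, (k < K)%nat -> Csums (fun n => g n k) (l k)) ->
  Csums (fun n => csum (g n) K) (csum l K).
Proof.
induction K as [|K IH]; intros H; simpl; [apply Csums_zero|].
apply Csums_plus; [apply IH; intros|]; apply H; lia.
Qed.

(** * Roots of unity and Cauchy's estimate *)

Definition expi (x : R) : C := Cexp (0, x).

Lemma expi_plus (x y : R) : expi (x + y) = (expi x * expi y)%C.
Proof.
unfold expi; rewrite <- Cexp_plus; f_equal; apply Ceq; autorewrite with cre; ring.
Qed.

Lemma expi_0 : expi 0 = 1.
Proof. unfold expi; change (0, 0) with (RtoC 0); apply Cexp_0. Qed.

Lemma Cmod_expi (x : R) : Cmod (expi x) = 1.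
Proof. unfold expi; rewrite Cmod_Cexp; apply exp_0. Qed.

Lemma expi_pow (x : R) (n : nat) : (expi x ^ n)%C = expi (INR n * x).
Proof.
induction n as [|n IH]; [simpl; rewrite Rmult_0_l; symmetry; apply expi_0|].
rewrite Cpow_S, IH, <- expi_plus; f_equal; rewrite S_INR; ring.
Qed.

Lemma expi_neq_1 (x : R) : x <> 0 -> - (2 * PI) < x < 2 * PI -> expi x <> 1.
Proof.
intros H0 Hx E. assert (E1 : cos x = 1).
{ transitivity (Re (expi x)); [unfold expi, Cexp; simpl; rewrite exp_0; ring|].
  rewrite E; reflexivity. }
replace x with (2 * (x / 2)) in E1 by field. rewrite cos_2a_sin in E1.
assert (S0 : sin (x / 2) = 0) by nra.
destruct (Rdichotomy _ _ H0) as [Hn|Hp].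
- assert (0 < sin (- (x / 2))) by (apply sin_gt_0; lra). rewrite sin_neg in H; lra.
- assert (0 < sin (x / 2)) by (apply sin_gt_0; lra). lra.
Qed.

(** Discrete orthogonality: for distinct [m] and [k] this is a geometric sum whose ratio is a [q]-th
    root of unity, different from 1 because |m - k| < q. *)
Lemma roots_of_unity_sum (q k m : nat) : (k < q)%nat -> (m < q)%nat ->
  csum (fun j => expi (INR j * (2 * PI * (INR m - INR k) / INR q))) q
  = if Nat.eq_dec m k then RtoC (INR q) else RtoC 0.
Proof.
intros Hk Hm.
assert (Hq : 0 < INR q) by (apply (lt_INR 0); lia).
destruct (Nat.eq_dec m k) as [->|Hne].
- rewrite (csum_ext _ (fun _ => RtoC 1)).
  + clear. induction q as [|q IH]; [reflexivity|].
    rewrite S_INR, RtoC_plus, <- IH; reflexivity.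
  + intros j _. replace (INR j * _) with 0 by (field; lra). apply expi_0.
- set (x := 2 * PI * (INR m - INR k) / INR q).
  rewrite (csum_ext _ (fun j => expi x ^ j)%C) by (intros; symmetry; apply expi_pow).
  assert (Hx : expi x <> 1).
  { assert (Hd : INR m - INR k <> 0) by (intros E; apply Hne, INR_eq; lra).
    assert (Hb : - INR q < INR m - INR k < INR q).
    { apply lt_INR in Hk; apply lt_INR in Hm.
      generalize (pos_INR k) (pos_INR m); lra. }
    assert (PI_p := PI_RGT_0).
    apply expi_neq_1; unfold x.
    - intros E. apply Hd. apply Rmult_eq_reg_l with (2 * PI / INR q).
      + rewrite Rmult_0_r, <- E; field; lra.
      + apply Rgt_not_eq. apply Rdiv_lt_0_compat; lra.
    - split.
      + apply Rlt_div_r; [lra|]. nra.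
      + apply Rlt_div_l; [lra|]. nra. }
  assert (E := csum_geom (expi x) q).
  assert (E1 : (expi x ^ q)%C = 1).
  { rewrite expi_pow. replace (INR q * x) with (2 * PI * (INR m - INR k)) by (unfold x; field; lra).
    assert (P : forall n : nat, expi (2 * PI * INR n) = 1).
    { assert (E1 : expi (2 * PI) = 1) by (unfold expi, Cexp; simpl; rewrite exp_0, cos_2PI, sin_2PI;
        apply Ceq; simpl; ring).
      intros n. rewrite Rmult_comm, <- expi_pow, E1, Cpow_1_l; reflexivity. }
    assert (E2 : (expi (2 * PI * (INR m - INR k)) * expi (2 * PI * INR k))%C = 1).
    { rewrite <- expi_plus. rewrite <- (P m). f_equal; ring. }
    rewrite (P k), Cmult_1_r in E2; exact E2. }
  rewrite E1 in E. replace (1 - 1)%C with (RtoC 0) in E by ring.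
  destruct (Ceq_dec (csum (fun k0 => expi x ^ k0)%C q) 0) as [Z|Z]; [exact Z|].
  exfalso. refine (Cmult_neq_0 (1 - expi x) _ _ Z E).
  intros Z1. apply Hx. replace (expi x) with (1 - (1 - expi x))%C by ring. rewrite Z1; ring.
Qed.

Lemma csum_single (f : nat -> C) (k n : nat) (v : C) : (k < n)%nat ->
  (forall m, (m < n)%nat -> f m = if Nat.eq_dec m k then v else RtoC 0) -> csum f n = v.
Proof.
intros Hk H. rewrite (csum_ext f (fun m => if Nat.eq_dec m k then v else RtoC 0)) by exact H.
clear H. induction n as [|n IH]; [lia|]. simpl.
destruct (Nat.eq_dec n k) as [E|E].
- rewrite (csum_ext _ (fun _ => RtoC 0)), csum_zero; [ring|].
  intros j Hj; destruct (Nat.eq_dec j k); [lia|reflexivity].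
- rewrite IH by lia; ring.
Qed.

Lemma rsum_const (c : R) (n : nat) : rsum (fun _ => c) n = INR n * c.
Proof. induction n as [|n IH]; [simpl; ring|]. rewrite S_INR; simpl; rewrite IH; ring. Qed.

(* Averaging over the [q]-th roots of unity isolates the [k]-th coefficient of the Taylor
   polynomial of degree less than [q]. *)
Lemma cauchy_estimate (a : nat -> C) (f : C -> C) (c : C) (r rho M : R) (k : nat) :
  has_pser a f c r -> 0 <= rho < r ->
  (forall z, Cmod (z - c)%C < r -> Cmod (f z) <= M) -> Cmod (a k) * rho ^ k <= M.
Proof.
intros H Hrho HM.
set (b := fun n => Cmod (a n) * rho ^ n).
assert (Hb : ex_series b) by apply (has_pser_abs _ _ _ _ _ H Hrho).
(* The averaging applies to polynomials; cutting the series at degree [q] costs the tail of the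
   majorant [b], which vanishes as [q] grows. *)
assert (G : forall q, (k < q)%nat -> Cmod (a k) * rho ^ k <= M + (Series b - rsum b q)).
{ intros q Hq. assert (Hq0 : 0 < INR q) by (apply (lt_INR 0); lia).
  set (t := fun j : nat => 2 * PI * INR j / INR q).
  set (p := fun w => csum (fun m => a m * w ^ m)%C q).
  assert (E : csum (fun j => p (rho * expi (t j)) * expi (- (INR k * t j)))%C q
    = (RtoC (INR q) * (a k * rho ^ k))%C).
  { unfold p.
    rewrite (csum_ext _ (fun j => csum (fun m => a m * rho ^ m *
      expi (INR j * (2 * PI * (INR m - INR k) / INR q)))%C q)).
    - rewrite csum_swap. apply (csum_single _ k q); [exact Hq|].
      intros m Hm. rewrite csum_scal, roots_of_unity_sum by assumption.
      destruct (Nat.eq_dec m k) as [->|]; ring.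
    - intros j _. rewrite Cmult_comm, <- csum_scal. apply csum_ext; intros m _.
      rewrite Cpow_mult_l, expi_pow.
      replace (INR j * (2 * PI * (INR m - INR k) / INR q))
        with (INR m * t j + - (INR k * t j)) by (unfold t; field; lra).
      rewrite expi_plus. ring. }
  assert (B : Cmod (csum (fun j => p (rho * expi (t j)) * expi (- (INR k * t j)))%C q)
    <= INR q * (M + (Series b - rsum b q))).
  { eapply Rle_trans; [apply Cmod_csum|]. rewrite <- rsum_const. apply rsum_le.
    intros j _. rewrite Cmod_mult, Cmod_expi, Rmult_1_r.
    set (w := (rho * expi (t j))%C).
    assert (Ew : Cmod w = rho)
      by (unfold w; rewrite Cmod_mult, Cmod_expi, Cmod_R, Rabs_pos_eq; lra).
    assert (Ez : (c + w - c)%C = w) by ring.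
    assert (Hz : Cmod (c + w - c)%C < r) by (rewrite Ez; lra).
    assert (P := H _ Hz). rewrite Ez in P.
    assert (Q := Csums_partial_error _ b _ q
      (fun n => Req_le _ _ (eq_trans (Cmod_mult (a n) (w ^ n)%C)
         (f_equal (Rmult _) (eq_trans (Cmod_pow w n) (f_equal (fun x => x ^ n) Ew))))) Hb P).
    specialize (HM _ Hz). rewrite Cmod_minus_sym in Q.
    generalize (Cmod_triangle_inv (p w) (f (c + w)%C)). unfold p at 2. lra. }
  rewrite E, !Cmod_mult, Cmod_pow, !Cmod_R, !Rabs_pos_eq in B by lra.
  apply Rmult_le_reg_l with (INR q); assumption. }
apply (is_lim_seq_le_loc (fun _ => Cmod (a k) * rho ^ k)
  (fun q => M + (Series b - rsum b q)) (Cmod (a k) * rho ^ k) M).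
- exists (S k); intros q Hq; apply G; lia.
- apply is_lim_seq_const.
- replace (Finite M) with (Finite (M + 0)) by (f_equal; ring).
  apply is_lim_seq_plus'; [apply is_lim_seq_const|apply tail_lim, Hb].
Qed.

(** * Weierstrass test and identity theorem *)

Lemma geom_tail (q : R) (K : nat) (x : R) : 0 <= q < 1 ->
  Series (fun n => x * q ^ n) - rsum (fun n => x * q ^ n) K = x * (q ^ K / (1 - q)).
Proof.
intros Hq.
rewrite (Series_scal_l x (fun n => q ^ n)), rsum_scal, Series_geom by (rewrite Rabs_pos_eq; lra).
assert (E : rsum (fun n => q ^ n) K = (1 - q ^ K) / (1 - q)).
{ induction K as [|K IH]; simpl; [|rewrite IH]; field; lra. }
change (pow q) with (fun n => q ^ n); rewrite E. field. lra.
Qed.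

(** Cauchy's estimate bounds the k-th Taylor coefficient of [f n] by [M n] rho^(-k) for every rho <
    r. Hence the coefficients can be summed over n, and the Taylor polynomials of degree below K
    approximate all [f n] at once, with an error [M n] times a geometric factor q^K / (1 - q). *)
Lemma an_series (f : nat -> C -> C) (F : C -> C) (M : nat -> R) (c : C) (r : R) :
  (forall n, an (f n) c r) ->
  (forall n z, Cmod (z - c)%C < r -> Cmod (f n z) <= M n) -> ex_series M ->
  (forall z, Cmod (z - c)%C < r -> Csums (fun n => f n z) (F z)) -> an F c r.
Proof.
intros Hf HM HS HF.
assert (Hr : 0 < r) by apply (Hf 0%nat).
assert (Hch : forall n, {a | has_pser a (f n) c r}).
{ intros n. apply constructive_indefinite_description, Hf. }
pose (a := fun n => proj1_sig (Hch n)).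
assert (Ha : forall n, has_pser (a n) (f n) c r) by (intros n; apply (proj2_sig (Hch n))).
assert (HE : forall n k rho, 0 <= rho < r -> Cmod (a n k) * rho ^ k <= M n).
{ intros n k rho Hrho. apply cauchy_estimate with (f n) c r; auto. }
assert (M0 : forall n, 0 <= M n).
{ intros n. eapply Rle_trans; [|apply (HE n 0%nat 0); lra].
  simpl; rewrite Rmult_1_r; apply Cmod_ge_0. }
assert (HA : forall k, {l | Csums (fun n => a n k) l}).
{ intros k. apply constructive_indefinite_description.
  set (rho := r / 2).
  destruct (Csums_abs (fun n => a n k) (fun n => / rho ^ k * M n)) as [l [Hl _]].
  - intros n. assert (P : 0 < rho ^ k) by (apply pow_lt; unfold rho; lra).
    apply Rmult_le_reg_l with (rho ^ k); [exact P|].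
    rewrite <- Rmult_assoc, Rinv_r, Rmult_1_l, Rmult_comm by lra.
    apply HE; unfold rho; lra.
  - apply Rex_series_scal, HS.
  - exists l; exact Hl. }
split; [exact Hr|]. exists (fun k => proj1_sig (HA k)). intros z Hz.
set (w := (z - c)%C) in *. set (rho := (Cmod w + r) / 2).
assert (Hrho : Cmod w < rho < r) by (unfold rho; lra).
assert (Hw0 := Cmod_ge_0 w).
set (q := Cmod w / rho).
assert (Hq : 0 <= q < 1).
{ unfold q; split; [apply Rdiv_le_0_compat; lra|apply Rlt_div_l; lra]. }
apply Clim_squeeze with (fun K => Series M * / (1 - q) * q ^ K).
- intros K. rewrite Cmod_minus_sym.
  assert (S1 : Csums (fun n => f n z - csum (fun k => a n k * w ^ k) K)%C
    (F z - csum (fun k => proj1_sig (HA k) * w ^ k) K)%C).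
  { apply Csums_ext with (fun n => f n z + (- (1)) * csum (fun k => a n k * w ^ k) K)%C;
      [intros; ring|].
    replace (F z - csum (fun k => proj1_sig (HA k) * w ^ k) K)%C
      with (F z + (- (1)) * csum (fun k => proj1_sig (HA k) * w ^ k) K)%C by ring.
    apply Csums_plus; [apply HF, Hz|].
    apply Csums_scal, (Csums_csum (fun n k => a n k * w ^ k)%C). intros k _.
    apply Csums_ext with (fun n => w ^ k * a n k)%C; [intros; ring|].
    rewrite Cmult_comm. apply Csums_scal, (proj2_sig (HA k)). }
  replace (Series M * / (1 - q) * q ^ K) with (Series (fun n => q ^ K / (1 - q) * M n))
    by (rewrite Series_scal_l; unfold Rdiv; ring).
  apply Csums_bound with (3 := S1).
  + intros n. rewrite Rmult_comm, <- geom_tail by exact Hq.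
    apply Csums_partial_error.
    * intros k. rewrite Cmod_mult, Cmod_pow.
      replace (Cmod w ^ k) with (rho ^ k * q ^ k)
        by (rewrite <- Rpow_mult_distr; f_equal; unfold q; field; lra).
      rewrite <- Rmult_assoc. apply Rmult_le_compat_r; [apply pow_le; lra|].
      apply HE; lra.
    * apply ex_series_geom_scal, Hq.
    * apply Ha, Hz.
  + apply Rex_series_scal, HS.
- apply is_lim_seq_scal_0, is_lim_seq_geom. rewrite Rabs_pos_eq; lra.
Qed.

(** After the constant term a factor w splits off, and the remaining series is bounded on the disc.
    This serves both for continuity and for isolating a leading coefficient. *)
Lemma pser_lipschitz (a : nat -> C) (rho : R) :
  0 < rho -> ex_series (fun n => Cmod (a n) * rho ^ n) ->
  exists B, 0 <= B /\ forall w l, Cmod w <= rho -> Csums (fun n => a n * w ^ n)%C l ->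
    Cmod (l - a 0%nat)%C <= B * Cmod w.
Proof.
intros Hrho He.
assert (He' : ex_series (fun n => Cmod (a (S n)) * rho ^ n)).
{ apply ex_series_incr_1 in He.
  apply ex_series_ext with (fun n => / rho * (Cmod (a (S n)) * rho ^ S n)).
  - intros n; simpl; toR; field; lra.
  - apply Rex_series_scal, He. }
assert (P : forall n, 0 <= Cmod (a (S n)) * rho ^ n)
  by (intros n; apply Rmult_le_pos; [apply Cmod_ge_0|apply pow_le; lra]).
exists (Series (fun n => Cmod (a (S n)) * rho ^ n)); split.
- apply (rsum_le_Series _ 0%nat P He').
- intros w l Hw Hl.
  destruct (Csums_abs (fun n => a (S n) * w ^ n)%C (fun n => Cmod (a (S n)) * rho ^ n))
    as [m [Hm Bm]].
  + intros n; rewrite Cmod_mult, Cmod_pow. apply Rmult_le_compat_l; [apply Cmod_ge_0|].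
    apply pow_incr; split; [apply Cmod_ge_0|exact Hw].
  + exact He'.
  + assert (E : l = (a 0%nat * w ^ 0 + w * m)%C).
    { apply Csums_unique with (1 := Hl). apply (Csums_tail (fun n => a n * w ^ n)%C).
      apply Csums_ext with (fun n => w * (a (S n) * w ^ n))%C;
        [intros; rewrite Cpow_S; ring|]. apply Csums_scal, Hm. }
    rewrite E. simpl. replace (a 0%nat * 1 + w * m - a 0%nat)%C with (w * m)%C by ring.
    rewrite Cmod_mult, Rmult_comm. apply Rmult_le_compat_r; [apply Cmod_ge_0|exact Bm].
Qed.

Lemma an_continuous (f : C -> C) (c : C) (r : R) : an f c r -> forall eps, 0 < eps ->
  exists delta, 0 < delta /\ forall z, Cmod (z - c)%C < delta -> Cmod (f z - f c)%C < eps.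
Proof.
intros [Hr [a Ha]] eps Heps.
destruct (pser_lipschitz a (r / 2)) as [B [HB0 HB]]; [lra|apply (has_pser_abs _ _ _ _ _ Ha); lra|].
assert (E : f c = a 0%nat).
{ assert (Z := Cmod_diag c).
  assert (Hc : Cmod (c - c)%C < r) by lra.
  specialize (HB (c - c)%C (f c) ltac:(lra) (Ha _ Hc)). rewrite Z, Rmult_0_r in HB.
  replace (f c) with (f c - a 0%nat + a 0%nat)%C by ring.
  rewrite (Cmod_eq_0 (f c - a 0%nat)%C); [ring|].
  apply Rle_antisym; [exact HB|apply Cmod_ge_0]. }
exists (Rmin (r / 2) (eps / (B + 1))); split.
- apply Rmin_glb_lt; [lra|apply Rdiv_lt_0_compat; lra].
- intros z Hz.
  assert (H1 := Rlt_le_trans _ _ _ Hz (Rmin_l _ _)).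
  assert (H2 := Rlt_le_trans _ _ _ Hz (Rmin_r _ _)).
  rewrite E. eapply Rle_lt_trans.
  + apply (HB (z - c)%C); [lra|apply Ha; lra].
  + apply Rlt_div_r in H2; [|lra]. generalize (Cmod_ge_0 (z - c)%C). nra.
Qed.

(** By strong induction every coefficient vanishes: if those below n do, division by (z - c)^n
    leaves a series with constant term [a n] and zeros arbitrarily close to its centre. *)
Lemma an_accumulating_zeros (f : C -> C) (c : C) (r : R) : an f c r ->
  (forall delta, 0 < delta -> exists z, 0 < Cmod (z - c)%C < delta /\ f z = 0) ->
  forall z, Cmod (z - c)%C < r -> f z = 0.
Proof.
intros [Hr [a Ha]] Hacc.
assert (Z : forall n, a n = 0).
{ intros n. induction n as [n IH] using (well_founded_induction lt_wf).
  set (rho := r / 2).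
  assert (He : ex_series (fun k => Cmod (a (n + k)%nat) * rho ^ k)).
  { assert (H1 : ex_series (fun n => Cmod (a n) * rho ^ n))
      by (apply (has_pser_abs _ _ _ _ _ Ha); unfold rho; lra).
    apply (ex_series_rtail _ n) in H1.
    apply ex_series_ext with (fun k => / rho ^ n * (Cmod (a (n + k)%nat) * rho ^ (n + k))).
    - intros k. rewrite pow_add. toR. field. apply pow_nonzero; unfold rho; lra.
    - apply Rex_series_scal, H1. }
  destruct (pser_lipschitz (fun k => a (n + k)%nat) rho) as [B [HB0 HB]];
    [unfold rho; lra|exact He|].
  rewrite Nat.add_0_r in HB.
  assert (Hsmall : forall eps, 0 < eps -> Cmod (a n) <= eps).
  { intros eps Heps.
    destruct (Hacc (Rmin rho (eps / (B + 1)))) as [z [[Hz0 Hz] Ez]].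
    { apply Rmin_glb_lt; [unfold rho; lra|apply Rdiv_lt_0_compat; lra]. }
    assert (H1 := Rlt_le_trans _ _ _ Hz (Rmin_l _ _)).
    assert (H2 := Rlt_le_trans _ _ _ Hz (Rmin_r _ _)).
    assert (S0 : Csums (fun k => a (n + k)%nat * (z - c) ^ k)%C 0).
    { assert (S1 : Csums (fun m => a m * (z - c) ^ m)%C 0)
        by (rewrite <- Ez; apply Ha; unfold rho in H1; lra).
      unfold Csums in S1. apply (Clim_incr_n n) in S1.
      assert (Hw : (z - c)%C <> 0) by (apply Cmod_gt_0; exact Hz0).
      replace (RtoC 0) with (/ (z - c) ^ n * 0)%C by ring.
      apply Clim_ext with (fun k => / (z - c) ^ n * csum (fun m => a m * (z - c) ^ m)%C (k + n))%C;
        [|apply Clim_scal, S1].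
      intros k. rewrite Nat.add_comm, csum_add, (csum_ext _ (fun _ => RtoC 0)), csum_zero.
      - rewrite Cplus_0_l, <- csum_scal. apply csum_ext; intros j _.
        rewrite Cpow_add_r. field. apply Cpow_nz, Hw.
      - intros j Hj. rewrite IH by exact Hj; ring. }
    assert (H3 := HB _ _ (Rlt_le _ _ H1) S0).
    replace (0 - a n)%C with (- a n)%C in H3 by ring. rewrite Cmod_opp in H3.
    apply Rlt_div_r in H2; [|lra]. nra. }
  apply Cmod_eq_0, Rle_antisym; [|apply Cmod_ge_0].
  apply Rnot_lt_le; intros Hlt. specialize (Hsmall (Cmod (a n) / 2)). lra. }
intros z Hz. apply Csums_unique with (1 := Ha z Hz).
apply Csums_ext with (fun _ => RtoC 0); [|apply Csums_zero].
intros n; rewrite Z; ring.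
Qed.

Definition vanishes_near (f : C -> C) (c : C) : Prop :=
  exists delta, 0 < delta /\ forall z, Cmod (z - c)%C < delta -> f z = 0.

(** A supremum argument replaces connectedness: [E] collects the parameters up to which [f] vanishes
    near every point of the segment, and its supremum must be 1. *)
Lemma identity_segment (f : C -> C) (p q : C) :
  (forall t, 0 <= t <= 1 -> exists r, an f (p + t * (q - p))%C r) ->
  vanishes_near f p -> vanishes_near f q.
Proof.
intros Han Hp.
destruct (Ceq_dec q p) as [->|Hne]; [exact Hp|].
assert (HL : 0 < Cmod (q - p)%C).
{ apply Cmod_gt_0; intros E; apply Hne.
  replace q with (q - p + p)%C by ring; rewrite E; ring. }
set (L := Cmod (q - p)%C) in *.
set (g := fun t : R => (p + t * (q - p))%C).
assert (Hg : forall s t, Cmod (g s - g t)%C = Rabs (s - t) * L).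
{ intros s t. unfold g.
  replace (p + s * (q - p) - (p + t * (q - p)))%C with (RtoC (s - t) * (q - p))%C
    by (rewrite RtoC_minus; ring).
  rewrite Cmod_mult, Cmod_R; reflexivity. }
assert (G0 : g 0 = p) by (unfold g; ring).
assert (G1 : g 1 = q) by (unfold g; ring).
set (E := fun t => 0 <= t <= 1 /\ forall s, 0 <= s <= t -> vanishes_near f (g s)).
assert (E0 : E 0).
{ split; [lra|]. intros s Hs; replace s with 0 by lra; rewrite G0; exact Hp. }
destruct (completeness E) as [m [Hub Hlub]].
{ exists 1; intros t [Ht _]; lra. }
{ exists 0; exact E0. }
assert (Hm : 0 <= m <= 1).
{ split; [apply Hub, E0|apply Hlub; intros t [Ht _]; lra]. }
destruct (Han m Hm) as [r Hr]; fold (g m) in Hr.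
assert (Hr0 : 0 < r) by apply Hr.
(* Zeros accumulate at [g m] in both cases: if [m] belongs to [E], [f] already vanishes near [g m];
   otherwise elements t < m of [E] arbitrarily close to [m] give the zeros [g t]. *)
assert (Hball : forall z, Cmod (z - g m)%C < r -> f z = 0).
{ destruct (excluded_middle_informative (E m)) as [Em|Em].
  - apply (an_accumulating_zeros f (g m) r Hr). intros delta Hd.
    destruct Em as [_ Em]. destruct (Em m ltac:(lra)) as [d [Hd0 Hd1]].
    assert (P : 0 < Rmin delta d / 2) by (generalize (Rmin_glb_lt _ _ _ Hd Hd0); lra).
    exists (g m + RtoC (Rmin delta d / 2))%C.
    replace (g m + RtoC (Rmin delta d / 2) - g m)%C with (RtoC (Rmin delta d / 2)) by ring.
    rewrite Cmod_R, Rabs_pos_eq by lra.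
    generalize (Rmin_l delta d) (Rmin_r delta d); intros A1 A2.
    split; [lra|]. apply Hd1.
    replace (g m + RtoC (Rmin delta d / 2) - g m)%C with (RtoC (Rmin delta d / 2)) by ring.
    rewrite Cmod_R, Rabs_pos_eq by lra. lra.
  - apply (an_accumulating_zeros f (g m) r Hr). intros delta Hd.
    destruct (excluded_middle_informative (exists t, E t /\ m - delta / L < t)) as [[t [Et Ht]]|N].
    + assert (t <= m) by (apply Hub, Et).
      assert (t <> m) by (intros ->; exact (Em Et)).
      exists (g t). rewrite Hg, Rabs_left by lra. split; [split|].
      * apply Rmult_lt_0_compat; lra.
      * apply Rlt_div_r; lra.
      * destruct Et as [Ht' Et]. destruct (Et t ltac:(lra)) as [d [Hd0 Hd1]].
        apply Hd1. rewrite Hg, Rminus_eq_0, Rabs_R0; lra.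
    + exfalso. assert (Hdl : 0 < delta / L) by (apply Rdiv_lt_0_compat; lra).
      assert (m <= m - delta / L); [|lra].
      apply Hlub. intros t Et. apply Rnot_lt_le; intros Hlt. apply N; exists t; auto. }
assert (Hnear : forall s, Rabs (s - m) * L < r -> vanishes_near f (g s)).
{ intros s Hs. exists (r - Rabs (s - m) * L); split; [lra|].
  intros z Hz. apply Hball. eapply Rle_lt_trans; [apply (Cmod_minus_le _ (g s))|].
  rewrite Hg; lra. }
assert (Hdl : 0 < r / L) by (apply Rdiv_lt_0_compat; lra).
assert (Hext : forall t, 0 <= t <= 1 -> t < m + r / L -> E t).
{ intros t Ht Htm; split; [exact Ht|]. intros s Hs.
  destruct (Rlt_dec (m - r / L) s) as [Hc|Hc].
  - apply Hnear. apply Rlt_div_r; [lra|]. apply Rabs_def1; lra.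
  - destruct (excluded_middle_informative (exists u, E u /\ s < u)) as [[u [Eu Hu]]|N].
    + apply Eu; lra.
    + exfalso. assert (m <= s); [|lra].
      apply Hlub. intros u Eu. apply Rnot_lt_le; intros Hlt. apply N; exists u; auto. }
rewrite <- G1.
destruct (Rlt_dec m 1) as [Hm1|Hm1].
(* If [m] < 1, the disc about [g m] carries [E] beyond its supremum. *)
- exfalso. set (t := Rmin 1 (m + r / L / 2)).
  assert (m < t) by (apply Rmin_glb_lt; lra).
  assert (t <= m); [|lra]. apply Hub, Hext.
  + split; [lra|apply Rmin_l].
  + generalize (Rmin_r 1 (m + r / L / 2)); fold t; lra.
- apply Hnear. replace m with 1 by lra. rewrite Rminus_eq_0, Rabs_R0; lra.
Qed.

(** * The Moebius function *)

Module Mobius.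

Import all_boot.
Local Close Scope R_scope.

Lemma mobius_prime_mul (p e : nat) : prime p -> 0 < e ->
  mobius (p * e) = if p %| e then IZR 0 else Ropp (mobius e).
Proof.
move=> pp e0; have p0 := prime_gt0 pp.
have memM q : (q \in primes (p * e)) = (q == p) || (q \in primes e).
  by rewrite primesM // primes_prime // inE.
have logM q : logn q (p * e) = (p == q) + logn q e.
  rewrite lognM //; case: (boolP (prime q)) => [pq|npq]; first by rewrite logn_prime // eq_sym.
  have z n : logn q n = 0 by rewrite lognE (negbTE npq).
  rewrite !z addn0.
  by case: eqP npq => [<-|//]; rewrite pp.
case: (boolP (p %| e)) => [pe|npe]; rewrite /mobius.
  case: ifP => // /allP H.
  have {H} : is_true (Nat.eqb (logn p (p * e)) 1) by apply: H; rewrite memM eqxx.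
  move=> /Nat.eqb_eq; rewrite logM eqxx.
  have : 0 < logn p e by rewrite logn_gt0 mem_primes pp e0 pe.
  by case: (logn p e).
have np : p \notin primes e by rewrite mem_primes pp e0.
have perm : perm_eq (primes (p * e)) (p :: primes e).
  apply: uniq_perm; [exact: primes_uniq|by rewrite /= np primes_uniq|].
  by move=> q; rewrite memM inE.
rewrite (perm_all _ perm) (perm_size perm) /=.
have -> : Nat.eqb (logn p (p * e)) 1.
  rewrite logM eqxx; move: np; rewrite -logn_gt0 -eqn0Ngt => /eqP ->; exact: Nat.eqb_refl.
rewrite /=.
have -> : all (fun q => Nat.eqb (logn q (p * e)) 1) (primes e)
        = all (fun q => Nat.eqb (logn q e) 1) (primes e).
  apply: eq_in_all => q qe; rewrite logM.
  by case: eqP qe np => [-> ->|].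
case: ifP => _; last by rewrite Ropp_0.
by rewrite -Ropp_mult_distr_l Rmult_1_l.
Qed.

Lemma mobius_1 : mobius 1 = IZR 1.
Proof. by []. Qed.

Lemma mobius_le_1 (n : nat) : Rle (Rabs (mobius n)) (IZR 1).
Proof.
rewrite /mobius; case: ifP => _; last by rewrite Rabs_R0; apply: Rle_0_1.
by rewrite pow_1_abs; apply: Rle_refl.
Qed.

(** Bridge between the two divisibility relations: outside this module the arithmetic is phrased
    with [Nat.divide]. *)
Lemma dividesP (m n : nat) : Nat.divide m n <-> m %| n.
Proof.
by split=> [[q ->]|/dvdnP [q ->]]; [rewrite dvdn_mull|exists q].
Qed.

Lemma divide_cofactor (p e k : nat) : prime p -> ~ Nat.divide p e ->
  Nat.divide e (p * k) -> Nat.divide e k.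
Proof.
move=> pp npe /dividesP H; apply/dividesP; move: H; rewrite Gauss_dvdr //.
rewrite coprime_sym prime_coprime //; apply/negP => /dividesP; exact: npe.
Qed.

Lemma mobius_mul (p e : nat) : prime p -> (Nat.lt 0 e) ->
  (Nat.divide p e -> mobius (Nat.mul p e) = IZR 0) /\
  (~ Nat.divide p e -> mobius (Nat.mul p e) = Ropp (mobius e)).
Proof.
move=> pp /ltP e0; rewrite multE mobius_prime_mul //.
by split=> /dividesP; [move=> ->|move/negP/negbTE => ->].
Qed.

Lemma prime_factor (k : nat) : Nat.lt 1 k ->
  exists p m, prime p /\ k = Nat.mul p m /\ Nat.lt 0 m /\ Nat.lt 1 p.
Proof.
move=> /ltP k1; have pp := pdiv_prime k1; exists (pdiv k), (k %/ pdiv k).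
have E : k = Nat.mul (pdiv k) (k %/ pdiv k) by rewrite multE mulnC divnK ?pdiv_dvd.
split=> //; split=> //; split; apply/ltP; last exact: prime_gt1.
by rewrite divn_gt0 ?pdiv_gt0 // pdiv_leq // ltnW.
Qed.

End Mobius.

Definition div_ind (n k : nat) (v : C) : C :=
  if excluded_middle_informative (Nat.divide n k) then v else 0.

Lemma div_ind_yes (n k : nat) (v : C) : Nat.divide n k -> div_ind n k v = v.
Proof. intros H; unfold div_ind; destruct excluded_middle_informative; tauto. Qed.

Lemma div_ind_no (n k : nat) (v : C) : ~ Nat.divide n k -> div_ind n k v = 0.
Proof. intros H; unfold div_ind; destruct excluded_middle_informative; tauto. Qed.

(** The range splits into [M] blocks of length [n], and only the last element of each block is a
    multiple of [n]. *)
Lemma csum_multiples (n M : nat) (f : nat -> C) : (0 < n)%nat ->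
  csum (fun k => div_ind n (S k) (f (S k))) (n * M) = csum (fun m => f (n * S m)%nat) M.
Proof.
intros Hn. induction M as [|M IH]; [rewrite Nat.mul_0_r; reflexivity|].
rewrite Nat.mul_succ_r, csum_add, IH. cbn [csum]. f_equal.
apply (csum_single _ (n - 1)); [lia|]. intros m Hm.
destruct (Nat.eq_dec m (n - 1)) as [->|Hne].
- replace (S (n * M + (n - 1)))%nat with (n * S M)%nat by lia.
  apply div_ind_yes. exists (S M); lia.
- apply div_ind_no. intros [q Hq].
  assert (M < q)%nat by nia. assert (q < S M)%nat by nia. lia.
Qed.

(** With a prime p and k = p m, the divisors of k prime to p cancel against the multiples p e with e
    dividing m. The cofactor m may itself be divisible by p; then mu(p e) = 0 whenever p divides
    e. *)
Lemma mobius_divisor_sum (k : nat) : (1 < k)%nat ->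
  csum (fun d => div_ind (S d) k (RtoC (mobius (S d)))) k = 0.
Proof.
intros Hk. destruct (Mobius.prime_factor k Hk) as (p & m & pp & -> & Hm & Hp).
(* [G] carries mu on the divisors of m prime to p. These are also the divisors of p m prime to p,
   while the terms mu(p e) add up to minus the sum of [G]. *)
set (G := fun e => div_ind (S e) m
  (if excluded_middle_informative (Nat.divide p (S e)) then 0 else RtoC (mobius (S e)))).
rewrite (csum_ext _ (fun d => G d + div_ind p (S d)
  (div_ind (S d) (p * m) (RtoC (mobius (S d)))))%C).
- rewrite csum_plus, (csum_multiples p m (fun d => div_ind d (p * m) (RtoC (mobius d)))) by lia.
  assert (E : csum G (p * m) = csum G m).
  { replace (p * m)%nat with (m + (p * m - m))%nat by nia.
    rewrite csum_add, (csum_ext (fun k => G (m + k)%nat) (fun _ => RtoC 0)), csum_zero; [ring|].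
    intros j _. apply div_ind_no. intros H. apply Nat.divide_pos_le in H; lia. }
  rewrite E.
  rewrite (csum_ext (fun m0 => div_ind (p * S m0) (p * m) (RtoC (mobius (p * S m0))))
    (fun e => (-(1)) * G e)%C).
  + rewrite csum_scal; ring.
  + intros e _. unfold G.
    destruct (Mobius.mobius_mul p (S e) pp ltac:(lia)) as [H1 H2].
    destruct (excluded_middle_informative (Nat.divide (S e) m)) as [D1|D1].
    * rewrite !div_ind_yes; [|exact D1|apply Nat.mul_divide_mono_l, D1].
      destruct excluded_middle_informative as [D2|D2]; [rewrite H1|rewrite H2]; try assumption.
      -- ring.
      -- rewrite RtoC_opp; ring.
    * rewrite !div_ind_no; [ring|exact D1|].
      intros H. apply D1. apply Nat.mul_divide_cancel_l in H; [exact H|lia].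
- intros d _. unfold G.
  destruct (excluded_middle_informative (Nat.divide p (S d))) as [D1|D1].
  + rewrite (div_ind_yes p) by exact D1.
    destruct (excluded_middle_informative (Nat.divide (S d) m)) as [D2|D2];
      [rewrite (div_ind_yes (S d) m) by exact D2|rewrite (div_ind_no (S d) m) by exact D2]; ring.
  + rewrite (div_ind_no p) by exact D1.
    destruct (excluded_middle_informative (Nat.divide (S d) m)) as [D2|D2].
    * rewrite !div_ind_yes; [ring|exact D2|apply Nat.divide_mul_r, D2].
    * rewrite !div_ind_no; [ring|exact D2|].
      intros H. apply D2, (Mobius.divide_cofactor p); assumption.
Qed.

(** * The Dirichlet series of zeta and of its reciprocal; [npow n z] is n^(-z) *)

Definition npow (n : nat) (z : C) : C := Cexp (- z * RtoC (ln (INR n)))%C.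

Lemma ncpow_inv (n : nat) (s : C) : (/ ncpow n s)%C = npow n s.
Proof. unfold ncpow, npow. rewrite <- Cexp_opp; f_equal; ring. Qed.

Lemma npow_mult (n m : nat) (z : C) : (0 < n)%nat -> (0 < m)%nat ->
  npow (n * m) z = (npow n z * npow m z)%C.
Proof.
intros Hn Hm. unfold npow. rewrite <- Cexp_plus, mult_INR, ln_mult by (apply lt_0_INR; assumption).
f_equal. rewrite RtoC_plus; ring.
Qed.

Lemma npow_1 (z : C) : npow 1 z = 1.
Proof. unfold npow. simpl. rewrite ln_1, Cmult_0_r; apply Cexp_0. Qed.

Lemma ln_INR_ge_0 (n : nat) : 0 <= ln (INR n).
Proof.
destruct n as [|[|n]].
(* At 0 the total function [ln] takes the default value 0. *)
- simpl. unfold ln; destruct (Rlt_dec 0 0) as [h|h]; [exfalso; exact (Rlt_irrefl 0 h)|apply Rle_refl].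
- simpl; rewrite ln_1; lra.
- rewrite <- ln_1. left; apply ln_increasing; [lra|]. rewrite !S_INR; generalize (pos_INR n); lra.
Qed.

Lemma Cmod_npow (n : nat) (z : C) : Cmod (npow n z) = exp (- Re z * ln (INR n)).
Proof. unfold npow. rewrite Cmod_Cexp; f_equal; autorewrite with cre; ring. Qed.

Lemma Cmod_npow_le (n : nat) (z : C) (sigma : R) : sigma <= Re z ->
  Cmod (npow n z) <= exp (- sigma * ln (INR n)).
Proof.
intros H. rewrite Cmod_npow. apply exp_mono. generalize (ln_INR_ge_0 n); nra.
Qed.

Lemma ex_series_bounded (a : nat -> R) (B : R) :
  (forall n, 0 <= a n) -> (forall n, rsum a n <= B) -> ex_series a.
Proof.
intros Ha HB.
destruct (ex_finite_lim_seq_incr (rsum a) B) as [l Hl].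
- intros n; simpl; generalize (Ha n); lra.
- exact HB.
- exists l. apply is_series_rsum, Hl.
Qed.

(** Integral comparison for t^(-sigma), a decreasing function, with its antiderivative in place of
    the integral; the right side telescopes. *)
Lemma rpow_telescope (sigma x y : R) : 1 < sigma -> 0 < x <= y ->
  (y - x) * exp (- sigma * ln y) <=
  (exp (- (sigma - 1) * ln x) - exp (- (sigma - 1) * ln y)) / (sigma - 1).
Proof.
intros Hs Hxy.
pose (g := fun t => - exp (- (sigma - 1) * ln t) / (sigma - 1) - exp (- sigma * ln y) * t).
assert (H : g x <= g y).
{ apply nondecreasing_of_derive with (fun t => exp (- sigma * ln t) - exp (- sigma * ln y)); [lra| |].
  - intros t Ht. unfold g. auto_derive; [repeat split; lra|].
    replace (exp (- sigma * ln t)) with (exp (- (sigma - 1) * ln t) * / t).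
    + field; lra.
    + rewrite <- (exp_ln t) at 2 by lra. rewrite <- exp_Ropp, <- exp_plus. f_equal; ring.
  - intros t Ht. assert (ln t <= ln y) by (apply ln_le; lra).
    enough (exp (- sigma * ln y) <= exp (- sigma * ln t)) by lra.
    apply exp_mono; nra. }
unfold g in H. unfold Rdiv in *. nra.
Qed.

Lemma ex_series_rpow (sigma : R) : 1 < sigma ->
  ex_series (fun n => exp (- sigma * ln (INR (S n)))).
Proof.
intros Hs.
apply ex_series_bounded with (1 + / (sigma - 1)).
- intros; left; apply exp_pos.
- assert (G : forall n, rsum (fun n => exp (- sigma * ln (INR (S n)))) (S n)
    <= 1 + (1 - exp (- (sigma - 1) * ln (INR (S n)))) / (sigma - 1)).
  { induction n as [|n IH].
    - simpl. rewrite ln_1, !Rmult_0_r, exp_0. unfold Rdiv; rewrite Rminus_eq_0; lra.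
    - change (rsum ?f (S (S n))) with (rsum f (S n) + f (S n)). cbv beta.
      assert (T := rpow_telescope sigma (INR (S n)) (INR (S (S n))) Hs).
      rewrite (S_INR (S n)) in T at 1 2. 
      assert (0 < INR (S n)) by (apply lt_0_INR; lia).
      specialize (T ltac:(lra)).
      unfold Rdiv in *. lra. }
  assert (P : 0 < / (sigma - 1)) by (apply Rinv_0_lt_compat; lra).
  intros [|n]; [simpl; lra|].
  eapply Rle_trans; [apply G|].
  generalize (exp_pos (- (sigma - 1) * ln (INR (S n)))); unfold Rdiv; nra.
Qed.

Section Zeta.
Variable zeta : C -> C.
Hypothesis Hzeta : is_riemann_zeta zeta.

Lemma zeta_series (z : C) : 1 < Re z -> Csums (fun k => npow (S k) z) (zeta z).
Proof.
intros Hz. destruct Hzeta as [H _]. specialize (H z Hz). apply is_series_Csums in H.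
revert H; apply Csums_ext; intros n; apply ncpow_inv.
Qed.

(** Absolute convergence provides some limit, and the partial sums at the multiples of [n] identify
    it. *)
Lemma Csums_subseq (a : nat -> C) (b : nat -> R) (n : nat) (l : C) : (0 < n)%nat ->
  (forall k, Cmod (a k) <= b k) -> ex_series b ->
  Clim (fun M => csum a (n * M)) l -> Csums a l.
Proof.
intros Hn Hb He H. destruct (Csums_abs a b Hb He) as [m [Hm _]].
replace l with m; [exact Hm|].
apply Clim_unique with (2 := H).
unfold Csums, Clim in *.
apply (is_lim_seq_subseq (fun n => Cmod (csum a n - m)%C) 0 (fun M => (n * M)%nat)); [|exact Hm].
apply eventually_subseq. intros k; nia.
Qed.

(** Up to the bound n M, the terms at multiples of n add up to n^(-z) times the M-th partial sum of
    zeta. *)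
Lemma zeta_multiples (n : nat) (z : C) : (0 < n)%nat -> 1 < Re z ->
  Csums (fun k => div_ind n (S k) (npow (S k) z)) (npow n z * zeta z)%C.
Proof.
intros Hn Hz.
apply Csums_subseq with (fun k => exp (- Re z * ln (INR (S k)))) n; [exact Hn| | |].
- intros k. unfold div_ind. destruct excluded_middle_informative; [rewrite Cmod_npow; lra|].
  rewrite Cmod_0; left; apply exp_pos.
- apply ex_series_rpow, Hz.
- apply Clim_ext with (fun M => npow n z * csum (fun m => npow (S m) z) M)%C.
  + intros M. rewrite (csum_multiples n M (fun k => npow k z) Hn), <- csum_scal.
    apply csum_ext; intros m _. symmetry; apply npow_mult; lia.
  + apply Clim_scal, zeta_series, Hz.
Qed.

Definition mobius_partial (N k : nat) : C :=
  csum (fun d => div_ind (S d) (S k) (RtoC (mobius (S d)))) N.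

Lemma mobius_partial_stable (N k : nat) : (S k <= N)%nat ->
  mobius_partial N k = mobius_partial (S k) k.
Proof.
intros H. unfold mobius_partial. replace N with (S k + (N - S k))%nat by lia.
rewrite csum_add, (csum_ext (fun j => div_ind (S (S k + j)) _ _) (fun _ => RtoC 0)), csum_zero;
  [ring|].
intros j _. apply div_ind_no. intros D. apply Nat.divide_pos_le in D; lia.
Qed.

Lemma Cmod_mobius_partial (N k : nat) : Cmod (mobius_partial N k) <= INR (S k).
Proof.
assert (G : forall M, Cmod (mobius_partial M k) <= INR M).
{ intros M. eapply Rle_trans; [apply Cmod_csum|].
  replace (INR M) with (rsum (fun _ => 1) M) by (rewrite rsum_const; ring).
  apply rsum_le; intros d _. unfold div_ind.
  destruct excluded_middle_informative; [|rewrite Cmod_0; lra].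
  rewrite Cmod_R; apply Mobius.mobius_le_1. }
destruct (le_lt_dec (S k) N) as [H|H].
- rewrite mobius_partial_stable by exact H; apply G.
- eapply Rle_trans; [apply G|apply le_INR; lia].
Qed.

(** The product of the N-th Moebius sum with zeta is a Dirichlet series whose coefficients are
    divisor sums of mu restricted to d <= N. Up to index N these are complete, so only the first
    survives. Beyond N they are bounded by the index, which costs one power and explains the
    condition Re z > 2; the identity is wanted only far to the right. *)
Lemma zeta_mobius (z : C) : 2 < Re z ->
  Clim (fun N => csum (fun n => RtoC (mobius (S n)) * npow (S n) z)%C N * zeta z)%C 1.
Proof.
intros Hz.
set (B := fun k => exp (- (Re z - 1) * ln (INR (S k)))).
assert (HB : ex_series B) by (apply ex_series_rpow; lra).
apply Clim_squeeze_ev with (fun N => Series B - rsum B N) 1%nat; [|apply tail_lim, HB].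
intros N HN.
assert (T : Csums (fun k => npow (S k) z * mobius_partial N k)%C
  (csum (fun n => RtoC (mobius (S n)) * npow (S n) z)%C N * zeta z)%C).
{ replace (csum (fun n => RtoC (mobius (S n)) * npow (S n) z)%C N * zeta z)%C
    with (csum (fun n => RtoC (mobius (S n)) * (npow (S n) z * zeta z))%C N)
    by (rewrite Cmult_comm, <- csum_scal; apply csum_ext; intros; ring).
  apply Csums_ext with
    (fun k => csum (fun d => RtoC (mobius (S d)) * div_ind (S d) (S k) (npow (S k) z)) N)%C.
  - intros k. unfold mobius_partial. rewrite <- csum_scal. apply csum_ext; intros d _.
    unfold div_ind; destruct excluded_middle_informative; ring.
  - apply (Csums_csum (fun k d => RtoC (mobius (S d)) * div_ind (S d) (S k) (npow (S k) z))%C).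
    intros d _. apply Csums_scal, zeta_multiples; [lia|lra]. }
replace (RtoC 1) with (csum (fun k => npow (S k) z * mobius_partial N k)%C N).
- apply Csums_partial_error with (3 := T); [|exact HB].
  intros k. rewrite Cmod_mult, Cmod_npow.
  replace (B k) with (exp (- Re z * ln (INR (S k))) * INR (S k)).
  + apply Rmult_le_compat_l; [left; apply exp_pos|apply Cmod_mobius_partial].
  + unfold B. rewrite <- (exp_ln (INR (S k))) at 2 by (apply lt_0_INR; lia).
    rewrite <- exp_plus; f_equal; ring.
- apply (csum_single _ 0); [lia|]. intros k Hk.
  rewrite mobius_partial_stable by lia. unfold mobius_partial.
  destruct (Nat.eq_dec k 0) as [->|Hk0].
  + rewrite npow_1. cbn [csum]. rewrite div_ind_yes by (exists 1%nat; reflexivity).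
    rewrite Mobius.mobius_1; ring.
  + rewrite mobius_divisor_sum by lia; ring.
Qed.

End Zeta.

(** * Analytic continuation and a weighted mean over the critical line *)

Definition anl (f : C -> C) (c : C) : Prop := exists r, an f c r.

Lemma anl_const (k c : C) : anl (fun _ => k) c.
Proof. exists 1; apply an_const; lra. Qed.

Lemma anl_id (c : C) : anl (fun z => z) c.
Proof. exists 1; apply an_id; lra. Qed.

Lemma anl_exp (k c : C) : anl (fun z => Cexp (k * z)) c.
Proof. exists 1; apply an_exp; lra. Qed.

Lemma anl_combine (f g h : C -> C) (c : C) :
  (forall r, an f c r -> an g c r -> an h c r) -> anl f c -> anl g c -> anl h c.
Proof.
intros H [r Hr] [s Hs]. exists (Rmin r s).
assert (Hr0 : 0 < r) by apply Hr. assert (Hs0 : 0 < s) by apply Hs.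
assert (0 < Rmin r s) by (apply Rmin_glb_lt; assumption).
apply H; [apply an_shrink with r|apply an_shrink with s]; try assumption;
  (split; [assumption|]); [apply Rmin_l|apply Rmin_r].
Qed.

Lemma anl_plus (f g : C -> C) (c : C) : anl f c -> anl g c -> anl (fun z => f z + g z)%C c.
Proof. apply anl_combine; intros r; apply an_plus. Qed.

Lemma anl_minus (f g : C -> C) (c : C) : anl f c -> anl g c -> anl (fun z => f z - g z)%C c.
Proof. apply anl_combine; intros r; apply an_minus. Qed.

Lemma anl_mult (f g : C -> C) (c : C) : anl f c -> anl g c -> anl (fun z => f z * g z)%C c.
Proof. apply anl_combine; intros r; apply an_mult. Qed.

Lemma anl_ext (f g : C -> C) (c : C) : (forall z, f z = g z) -> anl f c -> anl g c.
Proof. intros H [r Hr]; exists r; eapply an_ext; [|exact Hr]; auto. Qed.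


(** All singularities met below are real: the pole of zeta and the odd integers. Vanishing therefore
    spreads along horizontal segments off the real axis, starting at abscissa [x0], and reaches real
    points of analyticity by continuity. *)
Lemma identity_halfplane (f : C -> C) (a x0 : R) : a < x0 ->
  (forall z, a < Re z -> Im z <> 0 -> anl f z) ->
  (forall y, y <> 0 -> vanishes_near f (x0, y)) ->
  forall z, a < Re z -> anl f z -> f z = 0.
Proof.
intros Hx Han Hv.
assert (G : forall z, a < Re z -> Im z <> 0 -> f z = 0).
{ intros z Hz Hi.
  assert (V : vanishes_near f z).
  { apply identity_segment with (x0, Im z); [|apply Hv, Hi].
    intros t Ht. apply Han.
    - autorewrite with cre.
      assert (0 <= (1 - t) * (x0 - a)) by (apply Rmult_le_pos; lra).
      destruct (Rlt_dec 0 t) as [Hp|Hp].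
      + assert (0 < t * (Re z - a)) by (apply Rmult_lt_0_compat; lra). lra.
      + replace t with 0 by lra. lra.
    - autorewrite with cre. replace (Im z + _) with (Im z) by ring. exact Hi. }
  destruct V as [d [Hd V]]. apply V.
  rewrite Cmod_diag; exact Hd. }
intros z Hz [r Hr].
apply Cmod_eq_0, Rle_antisym; [|apply Cmod_ge_0].
apply Rnot_lt_le; intros Hlt.
destruct (an_continuous f z r Hr _ Hlt) as [d [Hd Hc]].
destruct (Req_dec (Im z) 0) as [I0|I0]; [|rewrite (G z Hz I0), Cmod_0 in Hlt; lra].
set (z' := (z + RtoC (d / 2) * Ci)%C).
assert (Rz' : Re z' = Re z) by (unfold z', Ci; autorewrite with cre; ring).
assert (Hz' : Im z' <> 0) by (unfold z', Ci; autorewrite with cre; lra).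
assert (Hd' : Cmod (z' - z)%C < d).
{ unfold z'. replace (z + RtoC (d / 2) * Ci - z)%C with (RtoC (d / 2) * Ci)%C by ring.
  rewrite Cmod_mult, Cmod_Ci, Cmod_R, Rabs_pos_eq; lra. }
specialize (Hc z' Hd').
rewrite (G z') in Hc; [|rewrite Rz'; exact Hz|exact Hz'].
replace (0 - f z)%C with (- f z)%C in Hc by ring. rewrite Cmod_opp in Hc; lra.
Qed.

Definition ccont (g : R -> C) : Prop :=
  forall t, continuous (fun t => Re (g t)) t /\ continuous (fun t => Im (g t)) t.

Lemma ccont_const (c : C) : ccont (fun _ => c).
Proof. intros t; split; apply continuous_const. Qed.

Lemma ccont_cder (g g' : R -> C) : (forall t, cder g t (g' t)) -> ccont g.
Proof.
intros H t. destruct (H t) as [H1 H2].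
split; apply (ex_derive_continuous (V := R_NormedModule)); eexists; eassumption.
Qed.

Lemma ccont_ext (f g : R -> C) : (forall t, f t = g t) -> ccont f -> ccont g.
Proof.
intros E H t. destruct (H t) as [H1 H2].
split; [eapply continuous_ext; [|exact H1]|eapply continuous_ext; [|exact H2]];
  intros x; cbv beta; rewrite E; reflexivity.
Qed.

Lemma ccont_plus (f g : R -> C) : ccont f -> ccont g -> ccont (fun t => f t + g t)%C.
Proof.
intros Hf Hg t. destruct (Hf t) as [A1 A2], (Hg t) as [B1 B2]. split.
- apply (continuous_plus (V := R_NormedModule) (fun t => Re (f t)) (fun t => Re (g t))); assumption.
- apply (continuous_plus (V := R_NormedModule) (fun t => Im (f t)) (fun t => Im (g t))); assumption.
Qed.

Lemma ccont_mult (f g : R -> C) : ccont f -> ccont g -> ccont (fun t => f t * g t)%C.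
Proof.
intros Hf Hg t. destruct (Hf t) as [A1 A2], (Hg t) as [B1 B2]. split.
- apply (continuous_minus (V := R_NormedModule) (fun t => Re (f t) * Re (g t))
    (fun t => Im (f t) * Im (g t)));
  apply (continuous_mult (K := R_AbsRing)); assumption.
- apply (continuous_plus (V := R_NormedModule) (fun t => Re (f t) * Im (g t))
    (fun t => Im (f t) * Re (g t)));
  apply (continuous_mult (K := R_AbsRing)); assumption.
Qed.

Lemma ccont_minus (f g : R -> C) : ccont f -> ccont g -> ccont (fun t => f t - g t)%C.
Proof.
intros Hf Hg t. destruct (Hf t) as [A1 A2], (Hg t) as [B1 B2]. split.
- apply (continuous_minus (V := R_NormedModule) (fun t => Re (f t)) (fun t => Re (g t))); assumption.
- apply (continuous_minus (V := R_NormedModule) (fun t => Im (f t)) (fun t => Im (g t))); assumption.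
Qed.

Lemma ccont_csum (f : nat -> R -> C) (n : nat) :
  (forall k, ccont (f k)) -> ccont (fun t => csum (fun k => f k t) n).
Proof.
intros H; induction n as [|n IH]; simpl; [apply ccont_const|apply ccont_plus; auto].
Qed.

Lemma ccont_npow (n : nat) (a b : C) : ccont (fun t => npow n (a + b * RtoC t)).
Proof.
apply ccont_cder with (fun t => - b * RtoC (ln (INR n)) * npow n (a + b * RtoC t))%C.
intros t. unfold npow. apply cder_exp.
apply cder_ext with (fun t : R => - a * RtoC (ln (INR n)) + (- b * RtoC (ln (INR n))) * RtoC t)%C;
  [intros; ring|].
eapply cder_eq.
- apply cder_plus; [apply cder_const|apply cder_scal].
  apply (cder_real (fun t => t)), (is_derive_id (K := R_AbsRing)).
- change (RtoC (@one R_AbsRing)) with (RtoC 1). ring.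
Qed.

Lemma continuous_Cmod2 (g : R -> C) : ccont g -> forall t, continuous (fun t => Cmod (g t) ^ 2) t.
Proof.
intros H t. destruct (H t) as [A1 A2].
apply continuous_ext with (fun t => Re (g t) * Re (g t) + Im (g t) * Im (g t)).
- intros x; rewrite Cmod2_alt; simpl; toR; ring.
- apply (continuous_plus (V := R_NormedModule) (fun t => Re (g t) * Re (g t))
    (fun t => Im (g t) * Im (g t)));
  apply (continuous_mult (K := R_AbsRing)); assumption.
Qed.

Lemma ex_RInt_cont (f : R -> R) (a b : R) : (forall t, continuous f t) -> ex_RInt f a b.
Proof. intros H; apply (ex_RInt_continuous (V := R_CompleteNormedModule)); auto. Qed.

Section Functional.
Variable W : R -> R.
Hypothesis W_cont : forall t, continuous W t.
Hypothesis W_pos : forall t, 0 <= W t.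

(** Integral of W g over [0, 1], taken componentwise; the weight W is later |zeta|^2 on the critical
    line. *)
Definition Lam (g : R -> C) : C :=
  (RInt (fun t => W t * Re (g t)) 0 1, RInt (fun t => W t * Im (g t)) 0 1).

Lemma W_mult_cont (f : R -> R) : (forall t, continuous f t) ->
  forall t, continuous (fun t => W t * f t) t.
Proof. intros H t. apply (continuous_mult (K := R_AbsRing) W f); auto. Qed.

Lemma Lam_ext (f g : R -> C) : (forall t, f t = g t) -> Lam f = Lam g.
Proof.
intros H. unfold Lam. f_equal; apply RInt_ext; intros t _; rewrite H; reflexivity.
Qed.

Lemma Lam_plus (f g : R -> C) : ccont f -> ccont g ->
  Lam (fun t => f t + g t)%C = (Lam f + Lam g)%C.
Proof.
intros Hf Hg.
assert (G : forall p : C -> R, (forall a b, p (a + b)%C = p a + p b) ->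
  (forall t, continuous (fun t => p (f t)) t) -> (forall t, continuous (fun t => p (g t)) t) ->
  RInt (fun t => W t * p (f t + g t)%C) 0 1
  = RInt (fun t => W t * p (f t)) 0 1 + RInt (fun t => W t * p (g t)) 0 1).
{ intros p Hp Cf Cg.
  rewrite <- (RInt_plus (V := R_CompleteNormedModule) (fun t => W t * p (f t))
    (fun t => W t * p (g t))) by (apply ex_RInt_cont, W_mult_cont; assumption).
  apply RInt_ext; intros t _. rewrite Hp; apply Rmult_plus_distr_l. }
apply Ceq; [apply (G Re)|apply (G Im)]; try reflexivity; intros t; apply Hf || apply Hg.
Qed.

Lemma Lam_scal (c : C) (f : R -> C) : ccont f -> Lam (fun t => c * f t)%C = (c * Lam f)%C.
Proof.
intros Hf.
assert (H1 : ex_RInt (fun t => W t * Re (f t)) 0 1)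
  by (apply ex_RInt_cont, W_mult_cont; intros; apply Hf).
assert (H2 : ex_RInt (fun t => W t * Im (f t)) 0 1)
  by (apply ex_RInt_cont, W_mult_cont; intros; apply Hf).
assert (S : forall x y : R, RInt (fun t => x * (W t * Re (f t)) + y * (W t * Im (f t))) 0 1
  = x * RInt (fun t => W t * Re (f t)) 0 1 + y * RInt (fun t => W t * Im (f t)) 0 1).
{ intros x y.
  rewrite (RInt_plus (V := R_CompleteNormedModule) (fun t => x * (W t * Re (f t)))
    (fun t => y * (W t * Im (f t)))).
  - rewrite (RInt_scal (V := R_CompleteNormedModule) (fun t => W t * Re (f t))) by exact H1.
    rewrite (RInt_scal (V := R_CompleteNormedModule) (fun t => W t * Im (f t))) by exact H2.
    reflexivity.
  - apply (ex_RInt_scal (V := R_NormedModule) (fun t => W t * Re (f t))), H1.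
  - apply (ex_RInt_scal (V := R_NormedModule) (fun t => W t * Im (f t))), H2. }
apply Ceq.
- rewrite Re_mult. unfold Lam; rewrite !Re_pair, !Im_pair.
  transitivity (RInt (fun t => Re c * (W t * Re (f t)) + (- Im c) * (W t * Im (f t))) 0 1).
  + apply RInt_ext; intros t _. rewrite Re_mult. toR. ring.
  + rewrite S; ring.
- rewrite Im_mult. unfold Lam; rewrite !Re_pair, !Im_pair.
  transitivity (RInt (fun t => Im c * (W t * Re (f t)) + Re c * (W t * Im (f t))) 0 1).
  + apply RInt_ext; intros t _. rewrite Im_mult. toR. ring.
  + rewrite S; ring.
Qed.

Lemma Lam_minus (f g : R -> C) : ccont f -> ccont g ->
  Lam (fun t => f t - g t)%C = (Lam f - Lam g)%C.
Proof.
intros Hf Hg.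
rewrite (Lam_ext _ (fun t => f t + (-(1)) * g t)%C) by (intros; ring).
rewrite Lam_plus, Lam_scal; [ring|exact Hg|exact Hf|].
apply ccont_mult; [apply ccont_const|exact Hg].
Qed.

Lemma Lam_csum (f : nat -> R -> C) (n : nat) : (forall k, ccont (f k)) ->
  Lam (fun t => csum (fun k => f k t) n) = csum (fun k => Lam (f k)) n.
Proof.
intros H. induction n as [|n IH]; simpl.
- transitivity (0 * Lam (fun _ => 0))%C; [|ring].
  rewrite <- Lam_scal by apply ccont_const. apply Lam_ext; intros; ring.
- rewrite Lam_plus, IH; [reflexivity|apply ccont_csum, H|apply H].
Qed.

Lemma Lam_const (c : C) : Lam (fun _ => c) = (c * RtoC (RInt W 0 1))%C.
Proof.
rewrite (Lam_ext _ (fun _ => c * 1)%C) by (intros; ring).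
rewrite Lam_scal by apply ccont_const. f_equal.
apply Ceq; unfold Lam; rewrite ?Re_pair, ?Im_pair, ?Re_RtoC, ?Im_RtoC.
- apply RInt_ext; intros; apply Rmult_1_r.
- transitivity (RInt (fun _ => 0) 0 1); [apply RInt_ext; intros; apply Rmult_0_r|].
  rewrite RInt_const. apply Rmult_0_r.
Qed.

(** Real and imaginary parts are estimated separately, whence the factor 2. *)
Lemma Lam_le (g : R -> C) (Q : R -> R) : ccont g -> ex_RInt Q 0 1 ->
  (forall t, 0 <= t <= 1 -> W t * Cmod (g t) <= Q t) -> Cmod (Lam g) <= 2 * RInt Q 0 1.
Proof.
intros Hg HQ H.
assert (G : forall f : R -> R, (forall t, continuous f t) -> (forall t, Rabs (f t) <= Cmod (g t)) ->
  Rabs (RInt (fun t => W t * f t) 0 1) <= RInt Q 0 1).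
{ intros f Hf Hfg. 
  assert (E : ex_RInt (fun t => W t * f t) 0 1) by apply ex_RInt_cont, W_mult_cont, Hf.
  apply (norm_RInt_le (V := R_NormedModule) (fun t => W t * f t) Q 0 1).
  - lra.
  - intros t Ht. eapply Rle_trans; [|apply H, Ht].
    change (Rabs (W t * f t) <= W t * Cmod (g t)).
    rewrite Rabs_mult, (Rabs_pos_eq (W t)) by apply W_pos.
    apply Rmult_le_compat_l; [apply W_pos|apply Hfg].
  - exact (RInt_correct (V := R_CompleteNormedModule) _ _ _ E).
  - exact (RInt_correct (V := R_CompleteNormedModule) _ _ _ HQ). }
eapply Rle_trans; [apply Cmod_le_abs|]. unfold Lam; rewrite Re_pair, Im_pair.
generalize (G (fun t => Re (g t)) (fun t => proj1 (Hg t)) (fun t => re_le_Cmod (g t)))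
  (G (fun t => Im (g t)) (fun t => proj2 (Hg t)) (fun t => im_le_Cmod (g t))). lra.
Qed.

Lemma Lam_le_const (g : R -> C) (B : R) : ccont g ->
  (forall t, 0 <= t <= 1 -> Cmod (g t) <= B) -> Cmod (Lam g) <= 2 * (B * RInt W 0 1).
Proof.
intros Hg H.
assert (E : ex_RInt W 0 1) by apply ex_RInt_cont, W_cont.
replace (B * RInt W 0 1) with (RInt (fun t => B * W t) 0 1)
  by (rewrite (RInt_scal (V := R_CompleteNormedModule) W) by exact E; reflexivity).
apply Lam_le; [exact Hg|apply (ex_RInt_scal (V := R_NormedModule) W), E|].
intros t Ht. rewrite Rmult_comm. apply Rmult_le_compat_r; [apply W_pos|apply H, Ht].
Qed.

End Functional.

(** * The zero-free half-plane *)

Definition crit (t : R) : C := (1 / 2, t).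

Lemma crit_affine (t : R) : crit t = (RtoC (1 / 2) + Ci * RtoC t)%C.
Proof. unfold crit, Ci; apply Ceq; autorewrite with cre; ring. Qed.

Definition cA (N : nat) (t : R) : C :=
  csum (fun n => RtoC (mobius (S n)) * npow (S n) (crit t))%C N.

(* [cL N t] is [log N] times the mollifier at [1/2 + i t]. *)
Definition cL (N : nat) (t : R) : C :=
  csum (fun n => RtoC (mobius (S n)) * npow (S n) (crit t) *
    RtoC (ln (INR N) - ln (INR (S n))))%C N.

Definition gap (N : nat) : R := ln (INR (S N)) - ln (INR N).

(** Minus the divided difference of the function exp(- w x) of x between log N and log(N + 1). *)
Definition slope (N : nat) (w : C) : C := ((npow N w - npow (S N) w) / RtoC (gap N))%C.

(* [dslope k] is the coefficient of [cL (k + 2)]. *)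
Definition dslope (k : nat) (w : C) : C := (slope (S k) w - slope (S (S k)) w)%C.

Lemma ln_le_sub (x : R) : 0 < x -> ln x <= x - 1.
Proof.
intros Hx. generalize (exp_ineq1_le (ln x)). rewrite exp_ln by exact Hx; lra.
Qed.

Lemma gap_bounds (N : nat) : (0 < N)%nat -> / INR (S N) <= gap N <= / INR N.
Proof.
intros HN. apply lt_0_INR in HN. assert (HS := S_INR N). unfold gap; split.
- assert (H := ln_le_sub (INR N / INR (S N)) ltac:(apply Rdiv_lt_0_compat; lra)).
  rewrite ln_div in H by lra.
  replace (INR N / INR (S N) - 1) with (- / INR (S N)) in H by (rewrite HS; field; lra). lra.
- assert (H := ln_le_sub (INR (S N) / INR N) ltac:(apply Rdiv_lt_0_compat; lra)).
  rewrite ln_div in H by lra.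
  replace (INR (S N) / INR N - 1) with (/ INR N) in H by (rewrite HS; field; lra). lra.
Qed.

Lemma gap_pos (N : nat) : (0 < N)%nat -> 0 < gap N.
Proof.
intros HN. eapply Rlt_le_trans; [|apply gap_bounds, HN].
apply Rinv_0_lt_compat, lt_0_INR; lia.
Qed.

Lemma gap_nz (N : nat) : (0 < N)%nat -> RtoC (gap N) <> 0.
Proof. intros HN. apply RtoC_nz, Rgt_not_eq, gap_pos, HN. Qed.

(** The logarithmic weight sums the unweighted partial sums [cA] over the steps of log. This is why
    a second summation by parts turns [cA] into mollifiers. *)
Lemma cL_step (N : nat) (t : R) :
  cL (S N) t = (cL N t + cA N t * RtoC (gap N))%C.
Proof.
unfold cL, cA. cbn [csum]. rewrite Rminus_eq_0.
rewrite (Cmult_comm (csum _ N)), <- csum_scal.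
rewrite Cmult_0_r, Cplus_0_r, <- csum_plus. apply csum_ext; intros n _. unfold gap.
rewrite !RtoC_minus; ring.
Qed.

Lemma cL_1 (t : R) : cL 1 t = 0.
Proof. unfold cL; cbn [csum]. rewrite Rminus_eq_0; ring. Qed.

Lemma slope_gap (N : nat) (w : C) : (0 < N)%nat ->
  (RtoC (gap N) * slope N w)%C = (npow N w - npow (S N) w)%C.
Proof. intros HN. unfold slope. field. apply gap_nz, HN. Qed.

(* Two successive summations by parts. *)
Lemma sum_by_parts (m : nat) (t : R) (w : C) :
  csum (fun n => RtoC (mobius (S n)) * npow (S n) (crit t) * npow (S n) w)%C (S m) =
  (csum (fun k => cL (S (S k)) t * dslope k w) m + cL (S (S m)) t * slope (S m) w
   + cA (S m) t * npow (S (S m)) w)%C.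
Proof.
induction m as [|m IH].
- rewrite (cL_step 1), cL_1. unfold cA. cbn [csum].
  replace (0 + (0 + (0 + RtoC (mobius 1) * npow 1 (crit t)) * RtoC (gap 1)) * slope 1 w)%C
    with (RtoC (mobius 1) * npow 1 (crit t) * (RtoC (gap 1) * slope 1 w))%C by ring.
  rewrite slope_gap by lia. ring.
- change (csum ?f (S (S m))) with (csum f (S m) + f (S m))%C. cbv beta. rewrite IH.
  rewrite (cL_step (S (S m))). cbn [csum]. unfold dslope.
  replace ((cL (S (S m)) t + cA (S (S m)) t * RtoC (gap (S (S m)))) * slope (S (S m)) w)%C
    with (cL (S (S m)) t * slope (S (S m)) w + cA (S (S m)) t * (RtoC (gap (S (S m))) * slope (S (S m)) w))%C
    by ring.
  rewrite slope_gap by lia.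
  replace (cA (S (S m)) t) with (cA (S m) t + RtoC (mobius (S (S m))) * npow (S (S m)) (crit t))%C
    by reflexivity.
  ring.
Qed.

Lemma Cexp_taylor_2 (v : C) : Cmod (Cexp v - 1 - v)%C <= exp (Cmod v) * Cmod v ^ 2 / 2.
Proof.
assert (H := Cexp_taylor v 2).
replace (csum (exp_term v) 2) with (1 + v)%C in H
  by (unfold exp_term; simpl; field; apply RtoC_nz; lra).
replace (Cexp v - 1 - v)%C with (Cexp v - (1 + v))%C by ring.
replace (INR (fact 2)) with 2 in H by (simpl; ring). unfold Rdiv in *; lra.
Qed.

Lemma npow_shift (N M : nat) (w : C) :
  npow M w = (npow N w * Cexp (- w * RtoC (ln (INR M) - ln (INR N))))%C.
Proof. unfold npow. rewrite <- Cexp_plus; f_equal. rewrite RtoC_minus; ring. Qed.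

Lemma exp_neg_ln (N : nat) : (0 < N)%nat -> exp (- ln (INR N)) = / INR N.
Proof. intros HN. rewrite exp_Ropp, exp_ln by (apply lt_0_INR, HN); reflexivity. Qed.

(* A second divided difference of [x |-> exp (- w x)] at three consecutive logarithms. *)
Lemma dslope_bound (k : nat) (w : C) :
  Cmod (dslope k w) <= 2 * (exp (Cmod w) * Cmod w ^ 2) * exp (- (Re w + 1) * ln (INR (S (S k)))).
Proof.
set (N := S (S k)). set (p := gap (S k)). set (q := gap N).
assert (HN : 2 <= INR N) by (unfold N; rewrite !S_INR; generalize (pos_INR k); lra).
assert (Hp0 : 0 < p) by (apply gap_pos; lia).
assert (Hq0 : 0 < q) by (apply gap_pos; unfold N; lia).
assert (HpN : p <= 2 / INR N).
{ eapply Rle_trans; [apply gap_bounds; lia|]. unfold N in *. rewrite (S_INR (S k)) in *.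
  apply Rle_div_r; [lra|]. apply (Rmult_le_reg_l (INR (S k))); [lra|]. 
  replace (INR (S k) * (/ INR (S k) * (INR (S k) + 1))) with (INR (S k) + 1) by (field; lra). lra. }
assert (HqN : q <= / INR N) by (apply gap_bounds; unfold N; lia).
assert (HN1 : / INR N <= / 2) by (apply Rinv_le_contravar; lra).
assert (Hp1 : p <= 1) by (unfold Rdiv in HpN; lra).
assert (Hq1 : q <= 1) by lra.
(* Both exponentials are expanded at the middle point log N; the linear terms w and - w cancel, so
   only second-order remainders are left. *)
assert (E : dslope k w = (npow N w * ((Cexp (w * RtoC p) - 1 - w * RtoC p) / RtoC p
   + (Cexp (- w * RtoC q) - 1 - (- w * RtoC q)) / RtoC q))%C).
{ unfold dslope, slope. fold N. fold p q.
  rewrite (npow_shift N (S k)), (npow_shift N (S N)).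
  replace (- w * RtoC (ln (INR (S k)) - ln (INR N)))%C with (w * RtoC p)%C
    by (unfold p, gap, N; rewrite !RtoC_minus; ring).
  fold (gap N); fold q.
  field. split; apply gap_nz; unfold N; lia. }
assert (B : forall (v : C) (x : R), 0 < x <= 1 -> Cmod v = Cmod w ->
  Cmod ((Cexp (v * RtoC x) - 1 - v * RtoC x) / RtoC x)%C <= exp (Cmod w) * Cmod w ^ 2 / 2 * x).
{ intros v x Hx Hv.
  assert (RtoC x <> 0) by (apply RtoC_nz; lra).
  rewrite Cmod_div, Cmod_R, Rabs_pos_eq by (assumption || lra).
  apply Rle_div_l; [lra|].
  eapply Rle_trans; [apply Cexp_taylor_2|].
  rewrite Cmod_mult, Cmod_R, Rabs_pos_eq, Hv by lra.
  assert (H1 : exp (Cmod w * x) <= exp (Cmod w)) by (apply exp_mono; generalize (Cmod_ge_0 w); nra).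
  replace ((Cmod w * x) ^ 2) with (Cmod w ^ 2 * (x * x)) by ring.
  assert (0 <= Cmod w ^ 2 * (x * x)) by (generalize (pow2_ge_0 (Cmod w)); nra).
  nra. }
rewrite E, Cmod_mult, Cmod_npow.
assert (B1 := B w p (conj Hp0 Hp1) eq_refl).
assert (B2 := B (- w)%C q (conj Hq0 Hq1) (Cmod_opp w)).
set (Q := exp (Cmod w) * Cmod w ^ 2) in *.
assert (HQ : 0 <= Q) by (apply Rmult_le_pos; [left; apply exp_pos|apply pow2_ge_0]).
replace (exp (- (Re w + 1) * ln (INR N))) with (exp (- Re w * ln (INR N)) * / INR N)
  by (rewrite <- exp_neg_ln, <- exp_plus by (unfold N; lia); f_equal; ring).
assert (B3 := Cmod_triangle ((Cexp (w * RtoC p) - 1 - w * RtoC p) / RtoC p)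
  ((Cexp (- w * RtoC q) - 1 - (- w * RtoC q)) / RtoC q)).
assert (P := exp_pos (- Re w * ln (INR N))).
assert (B4 : Q / 2 * p + Q / 2 * q <= 2 * Q * / INR N).
{ assert (0 < / INR N) by (apply Rinv_0_lt_compat; lra). unfold Rdiv in *. nra. }
replace (2 * Q * (exp (- Re w * ln (INR N)) * / INR N))
  with (exp (- Re w * ln (INR N)) * (2 * Q * / INR N)) by ring.
apply Rmult_le_compat_l; lra.
Qed.

Lemma ccont_npow_crit (n : nat) : ccont (fun t => npow n (crit t)).
Proof.
apply ccont_ext with (2 := ccont_npow n (RtoC (1 / 2)) Ci).
intros t; rewrite crit_affine; reflexivity.
Qed.

Lemma ccont_npow_sub (n : nat) (z : C) : ccont (fun t => npow n (z - crit t)%C).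
Proof.
apply ccont_ext with (2 := ccont_npow n (z - RtoC (1 / 2))%C (- Ci)%C).
intros t; rewrite crit_affine; f_equal; ring.
Qed.

Lemma ccont_cL (N : nat) : ccont (cL N).
Proof.
apply (ccont_csum (fun n t => RtoC (mobius (S n)) * npow (S n) (crit t) *
    RtoC (ln (INR N) - ln (INR (S n))))%C).
intros n. apply ccont_mult; [|apply ccont_const].
apply ccont_mult; [apply ccont_const|apply ccont_npow_crit].
Qed.

Lemma ccont_cA (N : nat) : ccont (cA N).
Proof.
apply (ccont_csum (fun n t => RtoC (mobius (S n)) * npow (S n) (crit t))%C).
intros n. apply ccont_mult; [apply ccont_const|apply ccont_npow_crit].
Qed.

Lemma ccont_slope (N : nat) (z : C) : ccont (fun t => slope N (z - crit t)%C).
Proof.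
apply ccont_mult; [|apply ccont_const]. apply ccont_minus; apply ccont_npow_sub.
Qed.

Lemma ccont_dslope (k : nat) (z : C) : ccont (fun t => dslope k (z - crit t)%C).
Proof. apply ccont_minus; apply ccont_slope. Qed.

Lemma mollifier_cL (N : nat) (t : R) : (2 <= N)%nat ->
  cL N t = (RtoC (ln (INR N)) * mollifier N (crit t))%C.
Proof.
intros HN.
assert (Hl : 0 < ln (INR N)) by (rewrite <- ln_1; apply ln_increasing; [lra|]; apply (lt_INR 1); lia).
assert (Hl' : RtoC (ln (INR N)) <> 0) by (apply RtoC_nz; lra).
unfold mollifier.
assert (E : forall (f : nat -> C) n, (0 < n)%nat ->
  sum_n_m (G := C_AbelianMonoid) f 1 n = csum (fun k => f (S k)) n).
{ intros f n Hn. destruct n as [|n]; [lia|]. rewrite <- sum_n_m_S, <- csum_sum_n; reflexivity. }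
rewrite E by lia. unfold cL. rewrite <- csum_scal. apply csum_ext; intros n _.
rewrite <- ncpow_inv. rewrite !RtoC_minus, RtoC_div by lra.
unfold Cdiv. field. split; [exact Hl'|apply Cexp_nz].
Qed.

Section PartOne.
Variable zeta : C -> C.
Hypothesis Hzeta : is_riemann_zeta zeta.

Lemma anl_zeta (z : C) : z <> 1 -> anl zeta z.
Proof. intros H. apply analytic_at_an, (proj2 Hzeta), H. Qed.

Lemma ccont_zeta : ccont (fun t => zeta (crit t)).
Proof.
intros t.
destruct (anl_zeta (crit t)) as [r Hr].
{ intros E. apply (f_equal Re) in E. unfold crit in E; simpl in E; lra. }
assert (G : forall f : C -> R, (forall a b, f (a - b)%C = f a - f b) ->
  (forall z, Rabs (f z) <= Cmod z) -> continuous (fun t => f (zeta (crit t))) t).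
{ intros f Hf Hle. apply continuity_pt_filterlim. intros eps Heps.
  destruct (an_continuous _ _ _ Hr eps Heps) as [d [Hd H]].
  exists d; split; [exact Hd|]. intros x [_ Hx]. simpl in *. unfold R_dist in *.
  rewrite <- Hf. eapply Rle_lt_trans; [apply Hle|apply H].
  replace (crit x - crit t)%C with (RtoC (x - t) * Ci)%C
    by (unfold crit, Ci; apply Ceq; autorewrite with cre; ring).
  rewrite Cmod_mult, Cmod_Ci, Cmod_R; lra. }
split; apply G; [exact Re_minus|exact re_le_Cmod|exact Im_minus|exact im_le_Cmod].
Qed.

Definition W (t : R) : R := Cmod (zeta (crit t)) ^ 2.

Lemma W_cont (t : R) : continuous W t.
Proof. apply (continuous_Cmod2 (fun t => zeta (crit t))), ccont_zeta. Qed.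

Lemma W_pos (t : R) : 0 <= W t.
Proof. apply pow2_ge_0. Qed.

Definition Kz : R := RInt W 0 1.

Lemma zeta_nonzero_right (z : C) : 2 < Re z -> zeta z <> 0.
Proof.
intros Hz E. assert (H := zeta_mobius zeta Hzeta z Hz).
assert (H' : RtoC 1 = 0).
{ apply Clim_unique with (1 := H). apply Clim_ext with (fun _ => RtoC 0); [|apply Clim_const].
  intros n; rewrite E; ring. }
apply RtoC_inj in H'; lra.
Qed.

(** If zeta vanished on this piece of the line, its zeros would accumulate at 1/2 + i/2, and the
    segment at height 1/2, which avoids the pole, would carry the vanishing to 3 + i/2, where zeta
    is nonzero. *)
Lemma zeta_nonzero_critical : exists t, 0 < t < 1 /\ zeta (crit t) <> 0.
Proof.
destruct (excluded_middle_informative (exists t, 0 < t < 1 /\ zeta (crit t) <> 0)) as [H|H];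
  [exact H|exfalso].
assert (Z : forall t, 0 < t < 1 -> zeta (crit t) = 0).
{ intros t Ht. destruct (Ceq_dec (zeta (crit t)) 0) as [E|E]; [exact E|].
  exfalso; apply H; exists t; auto. }
assert (V : vanishes_near zeta (crit (1 / 2))).
{ destruct (anl_zeta (crit (1 / 2))) as [r Hr].
  { intros E. apply (f_equal Re) in E. unfold crit in E; simpl in E; lra. }
  exists r; split; [apply Hr|].
  apply (an_accumulating_zeros zeta (crit (1 / 2)) r Hr). intros d Hd.
  assert (Hm : 0 < Rmin d (1 / 2) / 2) by (assert (0 < Rmin d (1 / 2)) by (apply Rmin_glb_lt; lra); lra).
  exists (crit (1 / 2 + Rmin d (1 / 2) / 2)).
  replace (crit (1 / 2 + Rmin d (1 / 2) / 2) - crit (1 / 2))%C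
    with (RtoC (Rmin d (1 / 2) / 2) * Ci)%C
    by (unfold crit, Ci; apply Ceq; autorewrite with cre; ring).
  rewrite Cmod_mult, Cmod_Ci, Cmod_R, Rabs_pos_eq by lra.
  generalize (Rmin_l d (1 / 2)) (Rmin_r d (1 / 2)); intros A1 A2.
  split; [lra|]. apply Z; lra. }
assert (V' : vanishes_near zeta (3, 1 / 2)).
{ apply identity_segment with (2 := V). intros t Ht. apply anl_zeta.
  intros E. apply (f_equal Im) in E. revert E. unfold crit. autorewrite with cre. lra. }
destruct V' as [d [Hd V']].
apply (zeta_nonzero_right (3, 1 / 2)); [simpl; lra|]. apply V'.
rewrite Cmod_diag; exact Hd.
Qed.

Lemma Kz_pos : 0 < Kz.
Proof.
destruct zeta_nonzero_critical as [t0 [Ht0 Hz]].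
assert (Hw : 0 < W t0) by (apply pow_lt, Cmod_gt_0, Hz).
assert (Hc := W_cont t0).
apply continuity_pt_filterlim in Hc.
destruct (Hc (W t0 / 2) ltac:(lra)) as [d [Hd H]]. simpl in H; unfold R_dist in H.
(* The interval of radius [e] about [t0] stays inside (0, 1) and inside the neighbourhood where W
   exceeds half of W(t0). *)
set (e := Rmin (d / 2) (Rmin (t0 / 2) ((1 - t0) / 2))).
assert (He : 0 < e) by (repeat apply Rmin_glb_lt; lra).
assert (E1 : e <= d / 2) by apply Rmin_l.
assert (E2 : e <= t0 / 2) by (eapply Rle_trans; [apply Rmin_r|apply Rmin_l]).
assert (E3 : e <= (1 - t0) / 2) by (eapply Rle_trans; [apply Rmin_r|apply Rmin_r]).
assert (X : forall a b, ex_RInt W a b) by (intros; apply ex_RInt_cont, W_cont).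
unfold Kz.
rewrite <- (RInt_Chasles (V := R_CompleteNormedModule) W 0 (t0 - e) 1) by apply X.
rewrite <- (RInt_Chasles (V := R_CompleteNormedModule) W (t0 - e) (t0 + e) 1) by apply X.
assert (P1 : 0 <= RInt W 0 (t0 - e)) by (apply RInt_ge_0; [lra|apply X|intros; apply W_pos]).
assert (P3 : 0 <= RInt W (t0 + e) 1) by (apply RInt_ge_0; [lra|apply X|intros; apply W_pos]).
assert (P2 : 0 < RInt W (t0 - e) (t0 + e)).
{ apply RInt_gt_0; [lra| |intros; apply W_cont].
  intros x Hx. destruct (Req_EM_T x t0) as [->|Hne]; [exact Hw|].
  assert (Hx' : Rabs (W x - W t0) < W t0 / 2).
  { apply H. split; [split; [exact I|]|]; [intros E; apply Hne; auto|].
    apply Rabs_def1; lra. }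
  apply Rabs_def2 in Hx'; lra. }
change (0 < RInt W 0 (t0 - e) + (RInt W (t0 - e) (t0 + e) + RInt W (t0 + e) 1)). lra.
Qed.

Definition msq (N : nat) (t : R) : R := Cmod (mollifier N (crit t)) ^ 2 * W t.

Lemma ccont_mollifier (N : nat) : (2 <= N)%nat -> ccont (fun t => mollifier N (crit t)).
Proof.
intros HN.
assert (Hl : 0 < ln (INR N)) by (rewrite <- ln_1; apply ln_increasing; [lra|]; apply (lt_INR 1); lia).
assert (Hl' : RtoC (ln (INR N)) <> 0) by (apply RtoC_nz; lra).
apply ccont_ext with (2 := ccont_mult _ _ (ccont_const (/ RtoC (ln (INR N)))) (ccont_cL N)).
intros t; rewrite mollifier_cL by exact HN; field; exact Hl'.
Qed.

Lemma msq_cont (N : nat) : (2 <= N)%nat -> forall t, continuous (msq N) t.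
Proof.
intros HN t. apply (continuous_mult (K := R_AbsRing) (fun t => Cmod (mollifier N (crit t)) ^ 2) W).
- apply (continuous_Cmod2 (fun t => mollifier N (crit t))), ccont_mollifier, HN.
- apply W_cont.
Qed.

Lemma msq_pos (N : nat) (t : R) : 0 <= msq N t.
Proof. apply Rmult_le_pos; [apply pow2_ge_0|apply W_pos]. Qed.

(** For given N the moment is taken up to the smallest useful height, T of size N^(1/theta), and the
    part over [1, T] is dropped by positivity. *)
Lemma moment_unit (theta eps : R) : 0 < theta -> 0 < eps -> moment_bound zeta theta ->
  exists B, 0 < B /\ forall N, (2 <= N)%nat ->
    RInt (msq N) 0 1 <= B * exp ((1 + eps) / theta * ln (INR N)).
Proof.
intros Hth Heps Hm. destruct (Hm eps Heps) as [B [HB H]].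
exists (B * exp ((1 + eps) * ln 2)). split; [apply Rmult_lt_0_compat; [exact HB|apply exp_pos]|].
intros N HN.
(* The factor 2 ensures T >= 2, and N <= T^theta holds since 2^theta >= 1. It enters the constant as
   2^(1 + eps). *)
set (T := 2 * exp (ln (INR N) / theta)).
assert (HT : ln T = ln 2 + ln (INR N) / theta)
  by (unfold T; rewrite ln_mult, ln_exp; [reflexivity|lra|apply exp_pos]).
assert (HNp : 0 < INR N) by (apply (lt_INR 0); lia).
assert (HL := ln_INR_ge_0 N).
assert (HLt : 0 <= ln (INR N) / theta) by (apply Rdiv_le_0_compat; lra).
assert (HT2 : 2 <= T).
{ unfold T. assert (1 <= exp (ln (INR N) / theta)) by (rewrite <- exp_0; apply exp_mono; lra). lra. }
assert (HNT : INR N <= Rpower T theta).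
{ unfold Rpower. rewrite HT. rewrite <- (exp_ln (INR N)) at 1 by exact HNp. apply exp_mono.
  assert (0 <= ln 2) by (rewrite <- ln_1; apply ln_le; lra).
  replace (theta * (ln 2 + ln (INR N) / theta)) with (theta * ln 2 + ln (INR N)) by (field; lra).
  nra. }
specialize (H T N HT2 HN HNT).
assert (X : forall a b, ex_RInt (msq N) a b) by (intros; apply ex_RInt_cont, msq_cont, HN).
assert (E : mollified_moment zeta N 0 T = RInt (msq N) 0 1 + RInt (msq N) 1 T).
{ unfold mollified_moment.
  transitivity (RInt (msq N) 0 T); [reflexivity|].
  rewrite <- (RInt_Chasles (V := R_CompleteNormedModule) (msq N) 0 1 T) by apply X.
  reflexivity. }
rewrite E in H.
assert (P : 0 <= RInt (msq N) 1 T) by (apply RInt_ge_0; [lra|apply X|intros; apply msq_pos]).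
replace (B * exp ((1 + eps) * ln 2) * exp ((1 + eps) / theta * ln (INR N)))
  with (B * Rpower T (1 + eps)); [lra|].
unfold Rpower. rewrite HT, Rmult_assoc, <- exp_plus. f_equal. f_equal. field; lra.
Qed.

(* AM-GM in place of Cauchy-Schwarz; [lam] is later the size of the root of the second moment. *)
Lemma Lam_cL_bound (N : nat) (g : R -> C) (B S lam : R) : (2 <= N)%nat -> ccont g -> 0 < lam ->
  0 <= S -> (forall t, 0 <= t <= 1 -> Cmod (g t) <= S) ->
  RInt (msq N) 0 1 <= B * (lam * lam) ->
  Cmod (Lam W (fun t => cL N t * g t)%C) <= S * ln (INR N) * lam * (Kz + B).
Proof.
intros HN Hg Hl HS Hgs HB.
assert (HL := ln_INR_ge_0 N).
set (Q := fun t => S * ln (INR N) * / 2 * (lam * W t + / lam * msq N t)).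
assert (X1 : ex_RInt W 0 1) by apply ex_RInt_cont, W_cont.
assert (X2 : ex_RInt (msq N) 0 1) by apply ex_RInt_cont, msq_cont, HN.
assert (XQ' : is_RInt (fun t => lam * W t + / lam * msq N t) 0 1
  (lam * Kz + / lam * RInt (msq N) 0 1)).
{ apply (is_RInt_plus (V := R_NormedModule) (fun t => lam * W t) (fun t => / lam * msq N t)).
  - apply (is_RInt_scal (V := R_NormedModule) W).
    exact (RInt_correct (V := R_CompleteNormedModule) _ _ _ X1).
  - apply (is_RInt_scal (V := R_NormedModule) (msq N)).
    exact (RInt_correct (V := R_CompleteNormedModule) _ _ _ X2). }
assert (XQ : is_RInt Q 0 1 (S * ln (INR N) * / 2 * (lam * Kz + / lam * RInt (msq N) 0 1)))
  by (apply (is_RInt_scal (V := R_NormedModule) (fun t => lam * W t + / lam * msq N t)), XQ').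
eapply Rle_trans.
- apply (Lam_le W W_cont W_pos _ Q).
  + apply ccont_mult; [apply ccont_cL|exact Hg].
  + eexists; exact XQ.
  + intros t Ht. rewrite (mollifier_cL N t HN), !Cmod_mult, Cmod_R, (Rabs_pos_eq _ HL).
    unfold Q, msq. set (m := Cmod (mollifier N (crit t))).
    assert (Hm : m <= / 2 * (lam + / lam * m ^ 2)).
    { assert (P : 0 < / lam) by (apply Rinv_0_lt_compat, Hl).
      apply Rmult_le_reg_l with lam; [exact Hl|].
      replace (lam * (/ 2 * (lam + / lam * m ^ 2))) with (/ 2 * (lam * lam + m ^ 2)) by (field; lra).
      assert (Sq := Rle_0_sqr (lam - m)). unfold Rsqr in Sq. simpl. lra. }
    assert (Hm0 : 0 <= m) by apply Cmod_ge_0.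
    specialize (Hgs t Ht). assert (G0 := Cmod_ge_0 (g t)). assert (Wt := W_pos t). fold W in Wt.
    replace (S * ln (INR N) * / 2 * (lam * W t + / lam * (m ^ 2 * W t)))
      with (W t * (ln (INR N) * (/ 2 * (lam + / lam * m ^ 2)) * S)) by ring.
    apply Rmult_le_compat_l; [exact Wt|].
    apply Rmult_le_compat; [apply Rmult_le_pos; assumption|exact G0| |exact Hgs].
    apply Rmult_le_compat_l; assumption.
- rewrite (is_RInt_unique (V := R_CompleteNormedModule) Q 0 1 _ XQ).
  (* The factor 2 of [Lam_le] cancels the 1/2 of the arithmetic-geometric mean inequality. *)
  replace (2 * (S * ln (INR N) * / 2 * (lam * Kz + / lam * RInt (msq N) 0 1)))
    with (S * ln (INR N) * (lam * Kz + / lam * RInt (msq N) 0 1)) by (field; lra).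
  rewrite (Rmult_assoc (S * ln (INR N))). apply Rmult_le_compat_l; [apply Rmult_le_pos; assumption|].
  rewrite Rmult_plus_distr_l. apply Rplus_le_compat_l.
  replace (lam * B) with (/ lam * (B * (lam * lam))) by (field; lra).
  apply Rmult_le_compat_l; [left; apply Rinv_0_lt_compat, Hl|exact HB].
Qed.

Definition Tterm (k : nat) (z : C) : C := Lam W (fun t => cL (S (S k)) t * dslope k (z - crit t))%C.

Lemma npow_sub (n : nat) (z w : C) : npow n (z - w) = (npow n z * npow n (- w))%C.
Proof. unfold npow. rewrite <- Cexp_plus; f_equal; ring. Qed.

Lemma ccont_npow_opp (n : nat) : ccont (fun t => npow n (- crit t)%C).
Proof. apply ccont_ext with (2 := ccont_npow_sub n 0). intros t; f_equal; ring. Qed.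

(** The factor n^(-(z - s)) splits into n^(-z) and n^s, so z leaves the integral: [Tterm k] is a
    combination of the three exponentials n^(-z) with n = k + 1, k + 2, k + 3, hence entire. *)
Lemma anl_Tterm (k : nat) (c : C) (r : R) : 0 < r -> an (Tterm k) c r.
Proof.
intros Hr.
assert (An : forall n, an (npow n) c r).
{ intros n. apply an_ext with (fun z => Cexp (- RtoC (ln (INR n)) * z)); [|apply an_exp, Hr].
  intros z _; unfold npow; f_equal; ring. }
set (u := fun (n : nat) (t : R) => (cL (S (S k)) t * npow n (- crit t))%C).
assert (Cu : forall n, ccont (u n)) by (intros n; apply ccont_mult; [apply ccont_cL|apply ccont_npow_opp]).
set (v := fun n z => (npow n z * Lam W (u n))%C).
assert (Av : forall n, an (v n) c r) by (intros n; apply an_mult; [apply An|apply an_const, Hr]).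
assert (Hv : forall n z, Lam W (fun t => cL (S (S k)) t * npow n (z - crit t))%C = v n z).
{ intros n z. unfold v. rewrite <- (Lam_scal W W_cont) by apply Cu.
  apply Lam_ext; intros t. rewrite npow_sub. unfold u; ring. }
apply an_ext with (fun z => / RtoC (gap (S k)) * (v (S k) z - v (S (S k)) z)
   - / RtoC (gap (S (S k))) * (v (S (S k)) z - v (S (S (S k))) z))%C.
- intros z _. rewrite <- !Hv. unfold Tterm.
  assert (P : forall n, ccont (fun t => cL (S (S k)) t * npow n (z - crit t))%C)
    by (intros n; apply ccont_mult; [apply ccont_cL|apply ccont_npow_sub]).
  rewrite <- !(Lam_minus W W_cont) by apply P.
  rewrite <- !(Lam_scal W W_cont) by (apply ccont_minus; apply P).
  rewrite <- (Lam_minus W W_cont)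
    by (apply ccont_mult; [apply ccont_const|apply ccont_minus; apply P]).
  apply Lam_ext; intros t. unfold dslope, slope. field. split; apply gap_nz; lia.
- apply an_minus; apply an_scal; apply an_minus; apply Av.
Qed.

Lemma Cmod_crit (t : R) : 0 <= t <= 1 -> Cmod (crit t) <= 2.
Proof.
intros Ht. eapply Rle_trans; [apply Cmod_le_abs|]. unfold crit. rewrite Re_pair, Im_pair.
rewrite !Rabs_pos_eq; lra.
Qed.

(** * Continuation of the averaged series from a mean square bound with exponent 2 kappa *)

Section Continuation.
Variables kappa B : R.
Hypothesis B_pos : 0 < B.
Hypothesis msq_bound : forall N, (2 <= N)%nat ->
  RInt (msq N) 0 1 <= B * exp (2 * kappa * ln (INR N)).

(** For s on the line Re(z - s) + 1 >= a + 1/2, which is the decay of [dslope]; the mean size of the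
    mollifier costs kappa, and delta absorbs the factor log N. *)
Lemma Tterm_bound (a Z delta : R) : 0 < delta -> 0 <= Z ->
  exists M, forall k z, Cmod z <= Z -> a <= Re z ->
    Cmod (Tterm k z) <= M * exp (- (a + 1 / 2 - kappa - delta) * ln (INR (S (S k)))).
Proof.
intros Hd HZ. set (Y := Z + 2).
exists (2 * (exp Y * Y ^ 2) * / delta * (Kz + B)).
intros k z Hz Ha. set (N := S (S k)).
assert (HL := ln_INR_ge_0 N).
assert (HK : 0 < Kz) by apply Kz_pos.
set (l := ln (INR N)) in *.
set (S0 := 2 * (exp Y * Y ^ 2) * exp (- (a + 1 / 2) * l)).
assert (HY : 0 <= exp Y * Y ^ 2) by (apply Rmult_le_pos; [left; apply exp_pos|apply pow2_ge_0]).
assert (HS0 : 0 <= S0) by (apply Rmult_le_pos; [lra|left; apply exp_pos]).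
eapply Rle_trans.
- apply (Lam_cL_bound N (fun t => dslope k (z - crit t)%C) B S0 (exp (kappa * l))).
  + unfold N; lia.
  + apply ccont_dslope.
  + apply exp_pos.
  + exact HS0.
  + intros t Ht. eapply Rle_trans; [apply dslope_bound|]. fold N l.
    assert (Hw : Cmod (z - crit t)%C <= Y).
    { eapply Rle_trans; [apply Cmod_triangle|]. rewrite Cmod_opp.
      generalize (Cmod_crit t Ht). unfold Y; lra. }
    assert (Hw0 := Cmod_ge_0 (z - crit t)%C).
    unfold S0. apply Rmult_le_compat.
    * apply Rmult_le_pos; [lra|]. apply Rmult_le_pos; [left; apply exp_pos|apply pow2_ge_0].
    * left; apply exp_pos.
    * apply Rmult_le_compat_l; [lra|]. apply Rmult_le_compat;
        [left; apply exp_pos|apply pow2_ge_0|apply exp_mono, Hw|apply pow_incr; lra].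
    * apply exp_mono. rewrite Re_minus. unfold crit; rewrite Re_pair. nra.
  + rewrite <- exp_plus. replace (kappa * l + kappa * l) with (2 * kappa * l) by ring.
    apply msq_bound. unfold N; lia.
- fold l.
  assert (Hl : l <= / delta * exp (delta * l)).
  { apply Rmult_le_reg_l with delta; [exact Hd|]. rewrite <- Rmult_assoc, Rinv_r, Rmult_1_l by lra.
    generalize (exp_ineq1_le (delta * l)); lra. }
  replace (exp (- (a + 1 / 2 - kappa - delta) * l)) with
    (exp (- (a + 1 / 2) * l) * exp (delta * l) * exp (kappa * l))
    by (rewrite <- !exp_plus; f_equal; ring).
  replace (2 * (exp Y * Y ^ 2) * / delta * (Kz + B) *
    (exp (- (a + 1 / 2) * l) * exp (delta * l) * exp (kappa * l)))
    with (S0 * (/ delta * exp (delta * l)) * exp (kappa * l) * (Kz + B)) by (unfold S0; ring).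
  apply Rmult_le_compat_r; [lra|]. apply Rmult_le_compat_r; [left; apply exp_pos|].
  apply Rmult_le_compat_l; [exact HS0|exact Hl].
Qed.

(* The continuation of [Kz / zeta]. *)
Definition Hfun (z : C) : C := epsilon (inhabits (RtoC 0)) (Csums (fun k => Tterm k z)).

Lemma ex_series_rpow_shift (sigma : R) : 1 < sigma ->
  ex_series (fun k => exp (- sigma * ln (INR (S (S k))))).
Proof.
intros Hs. apply (ex_series_rtail (fun n => exp (- sigma * ln (INR (S n)))) 1).
apply ex_series_rpow, Hs.
Qed.

Lemma Hfun_spec (z0 : C) : 1 / 2 + kappa < Re z0 ->
  anl Hfun z0 /\ Csums (fun k => Tterm k z0) (Hfun z0).
Proof.
intros Hz0.
(* With a quarter of the available margin, a disc of radius d and a loss delta = d still leave the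
   decay exponent 1 + 2 d. *)
set (d := (Re z0 - (1 / 2 + kappa)) / 4).
assert (Hd : 0 < d) by (unfold d; lra).
destruct (Tterm_bound (Re z0 - d) (Cmod z0 + d) d Hd) as [M HM].
{ generalize (Cmod_ge_0 z0); lra. }
set (b := fun k => M * exp (- (Re z0 - d + 1 / 2 - kappa - d) * ln (INR (S (S k))))).
assert (Hb : ex_series b).
{ apply Rex_series_scal, ex_series_rpow_shift. unfold d in *; lra. }
assert (Hbd : forall k z, Cmod (z - z0)%C < d -> Cmod (Tterm k z) <= b k).
{ intros k z Hz. apply HM.
  - generalize (Cmod_triangle_inv z z0); lra.
  - generalize (Re_near z z0 d Hz); lra. }
assert (Hs : forall z, Cmod (z - z0)%C < d -> Csums (fun k => Tterm k z) (Hfun z)).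
{ intros z Hz. apply (epsilon_spec (inhabits (RtoC 0)) (Csums (fun k => Tterm k z))).
  destruct (Csums_abs (fun k => Tterm k z) b) as [l [Hl _]];
    [intros k; apply Hbd, Hz|exact Hb|exists l; exact Hl]. }
split.
- exists d. apply an_series with Tterm b; auto. intros k; apply anl_Tterm, Hd.
- apply Hs. rewrite Cmod_diag; exact Hd.
Qed.

Lemma npow_crit_le (n : nat) (t : R) : Cmod (npow n (crit t)) <= 1.
Proof.
rewrite Cmod_npow, <- exp_0. apply exp_mono. unfold crit; rewrite Re_pair.
generalize (ln_INR_ge_0 n); lra.
Qed.

Lemma Cmod_cA (N : nat) (t : R) : Cmod (cA N t) <= INR N.
Proof.
eapply Rle_trans; [apply Cmod_csum|].
replace (INR N) with (rsum (fun _ => 1) N) by (rewrite rsum_const; ring).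
apply rsum_le; intros n _. rewrite Cmod_mult, Cmod_R.
generalize (Mobius.mobius_le_1 (S n)) (npow_crit_le (S n) t) (Rabs_pos (mobius (S n)))
  (Cmod_ge_0 (npow (S n) (crit t))). nra.
Qed.

Lemma Cmod_cL (N : nat) (t : R) : Cmod (cL N t) <= INR N * INR N.
Proof.
eapply Rle_trans; [apply Cmod_csum|]. rewrite <- (rsum_const (INR N) N).
apply rsum_le; intros n Hn. rewrite !Cmod_mult, !Cmod_R.
assert (H1 : Rabs (ln (INR N) - ln (INR (S n))) <= INR N).
{ assert (HnN : ln (INR (S n)) <= ln (INR N)) by (apply ln_le; [apply lt_0_INR; lia|apply le_INR; lia]).
  assert (H0 := ln_INR_ge_0 (S n)).
  assert (H2 : ln (INR N) <= INR N - 1) by (apply ln_le_sub, lt_0_INR; lia).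
  rewrite Rabs_pos_eq; lra. }
assert (H2 : Rabs (mobius (S n)) * Cmod (npow (S n) (crit t)) <= 1).
{ generalize (Mobius.mobius_le_1 (S n)) (npow_crit_le (S n) t) (Rabs_pos (mobius (S n)))
  (Cmod_ge_0 (npow (S n) (crit t))). nra. }
replace (INR N) with (1 * INR N) at 2 by ring.
apply Rmult_le_compat; [|apply Rabs_pos|exact H2|exact H1].
apply Rmult_le_pos; [apply Rabs_pos|apply Cmod_ge_0].
Qed.

Lemma npow_le_inv4 (N : nat) (w : C) : (0 < N)%nat -> 4 <= Re w ->
  Cmod (npow N w) <= (/ INR N) ^ 4.
Proof.
intros HN Hw. eapply Rle_trans; [apply (Cmod_npow_le N w 4 Hw)|].
rewrite <- exp_neg_ln by exact HN.
replace (- (4) * ln (INR N)) with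
  (- ln (INR N) + (- ln (INR N) + (- ln (INR N) + - ln (INR N)))) by ring.
rewrite !exp_plus. apply Req_le. ring.
Qed.

(** Trivial estimates suffice this far to the right. With X = m + 1, [cL] is at most (2 X)^2 and the
    slope at most 4 X^(-3), which gives 16 / X; the term with [cA] adds at most 1 / X. *)
Lemma boundary_bound (m : nat) (t : R) (w : C) : 4 <= Re w ->
  Cmod (cL (S (S m)) t * slope (S m) w + cA (S m) t * npow (S (S m)) w)%C <= 17 * / INR (S m).
Proof.
intros Hw. set (X := INR (S m)).
assert (HX : 1 <= X) by (unfold X; rewrite S_INR; generalize (pos_INR m); lra).
assert (HX1 : INR (S (S m)) = X + 1) by (unfold X; apply S_INR).
set (y := / X). assert (Hy : 0 < y) by (apply Rinv_0_lt_compat; lra).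
assert (Hy1 : y <= 1) by (unfold y; rewrite <- Rinv_1; apply Rinv_le_contravar; lra).
assert (Exy : X * y = 1) by (unfold y; field; lra).
assert (N1 : Cmod (npow (S m) w) <= y ^ 4) by (apply npow_le_inv4; [lia|exact Hw]).
assert (N2 : Cmod (npow (S (S m)) w) <= y ^ 4).
{ eapply Rle_trans; [apply npow_le_inv4; [lia|exact Hw]|]. rewrite HX1.
  apply pow_incr. split; [left; apply Rinv_0_lt_compat; lra|].
  apply Rinv_le_contravar; lra. }
assert (G : / (X + 1) <= gap (S m)) by (rewrite <- HX1; apply gap_bounds; lia).
assert (G0 := gap_pos (S m) ltac:(lia)).
assert (B1 : Cmod (slope (S m) w) <= 2 * y ^ 4 * (2 * X)).
{ unfold slope. rewrite Cmod_div, Cmod_R, Rabs_pos_eq by (try apply gap_nz; lia || lra).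
  unfold Rdiv. apply Rmult_le_compat.
  - apply Cmod_ge_0.
  - left; apply Rinv_0_lt_compat, G0.
  - eapply Rle_trans; [apply Cmod_triangle|]. rewrite Cmod_opp; lra.
  - apply Rle_trans with (/ / (X + 1)); [apply Rinv_le_contravar; [apply Rinv_0_lt_compat; lra|exact G]|].
    rewrite Rinv_inv; lra. }
assert (B2 := Cmod_cL (S (S m)) t). rewrite HX1 in B2.
assert (B3 := Cmod_cA (S m) t). fold X in B3.
eapply Rle_trans; [apply Cmod_triangle|]. rewrite !Cmod_mult.
assert (P1 : Cmod (cL (S (S m)) t) * Cmod (slope (S m) w) <= (2 * X) * (2 * X) * (2 * y ^ 4 * (2 * X))).
{ apply Rmult_le_compat; try apply Cmod_ge_0; [|exact B1]. nra. }
assert (P2 : Cmod (cA (S m) t) * Cmod (npow (S (S m)) w) <= X * y ^ 4)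
  by (apply Rmult_le_compat; try apply Cmod_ge_0; assumption).
replace ((2 * X) * (2 * X) * (2 * y ^ 4 * (2 * X))) with (16 * ((X * y) * (X * y) * (X * y)) * y) in P1 by ring.
replace (X * y ^ 4) with ((X * y) * y ^ 3) in P2 by ring.
rewrite Exy in P1, P2.
assert (y ^ 3 <= y) by (simpl; nra). lra.
Qed.

(** Since n^(-s) n^(-(z - s)) = n^(-z) does not depend on s, averaging [sum_by_parts] over the line
    turns its left side into [Kz] times a partial sum of 1 / zeta(z). The boundary terms tend to 0,
    as Re z > 5 keeps Re(z - s) above 4. *)
Lemma Hfun_zeta (z : C) : 5 < Re z -> 1 / 2 + kappa < Re z -> (Hfun z * zeta z)%C = RtoC Kz.
Proof.
intros Hz Hk. destruct (Hfun_spec z Hk) as [_ HS].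
set (D := fun m => csum (fun n => RtoC (mobius (S n)) * npow (S n) z)%C m).
set (E := fun m t => (cL (S (S m)) t * slope (S m) (z - crit t) + cA (S m) t * npow (S (S m)) (z - crit t))%C).
assert (CE : forall m, ccont (E m)).
{ intros m. apply ccont_plus; apply ccont_mult;
  [apply ccont_cL|apply ccont_slope|apply ccont_cA|apply ccont_npow_sub]. }
assert (EqT : forall m, csum (fun k => Tterm k z) m = (D (S m) * RtoC Kz - Lam W (E m))%C).
{ intros m. unfold Tterm.
  rewrite <- (Lam_csum W W_cont (fun k t => cL (S (S k)) t * dslope k (z - crit t))%C)
    by (intros k; apply ccont_mult; [apply ccont_cL|apply ccont_dslope]).
  change (RtoC Kz) with (RtoC (RInt W 0 1)).
  rewrite <- (Lam_const W W_cont (D (S m))).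
  rewrite <- (Lam_minus W W_cont) by (apply ccont_const || apply CE).
  apply Lam_ext; intros t.
  assert (P := sum_by_parts m t (z - crit t)).
  replace (D (S m)) with (csum (fun n => RtoC (mobius (S n)) * npow (S n) (crit t) *
     npow (S n) (z - crit t)%C)%C (S m)).
  - rewrite P. unfold E. ring.
  - apply csum_ext; intros n _. rewrite npow_sub.
    replace (RtoC (mobius (S n)) * npow (S n) (crit t) * (npow (S n) z * npow (S n) (- crit t)))%C
      with (RtoC (mobius (S n)) * npow (S n) z * (npow (S n) (crit t) * npow (S n) (- crit t)))%C by ring.
    unfold npow at 2 3. rewrite <- Cexp_plus.
    replace (- crit t * RtoC (ln (INR (S n))) + - - crit t * RtoC (ln (INR (S n))))%C with (RtoC 0) by ring.
    rewrite Cexp_0; ring. }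
assert (LE : Clim (fun m => Lam W (E m)) 0).
(* The constant combines the 17 of [boundary_bound] with the factor 2 of the averaged estimate. *)
{ apply Clim_squeeze with (fun m => 2 * (17 * Kz) * / INR (S m)).
  - intros m. replace (Lam W (E m) - 0)%C with (Lam W (E m)) by ring.
    replace (2 * (17 * Kz) * / INR (S m)) with (2 * (17 * / INR (S m) * RInt W 0 1))
      by (unfold Kz; ring).
    apply (Lam_le_const W W_cont W_pos); [apply CE|].
    intros t _. apply boundary_bound. rewrite Re_minus; unfold crit; rewrite Re_pair; lra.
  - apply is_lim_seq_scal_0, is_lim_seq_inv_S. }
apply Clim_unique with (fun m => csum (fun k => Tterm k z) m * zeta z)%C.
- apply Clim_mult; [exact HS|apply Clim_const].
- apply Clim_ext with (fun m => RtoC Kz * (D (S m) * zeta z) - Lam W (E m) * zeta z)%C.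
  + intros m. rewrite EqT. ring.
  + match goal with |- Clim ?u _ => enough (Q : Clim u (RtoC Kz * 1 - 0 * zeta z)%C)
      by (replace (RtoC Kz * 1 - 0 * zeta z)%C with (RtoC Kz) in Q by ring; exact Q) end.
    apply Clim_minus.
    * apply Clim_scal.
      apply (Clim_incr (fun m => D m * zeta z)%C). apply zeta_mobius; [exact Hzeta|lra].
    * apply Clim_mult; [exact LE|apply Clim_const].
Qed.

Lemma zeta_nonzero (z : C) : 1 / 2 + kappa < Re z -> z <> 1 -> zeta z <> 0.
Proof.
intros Hz Hz1 E0.
assert (HK : 0 < Kz) by apply Kz_pos.
assert (An : forall w, 1 / 2 + kappa < Re w -> w <> 1 ->
  anl (fun w => Hfun w * zeta w - RtoC Kz)%C w).
{ intros w Hw Hw1. apply anl_minus; [|apply anl_const].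
  apply anl_mult; [apply Hfun_spec, Hw|apply anl_zeta; assumption]. }
assert (D0 : (Hfun z * zeta z - RtoC Kz)%C = 0).
(* A unit disc centred at abscissa x0 lies where Re w exceeds both 6 and 1 + kappa, so both
   conditions of [Hfun_zeta] hold on it. *)
{ set (x0 := Rmax 6 (1 + kappa) + 1).
  assert (X1 : 6 <= Rmax 6 (1 + kappa)) by apply Rmax_l.
  assert (X2 : 1 + kappa <= Rmax 6 (1 + kappa)) by apply Rmax_r.
  apply (identity_halfplane (fun w => Hfun w * zeta w - RtoC Kz)%C (1 / 2 + kappa) x0).
  - unfold x0; lra.
  - intros w Hw Hi. apply An; [exact Hw|]. intros ->. apply Hi; reflexivity.
  - intros y _. exists 1; split; [lra|]. intros w Hw.
    assert (Hr : x0 - 1 < Re w) by (apply (Re_near w (x0, y)), Hw).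
    unfold x0 in Hr. rewrite Hfun_zeta by lra. ring.
  - exact Hz.
  - apply An; assumption. }
rewrite E0 in D0. replace (Hfun z * 0 - RtoC Kz)%C with (RtoC (- Kz)) in D0
  by (rewrite RtoC_opp; ring).
apply RtoC_inj in D0; lra.
Qed.

End Continuation.

Theorem zero_free_half_plane (theta : R) : 0 < theta -> moment_bound zeta theta ->
  forall s, 1 / 2 + 1 / (2 * theta) < Re s -> s <> 1 -> zeta s <> 0.
Proof.
intros Hth Hm s Hs Hs1.
set (d := Re s - (1 / 2 + 1 / (2 * theta))).
assert (Hd : 0 < d) by (unfold d; lra).
(* The choice eps = theta d gives kappa = 1/(2 theta) + d/2, so s lies to the right of 1/2 + kappa
   by d/2. *)
destruct (moment_unit theta (theta * d) Hth (Rmult_lt_0_compat _ _ Hth Hd) Hm) as [B [HB HBb]].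
apply (zeta_nonzero ((1 + theta * d) / (2 * theta)) B HB).
- intros N HN. eapply Rle_trans; [apply HBb, HN|]. apply Req_le. f_equal. f_equal. f_equal.
  field; lra.
- replace ((1 + theta * d) / (2 * theta)) with (1 / (2 * theta) + d / 2) by (field; lra).
  unfold d in *; lra.
- exact Hs1.
Qed.

End PartOne.

(** * Fourier series of the third Bernoulli polynomial *)

(* One sixth of the third Bernoulli polynomial. *)
Definition bern (x : R) : R := x ^ 3 / 6 - x ^ 2 / 4 + x / 12.

Definition om (k : nat) : R := 2 * PI * INR (S k).

(** Partial Fourier sum of [bern] on [0, 1]. *)
Definition fourier3 (N : nat) (x : R) : R := rsum (fun k => 2 * sin (om k * x) / om k ^ 3) N.

Lemma om_pos (k : nat) : 0 < om k.
Proof.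
apply Rmult_lt_0_compat; [generalize PI_RGT_0; lra|apply lt_0_INR; lia].
Qed.

Lemma is_derive_rsum (f : nat -> R -> R) (l : nat -> R) (x : R) (n : nat) :
  (forall k, is_derive (f k) x (l k)) -> is_derive (fun t => rsum (fun k => f k t) n) x (rsum l n).
Proof.
intros H; induction n as [|n IH]; simpl.
- exact (is_derive_const (V := R_NormedModule) 0 x).
- exact (is_derive_plus (V := R_NormedModule) (fun t => rsum (fun k => f k t) n) (f n) x _ _ IH (H n)).
Qed.

Lemma rmvt (f f' g g' : R -> R) (a b : R) : a <= b ->
  (forall x, a <= x <= b -> is_derive f x (f' x)) ->
  (forall x, a <= x <= b -> is_derive g x (g' x)) ->
  (forall x, a <= x <= b -> Rabs (f' x) <= g' x) -> Rabs (f b - f a) <= g b - g a.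
Proof.
intros Hab Hf Hg H. rewrite <- Cmod_R, RtoC_minus.
apply (cmvt (fun x => RtoC (f x)) (fun x => RtoC (f' x)) g g' a b Hab); [|exact Hg|].
- intros x Hx; apply cder_real, Hf, Hx.
- intros x Hx; rewrite Cmod_R; apply H, Hx.
Qed.

(** Multiplied out by sin(pi x), so that the identity also holds at the zeros of the sine. *)
Lemma dirichlet_kernel (N : nat) (x : R) :
  sin (PI * x) * (1 + rsum (fun k => 2 * cos (om k * x)) N) = sin ((2 * INR N + 1) * PI * x).
Proof.
induction N as [|N IH].
- simpl. rewrite Rplus_0_r, Rmult_1_r. f_equal; ring.
- simpl rsum. rewrite <- Rplus_assoc, Rmult_plus_distr_l, IH, (S_INR N).
  unfold om. rewrite S_INR.
  replace ((2 * (INR N + 1) + 1) * PI * x) with (2 * PI * (INR N + 1) * x + PI * x) by ring.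
  replace ((2 * INR N + 1) * PI * x) with (2 * PI * (INR N + 1) * x - PI * x) by ring.
  rewrite sin_minus, sin_plus; ring.
Qed.

(** By duplication sin y = 2 sin(y/2) cos(y/2). On [0, pi/4] the cosine is at least c = cos(pi/4),
    so sin(y/2) >= c y/2, and c^2 = 1/2 yields the constant. *)
Lemma sin_ge_half (y : R) : 0 <= y <= PI / 2 -> y / 2 <= sin y.
Proof.
intros Hy. set (z := y / 2).
assert (Hz : 0 <= z <= PI / 4) by (unfold z; lra).
set (c := cos (PI / 4)).
assert (Hc : c * c = / 2).
{ unfold c. rewrite cos_PI4. unfold Rdiv. rewrite Rmult_1_l, <- Rinv_mult, sqrt_sqrt by lra.
  reflexivity. }
assert (Hc0 : 0 <= c) by (unfold c; left; rewrite cos_PI4; apply Rdiv_lt_0_compat; [lra|apply sqrt_lt_R0; lra]).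
assert (PI_p := PI_RGT_0).
assert (Hcos : forall x, 0 <= x <= z -> c <= cos x).
{ intros x Hx. unfold c. destruct (Req_dec x (PI / 4)) as [->|Hne]; [lra|].
  left; apply cos_decreasing_1; lra. }
assert (Hs : sin 0 - c * 0 <= sin z - c * z).
{ apply (nondecreasing_of_derive (fun x => sin x - c * x) (fun x => cos x - c)); [lra| |].
  - intros x _. auto_derive; [exact I|ring].
  - intros x Hx. generalize (Hcos x Hx); lra. }
rewrite sin_0, Rmult_0_r in Hs.
assert (Hcz := Hcos z ltac:(lra)).
replace y with (2 * z) by (unfold z; field). rewrite sin_2a.
assert (c * z * c <= sin z * cos z) by (apply Rmult_le_compat; nra).
nra.
Qed.

Section Remainder.
Variable N : nat.

Let M := (2 * INR N + 1) * PI.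
(** [R0] is the error of the Fourier sum; its successive derivatives are [R1], [r] and the Dirichlet
    kernel. The kernel is integrated back from 1/2, where [r] and [R0] vanish by symmetry; the
    unknown value of [R1] at 1/2 is fixed by the other zero of [R0], at 0. *)
Let r (x : R) : R := x - 1 / 2 + rsum (fun k => 2 * sin (om k * x) / om k) N.
Let R1 (x : R) : R := x ^ 2 / 2 - x / 2 + / 12 - rsum (fun k => 2 * cos (om k * x) / om k ^ 2) N.
Let R0 (x : R) : R := bern x - fourier3 N x.

Let M_pos : 0 < M.
Proof. apply Rmult_lt_0_compat; [generalize (pos_INR N); lra|apply PI_RGT_0]. Qed.

Let r_derive (x : R) : is_derive r x (1 + rsum (fun k => 2 * cos (om k * x)) N).
Proof.
apply (is_derive_plus (V := R_NormedModule) (fun x => x - 1 / 2)).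
- auto_derive; [exact I|ring].
- apply (is_derive_rsum (fun k x => 2 * sin (om k * x) / om k)). intros k.
  assert (P := om_pos k). auto_derive; [exact I|field; lra].
Qed.

Let R1_derive (x : R) : is_derive R1 x (r x).
Proof.
unfold r.
replace (x - 1 / 2 + rsum (fun k => 2 * sin (om k * x) / om k) N)
  with ((x - 1 / 2) - rsum (fun k => - (2 * sin (om k * x) / om k)) N).
- apply (is_derive_minus (V := R_NormedModule) (fun x => x ^ 2 / 2 - x / 2 + / 12)).
  + auto_derive; [exact I|field].
  + apply (is_derive_rsum (fun k x => 2 * cos (om k * x) / om k ^ 2)). intros k.
    assert (P := om_pos k). auto_derive; [exact I|field; lra].
- rewrite (rsum_ext (fun k => - (2 * sin (om k * x) / om k))
    (fun k => (-1) * (2 * sin (om k * x) / om k))) by (intros; ring).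
  rewrite rsum_scal; ring.
Qed.

Let R0_derive (x : R) : is_derive R0 x (R1 x).
Proof.
unfold R0, R1, bern, fourier3.
apply (is_derive_minus (V := R_NormedModule) (fun x => x ^ 3 / 6 - x ^ 2 / 4 + x / 12)).
- auto_derive; [exact I|field].
- apply (is_derive_rsum (fun k x => 2 * sin (om k * x) / om k ^ 3)). intros k.
  assert (P := om_pos k). auto_derive; [exact I|field; lra].
Qed.

Let sin_om_half (k : nat) : sin (om k * (1 / 2)) = 0.
Proof.
unfold om. replace (2 * PI * INR (S k) * (1 / 2)) with (INR (S k) * PI) by field.
apply sin_eq_0_1. exists (Z.of_nat (S k)). rewrite <- INR_IZR_INZ; reflexivity.
Qed.

Let r_half : r (1 / 2) = 0.
Proof.
unfold r. rewrite (rsum_ext _ (fun _ => 0)), rsum_const; [ring|].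
intros k _. rewrite sin_om_half. unfold Rdiv; ring.
Qed.

Let R0_half : R0 (1 / 2) = 0.
Proof.
unfold R0, fourier3, bern. rewrite (rsum_ext _ (fun _ => 0)), rsum_const; [field|].
intros k _. rewrite sin_om_half. unfold Rdiv; ring.
Qed.

Let R0_0 : R0 0 = 0.
Proof.
unfold R0, fourier3, bern. rewrite (rsum_ext _ (fun _ => 0)), rsum_const; [field|].
intros k _. rewrite Rmult_0_r, sin_0. unfold Rdiv; ring.
Qed.

(** From 2 / (M sin(pi x)) with sin(pi x) >= pi x / 2 and M = (2 N + 1) pi. *)
Let e := 4 / ((2 * INR N + 1) * (PI * PI)).

(* The Dirichlet kernel is integrated by parts once. *)
Let r_bound (x : R) : 0 < x <= 1 / 2 -> Rabs (r x) <= e / x.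
Proof.
intros Hx. assert (PI_p := PI_RGT_0).
assert (Hsin : forall t, x <= t <= 1 / 2 -> 0 < sin (PI * t))
  by (intros t Ht; apply sin_gt_0; nra).
assert (Hcos : forall t, x <= t <= 1 / 2 -> 0 <= cos (PI * t))
  by (intros t Ht; apply cos_ge_0; nra).
(* Adding cos(M t) / (M sin(pi t)) to [r] cancels the kernel sin(M t) / sin(pi t); what remains is
   O(1/M) and dominated by the derivative of -1 / (M sin(pi t)). *)
assert (H : Rabs ((r (1 / 2) + cos (M * (1 / 2)) / (M * sin (PI * (1 / 2))))
   - (r x + cos (M * x) / (M * sin (PI * x))))
   <= - / (M * sin (PI * (1 / 2))) - - / (M * sin (PI * x))).
{ apply (rmvt (fun t => r t + cos (M * t) / (M * sin (PI * t)))
    (fun t => - (PI * cos (M * t) * cos (PI * t)) / (M * sin (PI * t) ^ 2))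
    (fun t => - / (M * sin (PI * t)))
    (fun t => PI * cos (PI * t) / (M * sin (PI * t) ^ 2))); [lra| | |].
  - intros t Ht. assert (Hs := Hsin t Ht).
    replace (- (PI * cos (M * t) * cos (PI * t)) / (M * sin (PI * t) ^ 2))
      with ((1 + rsum (fun k => 2 * cos (om k * t)) N) +
        (- (M * sin (M * t)) * (M * sin (PI * t)) - cos (M * t) * (M * (PI * cos (PI * t))))
          / (M * sin (PI * t)) ^ 2).
    + apply (is_derive_plus (V := R_NormedModule) r (fun t => cos (M * t) / (M * sin (PI * t))));
        [apply r_derive|].
      auto_derive; [nra|]. field. split; lra.
    + replace (1 + rsum (fun k => 2 * cos (om k * t)) N) with (sin (M * t) / sin (PI * t)).
      * field. split; lra.
      * unfold M. rewrite <- dirichlet_kernel. field; lra.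
  - intros t Ht. assert (Hs := Hsin t Ht). auto_derive; [nra|]. field. split; lra.
  - intros t Ht. assert (Hs := Hsin t Ht). assert (Hc := Hcos t Ht).
    assert (Hd : 0 < M * sin (PI * t) ^ 2) by (apply Rmult_lt_0_compat; [exact M_pos|apply pow_lt, Hs]).
    unfold Rdiv. rewrite Rabs_mult, Rabs_Ropp, !Rabs_mult.
    rewrite (Rabs_pos_eq (/ _)) by (left; apply Rinv_0_lt_compat, Hd).
    apply Rmult_le_compat_r; [left; apply Rinv_0_lt_compat, Hd|].
    rewrite (Rabs_pos_eq PI), (Rabs_pos_eq (cos (PI * t))) by lra.
    assert (Rabs (cos (M * t)) <= 1) by (apply Rabs_le, COS_bound).
    assert (0 <= PI * cos (PI * t)) by (apply Rmult_le_pos; lra). nra. }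
assert (C0 : cos (M * (1 / 2)) = 0).
{ replace (M * (1 / 2)) with (INR N * PI + PI / 2) by (unfold M; field).
  rewrite cos_plus, cos_PI2, sin_PI2.
  assert (E : sin (INR N * PI) = 0).
  { apply sin_eq_0_1. exists (Z.of_nat N). rewrite <- INR_IZR_INZ; reflexivity. }
  rewrite E; ring. }
assert (S1 : sin (PI * (1 / 2)) = 1) by (replace (PI * (1 / 2)) with (PI / 2) by field; apply sin_PI2).
rewrite r_half, C0, S1, Rmult_1_r in H.
assert (Hs := Hsin x ltac:(lra)).
assert (Hs2 : PI * x / 2 <= sin (PI * x)) by (apply sin_ge_half; nra).
set (q := / (M * sin (PI * x))) in *.
assert (Hq : 0 < q) by (apply Rinv_0_lt_compat, Rmult_lt_0_compat; lra).
assert (Hcb : Rabs (cos (M * x) / (M * sin (PI * x))) <= q).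
{ unfold Rdiv. fold q. rewrite Rabs_mult, (Rabs_pos_eq q) by lra.
  assert (Rabs (cos (M * x)) <= 1) by (apply Rabs_le, COS_bound). nra. }
assert (HM : 0 < / M) by (apply Rinv_0_lt_compat, M_pos).
assert (Hr : Rabs (r x) <= 2 * q).
{ unfold Rdiv in H, Hcb. rewrite Rmult_0_l, Rplus_0_l in H. fold q in H, Hcb.
  set (A0 := cos (M * x) * q) in *.
  replace (r x) with (- (0 - (r x + A0)) + - A0) by ring.
  eapply Rle_trans; [apply Rabs_triang|]. rewrite !Rabs_Ropp. lra. }
eapply Rle_trans; [exact Hr|].
replace (e / x) with (2 * / (M * (PI * x / 2))).
- apply Rmult_le_compat_l; [lra|]. apply Rinv_le_contravar.
  + apply Rmult_lt_0_compat; [exact M_pos|nra].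
  + apply Rmult_le_compat_l; lra.
- unfold e, M. field. generalize (pos_INR N); repeat split; lra.
Qed.

Let e_pos : 0 < e.
Proof.
assert (PI_p := PI_RGT_0). generalize (pos_INR N). intros.
apply Rdiv_lt_0_compat; [lra|]. apply Rmult_lt_0_compat; [lra|nra].
Qed.

(** Integrating the bound e / u gives a logarithm for [R1], whose singularity at 0 is integrable: t
    - t log(2 t) is its antiderivative. The term linear in x - 1/2 accounts for the still unknown
    value of [R1] at 1/2. *)
Let R0_linear (x : R) : 0 < x <= 1 / 2 -> Rabs (R0 x - R1 (1 / 2) * (x - 1 / 2)) <= e / 2.
Proof.
intros Hx.
set (P := fun t => R0 t - R1 (1 / 2) * (t - 1 / 2)).
set (G := fun t => e * (t - t * ln (2 * t))).
assert (H : Rabs (P (1 / 2) - P x) <= G (1 / 2) - G x).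
{ apply (rmvt P (fun t => R1 t - R1 (1 / 2)) G (fun t => - e * ln (2 * t))); [lra| | |].
  - intros t Ht. unfold P.
    apply (is_derive_minus (V := R_NormedModule) R0 (fun t => R1 (1 / 2) * (t - 1 / 2)));
      [apply R0_derive|]. auto_derive; [exact I|ring].
  - intros t Ht. unfold G. auto_derive; [lra|field; lra].
  - intros t Ht. rewrite <- Rabs_Ropp, Ropp_minus_distr.
    replace (- e * ln (2 * t)) with (e * ln (1 / 2) - e * ln t).
    + apply (rmvt R1 r (fun u => e * ln u) (fun u => e / u)); [lra| | |].
      * intros u _; apply R1_derive.
      * intros u Hu. auto_derive; [lra|field; lra].
      * intros u Hu. apply r_bound; lra.
    + rewrite ln_mult by lra. replace (1 / 2) with (/ 2) by field. rewrite ln_Rinv by lra. ring. }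
assert (P2 : P (1 / 2) = 0) by (unfold P; rewrite R0_half; ring).
assert (G2 : G (1 / 2) = e / 2).
{ unfold G. replace (2 * (1 / 2)) with 1 by field. rewrite ln_1. field. }
assert (Gx : 0 <= G x).
{ unfold G. assert (ln (2 * x) <= 0) by (rewrite <- ln_1; apply ln_le; lra).
  apply Rmult_le_pos; [left; apply e_pos|nra]. }
rewrite P2, G2 in H. change (Rabs (P x) <= e / 2).
rewrite <- Rabs_Ropp. replace (- P x) with (0 - P x) by ring. lra.
Qed.

(** The previous bound extends to x = 0 by continuity; there [R0] vanishes, leaving half of the
    value of [R1] at 1/2. *)
Let R1_half : Rabs (R1 (1 / 2)) <= e.
Proof.
set (F := fun x => R0 x - R1 (1 / 2) * (x - 1 / 2)).
assert (F0 : Rabs (F 0) <= e / 2).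
{ apply Rnot_lt_le; intros Hlt.
  assert (Hc : continuity_pt F 0).
  { apply continuity_pt_filterlim, (ex_derive_continuous (V := R_NormedModule)).
    exists (R1 0 - R1 (1 / 2)).
    apply (is_derive_minus (V := R_NormedModule) R0 (fun t => R1 (1 / 2) * (t - 1 / 2)));
      [apply R0_derive|]. auto_derive; [exact I|ring]. }
  destruct (Hc (Rabs (F 0) - e / 2) ltac:(lra)) as [d [Hd H]].
  simpl in H; unfold R_dist in H.
  set (x := Rmin (d / 2) (1 / 2)).
  assert (Hx : 0 < x) by (apply Rmin_glb_lt; lra).
  assert (Hx1 : x <= d / 2) by apply Rmin_l.
  assert (Hx2 : x <= 1 / 2) by apply Rmin_r.
  assert (H1 : Rabs (F x - F 0) < Rabs (F 0) - e / 2).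
  { apply H. split; [split; [exact I|lra]|]. rewrite Rminus_0_r, Rabs_pos_eq; lra. }
  assert (H2 : Rabs (F x) <= e / 2) by (apply R0_linear; lra).
  generalize (Rabs_triang_inv (F 0) (F x)). rewrite (Rabs_minus_sym (F 0)). lra. }
unfold F in F0. rewrite R0_0 in F0.
replace (0 - R1 (1 / 2) * (0 - 1 / 2)) with (R1 (1 / 2) * (1 / 2)) in F0 by ring.
rewrite Rabs_mult, (Rabs_pos_eq (1 / 2)) in F0 by lra. lra.
Qed.

Let R0_bound_half (x : R) : 0 <= x <= 1 / 2 -> Rabs (R0 x) <= e.
Proof.
intros Hx. assert (e_p := e_pos).
destruct (Req_dec x 0) as [->|Hx0]; [rewrite R0_0, Rabs_R0; lra|].
assert (H1 := R0_linear x ltac:(lra)).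
assert (H2 : Rabs (R1 (1 / 2) * (x - 1 / 2)) <= e / 2).
{ rewrite Rabs_mult, (Rabs_left1 (x - 1 / 2)) by lra.
  generalize R1_half (Rabs_pos (R1 (1 / 2))). nra. }
replace (R0 x) with ((R0 x - R1 (1 / 2) * (x - 1 / 2)) + R1 (1 / 2) * (x - 1 / 2)) by ring.
eapply Rle_trans; [apply Rabs_triang|lra].
Qed.

Lemma fourier3_error (x : R) : 0 <= x <= 1 -> Rabs (bern x - fourier3 N x) <= 4 * / INR (S N).
Proof.
intros Hx.
assert (He : e <= 4 * / INR (S N)).
{ unfold e, Rdiv. apply Rmult_le_compat_l; [lra|]. rewrite S_INR.
  assert (HN := pos_INR N). apply Rinv_le_contravar; [lra|].
  assert (1 <= PI * PI) by (generalize PI2_1; nra). nra. }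
destruct (Rle_dec x (1 / 2)) as [Hc|Hc].
- eapply Rle_trans; [apply R0_bound_half|]; lra.
(* Both [bern] and its Fourier sum are odd under the reflection of x to 1 - x. *)
- assert (H := R0_bound_half (1 - x) ltac:(lra)).
  replace (bern x - fourier3 N x) with (- R0 (1 - x)); [rewrite Rabs_Ropp; lra|].
  unfold R0, fourier3.
  rewrite (rsum_ext (fun k => 2 * sin (om k * (1 - x)) / om k ^ 3)
    (fun k => (-1) * (2 * sin (om k * x) / om k ^ 3))).
  + rewrite rsum_scal. unfold bern. field.
  + intros k _. unfold om.
    replace (2 * PI * INR (S k) * (1 - x)) with (- (2 * PI * INR (S k) * x) + 2 * INR (S k) * PI) by ring.
    rewrite sin_period, sin_neg. unfold Rdiv; ring.
Qed.

End Remainder.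

(** * The Mellin transform of the sine *)

(* [rp x u] is [x^(-u)], for [x > 0]. *)
Definition rp (x : R) (u : C) : C := Cexp (- u * RtoC (ln x))%C.

Lemma npow_rp (n : nat) (z : C) : npow n z = rp (INR n) z.
Proof. reflexivity. Qed.

Lemma Cmod_rp (x : R) (u : C) : Cmod (rp x u) = exp (- Re u * ln x).
Proof. unfold rp. rewrite Cmod_Cexp; f_equal; autorewrite with cre; ring. Qed.

Lemma rp_plus (x : R) (u v : C) : rp x (u + v) = (rp x u * rp x v)%C.
Proof. unfold rp. rewrite <- Cexp_plus; f_equal; ring. Qed.

Lemma rp_mult (x y : R) (u : C) : 0 < x -> 0 < y -> rp (x * y) u = (rp x u * rp y u)%C.
Proof.
intros Hx Hy. unfold rp. rewrite <- Cexp_plus, ln_mult, RtoC_plus by assumption. f_equal; ring.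
Qed.

Lemma rp_1_l (u : C) : rp 1 u = 1.
Proof. unfold rp. rewrite ln_1, Cmult_0_r; apply Cexp_0. Qed.

Lemma rp_0 (x : R) : rp x 0 = 1.
Proof. unfold rp. rewrite <- Cexp_0; f_equal; ring. Qed.

Lemma rp_1_r (x : R) : 0 < x -> rp x 1 = RtoC (/ x).
Proof.
intros Hx. unfold rp. replace (- (1) * RtoC (ln x))%C with (RtoC (- ln x)) by (rewrite RtoC_opp; ring).
rewrite Cexp_RtoC, exp_Ropp, exp_ln by exact Hx; reflexivity.
Qed.

Lemma rp_succ (x : R) (u : C) : 0 < x -> (RtoC x * rp x (u + 1))%C = rp x u.
Proof.
intros Hx. rewrite rp_plus, rp_1_r by exact Hx.
rewrite RtoC_inv by lra. field. apply RtoC_nz; lra.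
Qed.

Lemma cder_rp (x : R) (u : C) : 0 < x -> cder (fun t => rp t u) x (- u * rp x (u + 1))%C.
Proof.
intros Hx. apply cder_eq with (- u * RtoC (/ x) * rp x u)%C.
- unfold rp. apply cder_exp. apply cder_scal, cder_real. apply is_derive_ln, Hx.
- rewrite rp_plus, rp_1_r by exact Hx. ring.
Qed.

Lemma exp_series_R (x : R) : ex_series (fun n => x ^ n / INR (fact n)).
Proof.
exists (exp x). apply is_series_Reals. unfold exp. destruct (exist_exp x) as [l Hl]. simpl.
intros eps Heps. destruct (Hl eps Heps) as [N HN]. exists N; intros n Hn.
specialize (HN n Hn). erewrite sum_eq; [exact HN|].
intros i _. cbv beta. unfold Rdiv; ring.
Qed.

Section RealPowerSeries.
Variable a : nat -> C.
Variable D : R.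
Hypothesis Ha : forall n, Cmod (a n) <= D / INR (fact n).

Lemma entire_abs (x : R) : 0 <= x -> ex_series (fun n => Cmod (a n) * x ^ n).
Proof.
intros Hx. apply Rex_series_le with (fun n => D * (x ^ n / INR (fact n))).
- intros n. assert (P := INR_fact_lt_0 n). split.
  + apply Rmult_le_pos; [apply Cmod_ge_0|apply pow_le, Hx].
  + replace (D * (x ^ n / INR (fact n))) with (D / INR (fact n) * x ^ n) by (field; lra).
    apply Rmult_le_compat_r; [apply pow_le, Hx|apply Ha].
- apply Rex_series_scal, exp_series_R.
Qed.

Let radius (f : C -> R) : (forall z, Rabs (f z) <= Cmod z) ->
  CV_radius (fun n => f (a n)) = p_infty.
Proof.
intros Hf. destruct (CV_radius_bounded (fun n => f (a n))) as [Hub _].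
destruct (CV_radius (fun n => f (a n))) as [r| |] eqn:E; [exfalso|reflexivity|exfalso].
- set (x := Rabs r + 1).
  assert (Hx : 0 <= x) by (unfold x; generalize (Rabs_pos r); lra).
  assert (H : Rbar_le x r).
  { apply Hub. exists (Series (fun n => Cmod (a n) * x ^ n)). intros n.
    rewrite Rabs_mult, (Rabs_pos_eq (x ^ n)) by (apply pow_le, Hx).
    assert (P : forall k, 0 <= Cmod (a k) * x ^ k)
      by (intros k; apply Rmult_le_pos; [apply Cmod_ge_0|apply pow_le, Hx]).
    apply Rle_trans with (Cmod (a n) * x ^ n);
      [apply Rmult_le_compat_r; [apply pow_le, Hx|apply Hf]|].
    assert (L := rsum_le_Series _ (S n) P (entire_abs x Hx)). simpl in L.
    assert (L0 : 0 <= rsum (fun k => Cmod (a k) * x ^ k) n).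
    { clear L. induction n as [|m IH]; simpl; [lra|generalize (P m); lra]. }
    lra. }
  simpl in H. unfold x in H. generalize (Rle_abs r); lra.
- assert (H : Rbar_le 0 m_infty).
  { apply Hub. exists (Rabs (f (a 0%nat))). intros [|n].
    - simpl; rewrite Rmult_1_r; lra.
    - rewrite pow_i, Rmult_0_r, Rabs_R0 by lia. apply Rabs_pos. }
  exact H.
Qed.

Definition rpser (b : nat -> C) (x : R) : C :=
  (PSeries (fun n => Re (b n)) x, PSeries (fun n => Im (b n)) x).

Let pair_sums (p q : nat -> R) (x : R) : CV_radius p = p_infty -> CV_radius q = p_infty ->
  Csums (fun n => (p n, q n) * RtoC x ^ n)%C (PSeries p x, PSeries q x).
Proof.
intros Hp Hq.
assert (G : forall p, CV_radius p = p_infty -> is_series (fun n => p n * x ^ n) (PSeries p x)).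
{ intros r Hr. apply Series_correct, ex_series_Rabs, CV_disk_inside. rewrite Hr; exact I. }
apply Csums_comp; rewrite Re_pair, Im_pair; split;
  [apply is_series_ext with (2 := G p Hp)|apply is_series_ext with (2 := G q Hq)];
  intros n; rewrite <- RtoC_pow; autorewrite with cre; toR; ring.
Qed.

Lemma rpser_sums (x : R) : Csums (fun n => a n * RtoC x ^ n)%C (rpser a x).
Proof.
apply Csums_ext with (2 := pair_sums _ _ x (radius Re re_le_Cmod) (radius Im im_le_Cmod)).
intros n; f_equal; apply Ceq; reflexivity.
Qed.

(** The series is stated for x times the derivative, so that its terms keep the index and the power
    of the original ones. *)
Lemma rpser_derive (x : R) : exists l, cder (rpser a) x l /\
  Csums (fun n => RtoC (INR n) * a n * RtoC x ^ n)%C (RtoC x * l)%C.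
Proof.
assert (R1 := radius Re re_le_Cmod). assert (R2 := radius Im im_le_Cmod).
set (p := PS_derive (fun n => Re (a n))). set (q := PS_derive (fun n => Im (a n))).
exists (PSeries p x, PSeries q x). split.
- split; unfold rpser.
  + apply (is_derive_PSeries (fun n => Re (a n))). rewrite R1; exact I.
  + apply (is_derive_PSeries (fun n => Im (a n))). rewrite R2; exact I.
- replace (RtoC x * _)%C with (RtoC (INR 0) * a 0%nat * RtoC x ^ 0
    + RtoC x * (PSeries p x, PSeries q x))%C by (simpl; ring).
  apply (Csums_tail (fun n => RtoC (INR n) * a n * RtoC x ^ n)%C).
  apply Csums_ext with (fun n => RtoC x * ((p n, q n) * RtoC x ^ n))%C.
  + intros n. replace (p n, q n) with (RtoC (INR (S n)) * a (S n))%C.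
    * rewrite Cpow_S; ring.
    * apply Ceq; unfold p, q, PS_derive; autorewrite with cre; ring.
  + apply Csums_scal, pair_sums; unfold p, q; rewrite CV_radius_derive; assumption.
Qed.

End RealPowerSeries.

(* The derivatives of the sine at [0]. *)
Definition sgn (n : nat) : R := Im (Ci ^ n)%C.

Lemma sgn_even (n : nat) : Nat.even n = true -> sgn n = 0.
Proof.
intros H. apply Nat.even_spec in H. destruct H as [k ->]. unfold sgn.
rewrite Cpow_mult_r. replace (Ci ^ 2)%C with (RtoC (-1))
  by (unfold Ci; apply Ceq; simpl; ring).
rewrite <- RtoC_pow. reflexivity.
Qed.

Lemma sgn_le (n : nat) : Rabs (sgn n) <= 1.
Proof.
unfold sgn. eapply Rle_trans; [apply im_le_Cmod|].
rewrite Cmod_pow, Cmod_Ci, pow1; lra.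
Qed.

Lemma sin_series (x : R) : Csums (fun n => RtoC (sgn n / INR (fact n)) * RtoC x ^ n)%C (RtoC (sin x)).
Proof.
assert (H := Cexp_series (Ci * RtoC x)%C). apply Csums_comp in H. destruct H as [_ H].
apply Csums_comp. rewrite Re_RtoC, Im_RtoC.
assert (P : forall n, (RtoC (sgn n / INR (fact n)) * RtoC x ^ n)%C
  = RtoC (Im (exp_term (Ci * RtoC x)%C n))).
{ intros n. unfold exp_term, sgn. rewrite Cpow_mult_l, <- !RtoC_pow, <- RtoC_mult. f_equal.
  unfold Cdiv. rewrite <- RtoC_inv by apply INR_fact_neq_0.
  autorewrite with cre. unfold Rdiv; ring. }
split.
- apply is_series_ext with (fun n => Im (exp_term (Ci * RtoC x)%C n)); [intros n; rewrite P; reflexivity|].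
  replace (sin x) with (Im (Cexp (Ci * RtoC x))); [exact H|].
  unfold Cexp, Ci. autorewrite with cre.
  replace (0 * x - 1 * 0) with 0 by ring. replace (0 * 0 + 1 * x) with x by ring.
  rewrite exp_0; ring.
- apply is_series_ext with (fun _ => 0); [intros n; rewrite P; reflexivity|].
  apply is_series_rsum. apply is_lim_seq_ext with (fun _ => 0); [|apply is_lim_seq_const].
  intros n; rewrite rsum_const; ring.
Qed.

(** A quantitative distance from the odd positive integers, the poles of the transform: the even
    Taylor coefficients of the sine vanish. *)
Definition away (u : C) (d : R) : Prop :=
  0 < d /\ forall n, Nat.odd n = true -> d <= Cmod (RtoC (INR n) - u)%C.

(** Odd integers beyond |u| + 1 are at distance at least 1, and over the finitely many others a
    minimum is taken. *)
Lemma away_exists (u : C) : (forall n, Nat.odd n = true -> u <> RtoC (INR n)) ->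
  exists d, away u d.
Proof.
intros Hu.
assert (G : forall K, exists d, 0 < d /\ forall n, (n < K)%nat -> Nat.odd n = true ->
  d <= Cmod (RtoC (INR n) - u)%C).
{ induction K as [|K [d [Hd H]]].
  - exists 1; split; [lra|]. intros; lia.
  - destruct (Nat.odd K) eqn:EK.
    + assert (P : 0 < Cmod (RtoC (INR K) - u)%C).
      { apply Cmod_gt_0. intros Z. apply (Hu K EK).
        replace u with (RtoC (INR K) - (RtoC (INR K) - u))%C by ring. rewrite Z; ring. }
      exists (Rmin d (Cmod (RtoC (INR K) - u)%C)); split; [apply Rmin_glb_lt; assumption|].
      intros n Hn Hodd. destruct (Nat.eq_dec n K) as [->|Hne]; [apply Rmin_r|].
      eapply Rle_trans; [apply Rmin_l|apply H; [lia|exact Hodd]].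
    + exists d; split; [exact Hd|]. intros n Hn Hodd.
      destruct (Nat.eq_dec n K) as [->|Hne]; [congruence|]. apply H; [lia|exact Hodd]. }
destruct (nfloor_ex (Cmod u + 1)) as [K HK]; [generalize (Cmod_ge_0 u); lra|].
destruct (G (S K)) as [d [Hd H]].
exists (Rmin d 1); split; [apply Rmin_glb_lt; lra|].
intros n Hodd. destruct (le_lt_dec (S K) n) as [Hn|Hn].
- eapply Rle_trans; [apply Rmin_r|].
  eapply Rle_trans; [|apply Cmod_triangle_inv].
  rewrite Cmod_R, Rabs_pos_eq by apply pos_INR.
  apply le_INR in Hn. rewrite S_INR in Hn. lra.
- eapply Rle_trans; [apply Rmin_l|apply H; assumption].
Qed.

Lemma away_near (u v : C) (d : R) : away u d -> Cmod (v - u)%C < d / 2 -> away v (d / 2).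
Proof.
intros [Hd H] Hv. split; [lra|]. intros n Hn. specialize (H n Hn).
generalize (Cmod_minus_le (RtoC (INR n)) v u). lra.
Qed.

(** Integrating the n-th term of sin y times y^(-u-1) gives Y^(n-u) / (n - u) times its Taylor
    coefficient. *)
Definition sf (u : C) (n : nat) : C := (RtoC (sgn n / INR (fact n)) * / (RtoC (INR n) - u))%C.

Lemma sf_even (u : C) (n : nat) : Nat.even n = true -> sf u n = 0.
Proof. intros H. unfold sf. rewrite sgn_even by exact H. unfold Rdiv; rewrite Rmult_0_l; ring. Qed.

Lemma sf_bound (u : C) (d : R) (n : nat) : away u d -> Cmod (sf u n) <= / d / INR (fact n).
Proof.
intros [Hd H]. assert (P := INR_fact_lt_0 n).
assert (P' : 0 < / INR (fact n)) by (apply Rinv_0_lt_compat, P).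
assert (Hd' : 0 < / d) by (apply Rinv_0_lt_compat, Hd).
destruct (Nat.even n) eqn:En.
- rewrite sf_even, Cmod_0 by exact En. unfold Rdiv. nra.
- assert (Ho : Nat.odd n = true) by (unfold Nat.odd; rewrite En; reflexivity).
  specialize (H n Ho).
  unfold sf. rewrite Cmod_mult, Cmod_R, Cmod_inv by (apply Cmod_gt_0; lra).
  unfold Rdiv. rewrite Rabs_mult, (Rabs_pos_eq (/ INR (fact n))) by lra.
  rewrite (Rmult_comm (/ d)). apply Rmult_le_compat.
  + apply Rmult_le_pos; [apply Rabs_pos|lra].
  + left; apply Rinv_0_lt_compat; lra.
  + generalize (sgn_le n); nra.
  + apply Rinv_le_contravar; assumption.
Qed.

(* For [Re u < 1], [Efun Y u] is the integral of [sin y * y^(-u-1)] over [(0, Y)]; expanding the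
   sine continues it to all [u] other than the odd positive integers. *)
Definition Efun (Y : R) (u : C) : C := (rp Y u * rpser (sf u) Y)%C.

Lemma Efun_derive (Y : R) (u : C) (d : R) : 0 < Y -> away u d ->
  cder (fun y => Efun y u) Y (RtoC (sin Y) * rp Y (u + 1))%C.
Proof.
intros HY Hu.
assert (Hb : forall n, Cmod (sf u n) <= / d / INR (fact n)) by (intros; apply sf_bound, Hu).
destruct (rpser_derive (sf u) (/ d) Hb Y) as [l [Hl Sl]].
eapply cder_eq; [apply cder_mult; [apply cder_rp, HY|exact Hl]|].
(* Coefficientwise, (n - u) times [sf u n] is the n-th Taylor coefficient of the sine; for even n
   both vanish, even if n = u. *)
assert (E : RtoC (sin Y) = (RtoC Y * l - u * rpser (sf u) Y)%C).
{ apply Csums_unique with (1 := sin_series Y).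
  replace (RtoC Y * l - u * rpser (sf u) Y)%C with (RtoC Y * l + (- u) * rpser (sf u) Y)%C by ring.
  apply Csums_ext with (fun n => RtoC (INR n) * sf u n * RtoC Y ^ n + (- u) * (sf u n * RtoC Y ^ n))%C.
  - intros n. destruct (Nat.even n) eqn:En.
    + rewrite sf_even, sgn_even by exact En. unfold Rdiv; rewrite Rmult_0_l. ring.
    + assert (Ho : Nat.odd n = true) by (unfold Nat.odd; rewrite En; reflexivity).
      destruct Hu as [Hd Hu]. specialize (Hu n Ho).
      unfold sf. field. apply Cmod_gt_0; lra.
  - apply Csums_plus; [exact Sl|apply Csums_scal, (rpser_sums _ _ Hb)]. }
rewrite E. rewrite <- (rp_succ Y u HY). ring.
Qed.

(** The series starts at n = 1, which gains one power of Y over Y^(-u). *)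
Lemma Efun_small (u : C) (d : R) : away u d -> exists B, 0 <= B /\
  forall Y, 0 < Y <= 1 -> Cmod (Efun Y u) <= B * exp ((1 - Re u) * ln Y).
Proof.
intros Hu.
assert (Hb : forall n, Cmod (sf u n) <= / d / INR (fact n)) by (intros; apply sf_bound, Hu).
destruct (pser_lipschitz (sf u) 1) as [B [HB0 HB]]; [lra|apply (entire_abs _ _ Hb); lra|].
exists B; split; [exact HB0|]. intros Y HY.
assert (P := HB (RtoC Y) _ ltac:(rewrite Cmod_R, Rabs_pos_eq; lra) (rpser_sums _ _ Hb Y)).
rewrite (sf_even u 0), Cmod_R, Rabs_pos_eq in P by (reflexivity || lra).
replace (rpser (sf u) Y - 0)%C with (rpser (sf u) Y) in P by ring.
unfold Efun. rewrite Cmod_mult, Cmod_rp.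
replace (exp ((1 - Re u) * ln Y)) with (exp (- Re u * ln Y) * Y)
  by (rewrite <- (exp_ln Y) at 2 by lra; rewrite <- exp_plus; f_equal; ring).
assert (X := exp_pos (- Re u * ln Y)). nra.
Qed.

Lemma exp_ln_derive (c x : R) : 0 < x ->
  is_derive (fun t => exp (c * ln t)) x (c * exp ((c - 1) * ln x)).
Proof.
intros Hx. replace (c * exp ((c - 1) * ln x)) with (exp (c * ln x) * (c * / x)).
- auto_derive; [exact Hx|ring].
- replace ((c - 1) * ln x) with (c * ln x + - ln x) by ring.
  rewrite exp_plus, exp_Ropp, exp_ln by exact Hx. ring.
Qed.

(** Used with |sin y| <= 1 towards infinity and with |sin y| <= y towards 0. *)
Lemma Efun_mvt (u : C) (d a b : R) (g g' : R -> R) : away u d -> 0 < a <= b ->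
  (forall x, a <= x <= b -> is_derive g x (g' x)) ->
  (forall x, a <= x <= b -> Rabs (sin x) * exp ((- Re u - 1) * ln x) <= g' x) ->
  Cmod (Efun b u - Efun a u)%C <= g b - g a.
Proof.
intros Hu Hab Hg H.
apply (cmvt (fun y => Efun y u) (fun y => RtoC (sin y) * rp y (u + 1))%C g g'); [lra| |exact Hg|].
- intros x Hx. apply Efun_derive with d; [lra|exact Hu].
- intros x Hx. rewrite Cmod_mult, Cmod_R, Cmod_rp. autorewrite with cre.
  replace (- (Re u + 1)) with (- Re u - 1) by ring. apply H, Hx.
Qed.

Lemma Efun_diff_large (u : C) (d a b : R) : away u d -> 0 < Re u -> 0 < a <= b ->
  Cmod (Efun b u - Efun a u)%C <= (exp (- Re u * ln a) - exp (- Re u * ln b)) / Re u.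
Proof.
intros Hu Hs Hab.
replace ((exp (- Re u * ln a) - exp (- Re u * ln b)) / Re u)
  with (- exp (- Re u * ln b) / Re u - - exp (- Re u * ln a) / Re u) by (field; lra).
apply (Efun_mvt u d a b (fun y => - exp (- Re u * ln y) / Re u)
  (fun y => exp ((- Re u - 1) * ln y)) Hu Hab).
- intros x Hx.
  apply is_derive_ext with (fun y => - / Re u * exp (- Re u * ln y)); [intros; toR; field; lra|].
  replace (exp ((- Re u - 1) * ln x)) with (- / Re u * (- Re u * exp ((- Re u - 1) * ln x)))
    by (field; lra).
  apply (is_derive_scal (fun y => exp (- Re u * ln y))), exp_ln_derive; lra.
- intros x Hx. assert (Rabs (sin x) <= 1) by (apply Rabs_le, SIN_bound).
  assert (X := exp_pos ((- Re u - 1) * ln x)). nra.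
Qed.

Lemma abs_sin_le (x : R) : 0 <= x -> Rabs (sin x) <= x.
Proof.
intros Hx. replace (sin x) with (sin x - sin 0) by (rewrite sin_0; ring).
replace x with (x - 0) at 2 by ring.
apply (rmvt sin cos (fun t => t) (fun _ => 1)); [exact Hx| | |].
- intros t _; apply is_derive_sin.
- intros t _; apply (is_derive_id (K := R_AbsRing)).
- intros t _; apply Rabs_le, COS_bound.
Qed.

Lemma Efun_diff_small (u : C) (d a b : R) : away u d -> Re u < 1 -> 0 < a <= b ->
  Cmod (Efun b u - Efun a u)%C <= (exp ((1 - Re u) * ln b) - exp ((1 - Re u) * ln a)) / (1 - Re u).
Proof.
intros Hu Hs Hab.
replace ((exp ((1 - Re u) * ln b) - exp ((1 - Re u) * ln a)) / (1 - Re u))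
  with (exp ((1 - Re u) * ln b) / (1 - Re u) - exp ((1 - Re u) * ln a) / (1 - Re u)) by (field; lra).
apply (Efun_mvt u d a b (fun y => exp ((1 - Re u) * ln y) / (1 - Re u))
  (fun y => exp ((1 - Re u - 1) * ln y)) Hu Hab).
- intros x Hx.
  apply is_derive_ext with (fun y => / (1 - Re u) * exp ((1 - Re u) * ln y)); [intros; toR; field; lra|].
  replace (exp ((1 - Re u - 1) * ln x)) with
    (/ (1 - Re u) * ((1 - Re u) * exp ((1 - Re u - 1) * ln x))) by (field; lra).
  apply (is_derive_scal (fun y => exp ((1 - Re u) * ln y))), exp_ln_derive; lra.
- intros x Hx. replace (exp ((1 - Re u - 1) * ln x)) with (x * exp ((- Re u - 1) * ln x))
    by (rewrite <- (exp_ln x) at 1 by lra; rewrite <- exp_plus; f_equal; ring).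
  apply Rmult_le_compat_r; [left; apply exp_pos|apply abs_sin_le; lra].
Qed.

Lemma exp_ln_vanishes (c : R) : 0 < c -> is_lim_seq (fun n => exp (- c * ln (INR (S n)))) 0.
Proof.
intros Hc. apply (is_lim_comp_seq exp _ m_infty 0); [apply is_lim_exp_m| |].
- exists 0%nat; intros; discriminate.
- apply (is_lim_seq_incr_1 (fun n => - c * ln (INR n))).
  replace m_infty with (Rbar_mult (- c) p_infty).
  + apply is_lim_seq_scal_l.
    apply (is_lim_comp_seq ln _ p_infty p_infty); [apply is_lim_ln_p| |apply is_lim_seq_INR].
    exists 0%nat; intros; discriminate.
  + simpl. destruct (Rle_dec 0 (- c)); [exfalso; lra|reflexivity].
Qed.

(** Integrates |sin y| <= y from 0: the lower limit runs through 1/(n + 1), where [Efun_small] makes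
    the boundary value vanish because Re u < 1. *)
Lemma Efun_le (u : C) (d Y : R) : away u d -> Re u < 1 -> 0 < Y ->
  Cmod (Efun Y u) <= exp ((1 - Re u) * ln Y) / (1 - Re u).
Proof.
intros Hu Hs HY. destruct (Efun_small u d Hu) as [B [HB0 HB]].
apply (is_lim_seq_le_loc (fun _ => Cmod (Efun Y u))
  (fun n => exp ((1 - Re u) * ln Y) / (1 - Re u) + B * exp (- (1 - Re u) * ln (INR (S n))))
  (Cmod (Efun Y u)) (exp ((1 - Re u) * ln Y) / (1 - Re u))).
- destruct (nfloor_ex (/ Y)) as [N HN]; [left; apply Rinv_0_lt_compat, HY|].
  exists (S N); intros n Hn. set (y := / INR (S n)).
  assert (Hn1 : 1 <= INR (S n)) by (rewrite S_INR; generalize (pos_INR n); lra).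
  assert (Hy : 0 < y <= 1).
  { unfold y; split; [apply Rinv_0_lt_compat; lra|]. rewrite <- Rinv_1. apply Rinv_le_contravar; lra. }
  assert (HyY : y <= Y).
  { unfold y. rewrite <- (Rinv_inv Y). apply Rinv_le_contravar; [apply Rinv_0_lt_compat, HY|].
    apply le_INR in Hn. rewrite S_INR in *. lra. }
  assert (H1 := Efun_diff_small u d y Y Hu Hs ltac:(lra)).
  assert (H2 := HB y Hy).
  assert (El : (1 - Re u) * ln y = - (1 - Re u) * ln (INR (S n)))
    by (unfold y; rewrite ln_Rinv by lra; ring).
  rewrite El in *.
  assert (X := exp_pos (- (1 - Re u) * ln (INR (S n)))).
  generalize (Cmod_triangle_inv (Efun Y u) (Efun y u)).
  assert (0 < / (1 - Re u)) by (apply Rinv_0_lt_compat; lra).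
  unfold Rdiv in *. nra.
- apply is_lim_seq_const.
- replace (Finite (exp ((1 - Re u) * ln Y) / (1 - Re u)))
    with (Rbar_plus (exp ((1 - Re u) * ln Y) / (1 - Re u)) (Rbar_mult B 0))
    by (simpl; f_equal; ring).
  apply is_lim_seq_plus with (l1 := exp ((1 - Re u) * ln Y) / (1 - Re u)) (l2 := Rbar_mult B 0).
  + apply is_lim_seq_const.
  + apply is_lim_seq_scal_l, exp_ln_vanishes; lra.
  + simpl. unfold is_Rbar_plus; simpl; f_equal; f_equal; ring.
Qed.

Lemma an_Efun (Y : R) (u : C) (d : R) : 0 < Y -> away u d -> an (Efun Y) u (d / 2).
Proof.
intros HY Hu. assert (Hd : 0 < d) by apply Hu.
apply (an_mult (rp Y) (fun v => rpser (sf v) Y)).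
- apply an_ext with (fun z => Cexp (- RtoC (ln Y) * z)); [|apply an_exp; lra].
  intros z _; unfold rp; f_equal; ring.
- apply an_series with (fun n v => sf v n * RtoC Y ^ n)%C (fun n => / (d / 2) * (Y ^ n / INR (fact n))).
  + intros n. destruct (Nat.even n) eqn:En.
    * apply an_ext with (fun _ => RtoC 0); [|apply an_const; lra].
      intros z _; rewrite sf_even by exact En; ring.
    * assert (Ho : Nat.odd n = true) by (unfold Nat.odd; rewrite En; reflexivity).
      apply an_ext with (fun v => (- RtoC (sgn n / INR (fact n)) * RtoC Y ^ n) * / (v - RtoC (INR n)))%C.
      -- intros z Hz. unfold sf.
         destruct (away_near u z d Hu Hz) as [H1 H2]. specialize (H2 n Ho).
         field. split; apply Cmod_gt_0; [|rewrite Cmod_minus_sym]; lra.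
      -- apply an_scal, an_inv. destruct Hu as [_ Hu]. specialize (Hu n Ho). lra.
  + intros n z Hz. rewrite Cmod_mult, Cmod_pow, Cmod_R, Rabs_pos_eq by lra.
    assert (P := INR_fact_lt_0 n).
    replace (/ (d / 2) * (Y ^ n / INR (fact n))) with (/ (d / 2) / INR (fact n) * Y ^ n) by (field; lra).
    apply Rmult_le_compat_r; [apply pow_le; lra|].
    apply sf_bound, (away_near u z d Hu Hz).
  + apply Rex_series_scal, exp_series_R.
  + intros z Hz. apply (rpser_sums (sf z) (/ (d / 2))).
    intros n. apply sf_bound, (away_near u z d Hu Hz).
Qed.

(** The integral of sin y times y^(-u-1) over the half-line for 0 < Re u < 1, continued to Re u > 0
    off the odd integers; classically it is - Gamma(-u) sin(pi u / 2). *)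
Definition Sfun (u : C) : C :=
  epsilon (inhabits (RtoC 0)) (fun l => Clim (fun m => Efun (INR (S m)) u) l).

Lemma Efun_step (u : C) (d : R) (m : nat) : away u d -> 0 < Re u ->
  Cmod (Efun (INR (S (S m))) u - Efun (INR (S m)) u)%C <= exp (- (Re u + 1) * ln (INR (S m))).
Proof.
intros Hu Hs. assert (Hm : 0 < INR (S m)) by (apply lt_0_INR; lia).
assert (HS := S_INR (S m)).
set (q := exp (- (Re u + 1) * ln (INR (S m)))).
replace q with (q * INR (S (S m)) - q * INR (S m)) by (rewrite HS; ring).
apply (Efun_mvt u d (INR (S m)) (INR (S (S m))) (fun y => q * y) (fun y => q) Hu); [lra| |].
- intros x Hx. auto_derive; [exact I|ring].
- intros x Hx. assert (Rabs (sin x) <= 1) by (apply Rabs_le, SIN_bound).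
  assert (X := exp_pos ((- Re u - 1) * ln x)).
  assert (exp ((- Re u - 1) * ln x) <= q).
  { apply exp_mono. assert (ln (INR (S m)) <= ln x) by (apply ln_le; lra). nra. }
  nra.
Qed.

(** The limit is a telescoping series whose terms are O(m^(-Re u - 1)) locally uniformly, so that
    the Weierstrass test applies. *)
Lemma Sfun_spec (u : C) (d : R) : away u d -> 0 < Re u ->
  anl Sfun u /\ Clim (fun m => Efun (INR (S m)) u) (Sfun u).
Proof.
intros Hu Hs. assert (Hd : 0 < d) by apply Hu.
set (r := Rmin (d / 2) (Re u / 2)).
assert (Hr : 0 < r) by (apply Rmin_glb_lt; lra).
assert (Hr1 : r <= d / 2) by apply Rmin_l.
assert (Hr2 : r <= Re u / 2) by apply Rmin_r.
set (b := fun m => exp (- (Re u / 2 + 1) * ln (INR (S m)))).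
assert (Hb : ex_series b) by (apply ex_series_rpow; lra).
assert (HRe : forall z, Cmod (z - u)%C < r -> Re u / 2 < Re z).
{ intros z Hz. generalize (Re_near z u r Hz); lra. }
set (t := fun (m : nat) (z : C) => (Efun (INR (S (S m))) z - Efun (INR (S m)) z)%C).
assert (Hbd : forall m z, Cmod (z - u)%C < r -> Cmod (t m z) <= b m).
{ intros m z Hz. eapply Rle_trans.
  - apply (Efun_step z (d / 2)); [apply away_near with u; [exact Hu|lra]|].
    generalize (HRe z Hz); lra.
  - apply exp_mono. generalize (HRe z Hz) (ln_INR_ge_0 (S m)). nra. }
assert (Hlim : forall z, Cmod (z - u)%C < r -> Clim (fun m => Efun (INR (S m)) z) (Sfun z)).
{ intros z Hz. unfold Sfun.
  apply (epsilon_spec (inhabits (RtoC 0)) (fun l => Clim (fun m => Efun (INR (S m)) z) l)).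
  destruct (Csums_abs (fun m => t m z) b) as [l [Hl _]]; [intros; apply Hbd, Hz|exact Hb|].
  exists (l + Efun (INR 1) z)%C.
  apply Clim_ext with (fun m => csum (fun m => t m z) m + Efun (INR 1) z)%C.
  - intros m. unfold t. rewrite (csum_telescope (fun m => Efun (INR (S m)) z)). ring.
  - apply Clim_plus; [exact Hl|apply Clim_const]. }
split.
- exists r. apply an_ext with (fun z => (Sfun z - Efun (INR 1) z) + Efun (INR 1) z)%C; [intros; ring|].
  assert (AE : forall m, an (Efun (INR (S m))) u r).
  { intros m. apply an_shrink with (d / 2); [|lra]. apply an_Efun; [apply lt_0_INR; lia|exact Hu]. }
  apply an_plus; [|apply (AE 0%nat)].
  apply an_series with t b.
  + intros m. apply an_minus; [apply (AE (S m))|apply (AE m)].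
  + exact Hbd.
  + exact Hb.
  + intros z Hz. apply Clim_ext with (fun m => Efun (INR (S m)) z - Efun (INR 1) z)%C.
    * intros m. unfold t. rewrite (csum_telescope (fun m => Efun (INR (S m)) z)). ring.
    * apply Clim_minus; [apply Hlim, Hz|apply Clim_const].
- apply Hlim. rewrite Cmod_diag; exact Hr.
Qed.

Lemma Sfun_tail (u : C) (d Y : R) : away u d -> 0 < Re u -> 0 < Y ->
  Cmod (Efun Y u - Sfun u)%C <= exp (- Re u * ln Y) / Re u.
Proof.
intros Hu Hs HY. destruct (Sfun_spec u d Hu Hs) as [_ HL].
destruct (nfloor_ex Y) as [N HN]; [lra|].
rewrite Cmod_minus_sym.
apply (Clim_bound (fun m => Efun (INR (S m)) u - Efun Y u)%C _ _ N).
- apply Clim_minus; [exact HL|apply Clim_const].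
- intros m Hm. apply le_INR in Hm. assert (HS := S_INR m).
  eapply Rle_trans; [apply (Efun_diff_large u d Y); [exact Hu|exact Hs|lra]|].
  unfold Rdiv. apply Rmult_le_compat_r; [left; apply Rinv_0_lt_compat, Hs|].
  generalize (exp_pos (- Re u * ln (INR (S m)))); lra.
Qed.

(** * The functional equation *)

(** With |al| = 1 the disc keeps its radius; only al = 1 and al = -1 occur. *)
Lemma anl_comp_affine (f : C -> C) (al be c : C) : Cmod al = 1 ->
  anl f (al * c + be)%C -> anl (fun z => f (al * z + be)%C) c.
Proof.
intros Hal [r [Hr [a Ha]]]. exists r; split; [exact Hr|].
exists (fun n => a n * al ^ n)%C. intros z Hz.
assert (E : (al * z + be - (al * c + be))%C = (al * (z - c))%C) by ring.
assert (P := Ha (al * z + be)%C). rewrite E, Cmod_mult, Hal, Rmult_1_l in P.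
specialize (P Hz). revert P. apply Csums_ext. intros n. rewrite Cpow_mult_l; ring.
Qed.

Lemma Clim_bound_eps (u : nat -> C) (l : C) (B : R) (e : nat -> R) :
  Clim u l -> (forall n, Cmod (u n) <= B + e n) -> is_lim_seq e 0 -> Cmod l <= B.
Proof.
intros H HB He. apply Rnot_lt_le; intros Hlt.
assert (P : 0 < (Cmod l - B) / 2) by lra.
apply is_lim_seq_spec in H. apply is_lim_seq_spec in He.
destruct (H (mkposreal _ P)) as [M1 H1], (He (mkposreal _ P)) as [M2 H2]; simpl in H1, H2.
specialize (H1 (M1 + M2)%nat ltac:(lia)); specialize (H2 (M1 + M2)%nat ltac:(lia)).
specialize (HB (M1 + M2)%nat).
rewrite Rminus_0_r in H1, H2. rewrite (Rabs_pos_eq _ (Cmod_ge_0 _)), Cmod_minus_sym in H1.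
apply Rabs_def2 in H2.
generalize (Cmod_triangle_inv l (u (M1 + M2)%nat)); lra.
Qed.

(** * Euler-Maclaurin summation of third order *)

(* The derivative of [bern]. *)
Definition bern1 (x : R) : R := x ^ 2 / 2 - x / 2 + 1 / 12.

Definition kap (s : C) : C := (- s * (s + 1) * (s + 2))%C.

(* An antiderivative of [kap s * bern (x - n) * x^(-s-3)], by three integrations by parts. *)
Definition Aprim (s : C) (n x : R) : C :=
  (RtoC (bern (x - n)) * (s * (s + 1) * rp x (s + 2)) + RtoC (bern1 (x - n)) * (s * rp x (s + 1))
   + RtoC (x - n - 1 / 2) * rp x s - / (1 - s) * rp x (s - 1))%C.

Lemma cder_RtoC_mult (f : R -> R) (g : R -> C) (x l : R) (m : C) :
  is_derive f x l -> cder g x m ->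
  cder (fun t => RtoC (f t) * g t)%C x (RtoC l * g x + RtoC (f x) * m)%C.
Proof. intros Hf Hg. apply (cder_mult (fun t => RtoC (f t)) g); [apply cder_real, Hf|exact Hg]. Qed.

Lemma one_minus_nz (s : C) : s <> 1 -> (1 - s)%C <> 0.
Proof. intros H E. apply H. replace s with (1 - (1 - s))%C by ring. rewrite E; ring. Qed.

Lemma Aprim_derive (s : C) (n x : R) : 0 < x -> s <> 1 ->
  cder (Aprim s n) x (kap s * RtoC (bern (x - n)) * rp x (s + 3))%C.
Proof.
intros Hx Hs. unfold Aprim.
eapply cder_eq.
- apply cder_minus; [apply cder_plus; [apply cder_plus|]|].
  + apply (cder_RtoC_mult (fun t => bern (t - n)) (fun t => s * (s + 1) * rp t (s + 2))%C _ (bern1 (x - n))).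
    * unfold bern, bern1. auto_derive; [exact I|field].
    * apply cder_scal, cder_rp, Hx.
  + apply (cder_RtoC_mult (fun t => bern1 (t - n)) (fun t => s * rp t (s + 1))%C _ (x - n - 1 / 2)).
    * unfold bern1. auto_derive; [exact I|field].
    * apply cder_scal, cder_rp, Hx.
  + apply (cder_RtoC_mult (fun t => t - n - 1 / 2) (fun t => rp t s) _ 1).
    * auto_derive; [exact I|ring].
    * apply cder_rp, Hx.
  + apply cder_scal, cder_rp, Hx.
- replace (s + 2 + 1)%C with (s + 3)%C by ring. replace (s + 1 + 1)%C with (s + 2)%C by ring.
  replace (s - 1 + 1)%C with s by ring. unfold kap.
  field. apply one_minus_nz, Hs.
Qed.

Lemma bern_0 : bern 0 = 0. Proof. unfold bern; field. Qed.
Lemma bern_1 : bern 1 = 0. Proof. unfold bern; field. Qed.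
Lemma bern1_0 : bern1 0 = / 12. Proof. unfold bern1; field. Qed.
Lemma bern1_1 : bern1 1 = / 12. Proof. unfold bern1; field. Qed.

Lemma bern_le (x : R) : 0 <= x <= 1 -> Rabs (bern x) <= x.
Proof. intros Hx. unfold bern. apply Rabs_le. simpl. split; nra. Qed.

(** The Euler-Maclaurin remainder over [n, n + 1], as an increment of the antiderivative. *)
Definition emt (s : C) (n : nat) : C := (Aprim s (INR n) (INR (S n)) - Aprim s (INR n) (INR n))%C.

Definition bdry (s : C) (n : nat) : C :=
  (s * RtoC (/ 12) * rp (INR n) (s + 1) + RtoC (/ 2) * rp (INR n) s - / (1 - s) * rp (INR n) (s - 1))%C.

(** [bern] vanishes at both ends of the unit interval and [bern1] equals 1/12 at both, so these
    terms telescope; the sawtooth takes the values 1/2 and -1/2, and its jump produces n^(-s). *)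
Lemma emt_explicit (s : C) (n : nat) : emt s n = (bdry s (S n) - bdry s n + npow n s)%C.
Proof.
unfold emt, Aprim, bdry. rewrite npow_rp, S_INR.
replace (INR n + 1 - INR n) with 1 by ring. rewrite Rminus_eq_0.
rewrite bern_0, bern_1, bern1_0, bern1_1.
replace (1 - 1 / 2) with (/ 2) by field. replace (0 - 1 / 2) with (- / 2) by field.
generalize (/ (1 - s))%C; intros v. rewrite RtoC_opp, !RtoC_inv by lra.
field.
Qed.

Lemma emt_bound (s : C) (n : nat) : s <> 1 -> -3 <= Re s -> (0 < n)%nat ->
  Cmod (emt s n) <= Cmod (kap s) * exp (- (Re s + 3) * ln (INR n)).
Proof.
intros Hs Hr Hn. assert (Hn0 : 0 < INR n) by (apply lt_0_INR, Hn).
assert (HS := S_INR n). unfold emt.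
set (q := Cmod (kap s) * exp (- (Re s + 3) * ln (INR n))).
replace q with (q * INR (S n) - q * INR n) by (rewrite HS; ring).
apply (cmvt (Aprim s (INR n)) (fun x => kap s * RtoC (bern (x - INR n)) * rp x (s + 3))%C
  (fun y => q * y) (fun y => q)); [lra| | |].
- intros x Hx. apply Aprim_derive; [lra|exact Hs].
- intros x Hx. auto_derive; [exact I|ring].
- intros x Hx. rewrite !Cmod_mult, Cmod_R, Cmod_rp. autorewrite with cre.
  assert (Rabs (bern (x - INR n)) <= 1)
    by (eapply Rle_trans; [apply bern_le|]; lra).
  assert (X := exp_pos (- (Re s + 3) * ln x)).
  assert (exp (- (Re s + 3) * ln x) <= exp (- (Re s + 3) * ln (INR n))).
  { apply exp_mono. assert (ln (INR n) <= ln x) by (apply ln_le; lra). nra. }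
  unfold q. rewrite Rmult_assoc. apply Rmult_le_compat_l; [apply Cmod_ge_0|].
  generalize (Rabs_pos (bern (x - INR n))). nra.
Qed.

Lemma anl_rp (x : R) (k : C) (c : C) (r : R) : 0 < r -> an (fun s => rp x (s + k)) c r.
Proof.
intros Hr. apply an_ext with (fun s => rp x k * Cexp (- RtoC (ln x) * s))%C.
- intros s _. rewrite rp_plus. unfold rp at 3. rewrite (Cmult_comm (rp x s)). f_equal.
  unfold rp; f_equal; ring.
- apply an_scal, an_exp, Hr.
Qed.

Lemma an_bdry (n : nat) (c : C) (r : R) : 0 < r <= Cmod (1 - c)%C -> an (fun s => bdry s n) c r.
Proof.
intros Hr. unfold bdry.
apply an_minus; [apply an_plus|].
- apply an_mult; [|apply anl_rp; lra].
  apply an_mult; [apply an_id; lra|apply an_const; lra].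
- apply an_scal. apply an_ext with (fun s => rp (INR n) (s + 0)); [intros; f_equal; ring|].
  apply anl_rp; lra.
- apply an_mult.
  + apply an_ext with (fun s => - (1) * / (s - 1))%C.
    * intros z Hz. field.
      assert (z <> 1) by (intros ->; lra).
      split; [apply one_minus_nz, H|]. intros E.
      apply (one_minus_nz z H). replace (1 - z)%C with (- (z - 1))%C by ring. rewrite E; ring.
    * apply an_scal, an_inv, Hr.
  + apply an_ext with (fun s => rp (INR n) (s + - (1))); [intros; f_equal|]. apply anl_rp; lra.
Qed.

Lemma an_emt (n : nat) (c : C) (r : R) : 0 < r <= Cmod (1 - c)%C -> an (fun s => emt s n) c r.
Proof.
intros Hr. apply an_ext with (fun s => bdry s (S n) - bdry s n + npow n s)%C;
  [intros; symmetry; apply emt_explicit|].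
apply an_plus; [apply an_minus; apply an_bdry, Hr|].
apply an_ext with (fun s => rp (INR n) (s + 0)); [intros; rewrite npow_rp; f_equal; ring|].
apply anl_rp; lra.
Qed.

Definition Esum (s : C) : C := epsilon (inhabits (RtoC 0)) (Csums (fun k => emt s (S k))).

Lemma Cmod_kap_le (s : C) (X : R) : Cmod s <= X -> Cmod (kap s) <= X * (X + 1) * (X + 2).
Proof.
intros Hs. unfold kap. rewrite !Cmod_mult, Cmod_opp.
assert (H1 : Cmod (s + 1)%C <= X + 1)
  by (eapply Rle_trans; [apply Cmod_triangle|rewrite Cmod_1; lra]).
assert (H2 : Cmod (s + 2)%C <= X + 2)
  by (eapply Rle_trans; [apply Cmod_triangle|rewrite Cmod_R, Rabs_pos_eq; lra]).
assert (P0 := Cmod_ge_0 s). assert (P1 := Cmod_ge_0 (s + 1)%C). assert (P2 := Cmod_ge_0 (s + 2)%C).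
repeat apply Rmult_le_compat; try assumption. apply Rmult_le_pos; assumption.
Qed.

(** The remainders are O(n^(-Re s - 3)), locally uniformly summable for Re s > -2. *)
Lemma Esum_spec (s : C) : -2 < Re s -> s <> 1 -> anl Esum s /\ Csums (fun k => emt s (S k)) (Esum s).
Proof.
intros Hs Hs1.
assert (H1 : 0 < Cmod (1 - s)%C) by (apply Cmod_gt_0, one_minus_nz, Hs1).
set (r := Rmin (Cmod (1 - s)%C) ((Re s + 2) / 2)).
assert (Hr : 0 < r) by (apply Rmin_glb_lt; lra).
assert (Hr1 : r <= Cmod (1 - s)%C) by apply Rmin_l.
assert (Hr2 : r <= (Re s + 2) / 2) by apply Rmin_r.
set (X := Cmod s + r). set (B := X * (X + 1) * (X + 2)).
set (b := fun k => B * exp (- (1 + (Re s + 2) / 2) * ln (INR (S k)))).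
assert (Hb : ex_series b)
  by (apply Rex_series_scal, ex_series_rpow; lra).
assert (Hbd : forall k z, Cmod (z - s)%C < r -> Cmod (emt z (S k)) <= b k).
{ intros k z Hz.
  assert (HRe := Re_near z s r Hz).
  eapply Rle_trans; [apply emt_bound; [|lra|lia]|].
  - intros ->. lra.
  - unfold b. apply Rmult_le_compat; [apply Cmod_ge_0|left; apply exp_pos| |].
    + apply Cmod_kap_le. unfold X. generalize (Cmod_triangle_inv z s); lra.
    + apply exp_mono. generalize (ln_INR_ge_0 (S k)). nra. }
assert (Hsum : forall z, Cmod (z - s)%C < r -> Csums (fun k => emt z (S k)) (Esum z)).
{ intros z Hz. apply (epsilon_spec (inhabits (RtoC 0)) (Csums (fun k => emt z (S k)))).
  destruct (Csums_abs (fun k => emt z (S k)) b) as [l [Hl _]];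
    [intros k; apply Hbd, Hz|exact Hb|exists l; exact Hl]. }
split.
- exists r. apply an_series with (fun k z => emt z (S k)) b; auto.
  intros k; apply an_emt; lra.
- apply Hsum. rewrite Cmod_diag; exact Hr.
Qed.

Lemma csum_emt (s : C) (m : nat) : csum (fun k => emt s (S k)) m =
  (bdry s (S m) - bdry s 1 + csum (fun k => npow (S k) s) m)%C.
Proof.
rewrite <- (csum_telescope (fun k => bdry s (S k))), <- csum_plus.
apply csum_ext; intros k _. apply emt_explicit.
Qed.

Lemma rp_vanishes (s : C) : 0 < Re s -> Clim (fun m => rp (INR (S m)) s) 0.
Proof.
intros Hs. apply Clim_squeeze with (fun m => exp (- Re s * ln (INR (S m)))).
- intros m. replace (rp (INR (S m)) s - 0)%C with (rp (INR (S m)) s) by ring. rewrite Cmod_rp; lra.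
- apply exp_ln_vanishes, Hs.
Qed.

Section Functional.
Variable zeta : C -> C.
Hypothesis Hzeta : is_riemann_zeta zeta.

(** For Re s > 1 the explicit remainders telescope and the boundary terms at infinity vanish; the
    identity theorem carries the formula to Re s > -2. *)
Lemma euler_maclaurin (s : C) : -2 < Re s -> s <> 1 -> zeta s = (bdry s 1 + Esum s)%C.
Proof.
assert (R1 : forall s, 1 < Re s -> zeta s = (bdry s 1 + Esum s)%C).
{ intros z Hz.
  assert (Hz1 : z <> 1) by (intros ->; simpl in Hz; lra).
  destruct (Esum_spec z) as [_ HE]; [lra|exact Hz1|].
  assert (L : Csums (fun k => emt z (S k)) (0 - bdry z 1 + zeta z)%C).
  { apply Clim_ext with (fun m => bdry z (S m) - bdry z 1 + csum (fun k => npow (S k) z) m)%C;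
      [intros; symmetry; apply csum_emt|].
    apply Clim_plus; [apply Clim_minus; [|apply Clim_const]|apply zeta_series; assumption].
    replace (RtoC 0) with (z * RtoC (/ 12) * 0 + RtoC (/ 2) * 0 - / (1 - z) * 0)%C by ring.
    unfold bdry. apply Clim_minus; [apply Clim_plus|]; apply Clim_scal, rp_vanishes;
      autorewrite with cre; lra. }
  rewrite (Csums_unique _ _ _ HE L). ring. }
intros Hs Hs1.
assert (An : forall z, -2 < Re z -> z <> 1 -> anl (fun w => zeta w - (bdry w 1 + Esum w))%C z).
{ intros z Hz Hz1. apply anl_minus; [apply anl_zeta; assumption|].
  apply anl_plus; [|apply Esum_spec; assumption].
  exists (Cmod (1 - z)%C). apply an_bdry. split; [apply Cmod_gt_0, one_minus_nz, Hz1|lra]. }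
assert (Z : (zeta s - (bdry s 1 + Esum s))%C = 0).
{ apply (identity_halfplane (fun w => zeta w - (bdry w 1 + Esum w))%C (-2) 3); [lra| | |exact Hs|].
  - intros z Hz Hi. apply An; [exact Hz|intros ->; apply Hi; reflexivity].
  - intros y _. exists 1; split; [lra|]. intros w Hw.
    assert (Hr := Re_near w (3, y) 1 Hw). rewrite Re_pair in Hr.
    rewrite R1 by lra. ring.
  - apply An; assumption. }
replace (zeta s) with (zeta s - (bdry s 1 + Esum s) + (bdry s 1 + Esum s))%C by ring.
rewrite Z; ring.
Qed.

(** At 0 the factor [kap] kills the remainder, and the boundary terms give 1/2 - 1 = -1/2. *)
Lemma zeta_0 : zeta 0 <> 0.
Proof.
assert (H01 : RtoC 0 <> 1) by (apply not_eq_sym, RtoC_nz; lra).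
rewrite euler_maclaurin by (simpl; lra || exact H01).
destruct (Esum_spec 0) as [_ HE]; [simpl; lra|exact H01|].
assert (E0 : Esum 0 = 0).
{ apply Csums_unique with (1 := HE). apply Csums_ext with (fun _ => RtoC 0); [|apply Csums_zero].
  intros k. symmetry. apply Cmod_eq_0, Rle_antisym; [|apply Cmod_ge_0].
  eapply Rle_trans; [apply emt_bound; [exact H01|simpl; lra|lia]|].
  unfold kap. replace (- 0 * (0 + 1) * (0 + 2))%C with (RtoC 0) by ring. rewrite Cmod_0; lra. }
rewrite E0. unfold bdry. simpl INR. rewrite !rp_1_l. intros E.
apply (f_equal Re) in E. revert E.
replace (/ (1 - 0))%C with (RtoC 1) by (field; apply RtoC_nz; lra).
autorewrite with cre. lra.
Qed.

(** * The remainder integral in the strip, expanded in Fourier series *)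

Section Strip.
Variable s : C.
Hypothesis Hs : -2 < Re s < -1.

Let u := (s + 2)%C.
Let sg := Re u.
Variable d : R.
Hypothesis Hd : away u d.

Let Hsg : 0 < sg < 1.
Proof. unfold sg, u. autorewrite with cre. lra. Qed.

Let s_neq_1 : s <> 1.
Proof. intros E. destruct Hs as [_ H]. rewrite E in H. simpl in H; lra. Qed.

(** The substitution y = om k x turns the k-th Fourier term times x^(-s-3) into sin y times y^(-u-1)
    and leaves this constant; [phi] is therefore an antiderivative of the partial Fourier sum times
    x^(-s-3). *)
Definition wgt (k : nat) : C := (RtoC (2 / om k ^ 3) * rp (om k) (- u))%C.

Definition phi (N : nat) (x : R) : C := csum (fun k => wgt k * Efun (om k * x) u)%C N.

Lemma cder_scale (f : R -> C) (c x : R) (l : C) : cder f (c * x) l ->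
  cder (fun t => f (c * t)) x (RtoC c * l)%C.
Proof.
intros [H1 H2].
assert (L : is_derive (fun t => c * t) x c) by (auto_derive; [exact I|ring]).
split; autorewrite with cre.
- replace (c * Re l - 0 * Im l) with (c * Re l) by ring.
  apply (is_derive_comp (fun t => Re (f t)) (fun t => c * t)); assumption.
- replace (c * Im l + 0 * Re l) with (c * Im l) by ring.
  apply (is_derive_comp (fun t => Im (f t)) (fun t => c * t)); assumption.
Qed.


Lemma phi_derive (N : nat) (x : R) : 0 < x ->
  cder (phi N) x (RtoC (fourier3 N x) * rp x (s + 3))%C.
Proof.
intros Hx. unfold phi.
apply cder_eq with (csum (fun k => wgt k * (RtoC (om k) *
  (RtoC (sin (om k * x)) * rp (om k * x) (u + 1))))%C N).
- apply (cder_csum (fun k x => wgt k * Efun (om k * x) u)%C). intros k _.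
  apply cder_scal, (cder_scale (fun y => Efun y u)).
  apply Efun_derive with d; [apply Rmult_lt_0_compat; [apply om_pos|exact Hx]|exact Hd].
- transitivity (csum (fun k => rp x (s + 3) * RtoC (2 * sin (om k * x) / om k ^ 3))%C N).
  + apply csum_ext; intros k _. assert (P := om_pos k).
    rewrite rp_mult by assumption. replace (u + 1)%C with (s + 3)%C by (unfold u; ring).
    unfold wgt.
    assert (E : (rp (om k) (- u) * (RtoC (om k) * rp (om k) (s + 3)))%C = 1).
    { replace (s + 3)%C with (u + 1)%C by (unfold u; ring). rewrite rp_succ, <- rp_plus by exact P.
      replace (- u + u)%C with (RtoC 0) by ring. apply rp_0. }
    replace (2 * sin (om k * x) / om k ^ 3) with (2 / om k ^ 3 * sin (om k * x)) by (unfold Rdiv; ring).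
    rewrite RtoC_mult.
    replace (RtoC (2 / om k ^ 3) * rp (om k) (- u) *
      (RtoC (om k) * (RtoC (sin (om k * x)) * (rp (om k) (s + 3) * rp x (s + 3)))))%C
      with (RtoC (2 / om k ^ 3) * RtoC (sin (om k * x)) * rp x (s + 3) *
        (rp (om k) (- u) * (RtoC (om k) * rp (om k) (s + 3))))%C by ring.
    rewrite E. ring.
  + rewrite csum_scal, Cmult_comm. f_equal. unfold fourier3. clear.
    induction N as [|N IH]; [reflexivity|]. cbn [csum rsum]. rewrite IH, RtoC_plus; reflexivity.
Qed.

Lemma fourier3_periodic (N n : nat) (x : R) : fourier3 N (x - INR n) = fourier3 N x.
Proof.
unfold fourier3. apply rsum_ext; intros k _. unfold om.
replace (2 * PI * INR (S k) * x)
  with (2 * PI * INR (S k) * (x - INR n) + 2 * INR (S k * n) * PI) by (rewrite mult_INR; ring).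
rewrite sin_period; reflexivity.
Qed.

(** On one period the two antiderivatives have derivatives that differ by the uniform Fourier error
    times x^(-s-3). *)
Lemma Aprim_phi (N n : nat) (a b : R) : 0 < a -> INR n <= a -> a <= b -> b <= INR n + 1 ->
  Cmod ((Aprim s (INR n) b - Aprim s (INR n) a) - kap s * (phi N b - phi N a))%C
  <= Cmod (kap s) * (4 * / INR (S N)) / sg * (exp (- sg * ln a) - exp (- sg * ln b)).
Proof.
intros Ha Hn Hab Hb.
set (q := Cmod (kap s) * (4 * / INR (S N))).
replace (Aprim s (INR n) b - Aprim s (INR n) a - kap s * (phi N b - phi N a))%C
  with ((Aprim s (INR n) b - kap s * phi N b) - (Aprim s (INR n) a - kap s * phi N a))%C by ring.
replace (q / sg * (exp (- sg * ln a) - exp (- sg * ln b)))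
  with ((- q / sg) * exp (- sg * ln b) - (- q / sg) * exp (- sg * ln a)) by (field; lra).
apply (cmvt (fun x => Aprim s (INR n) x - kap s * phi N x)%C
  (fun x => kap s * RtoC (bern (x - INR n)) * rp x (s + 3) - kap s * (RtoC (fourier3 N x) * rp x (s + 3)))%C
  (fun x => (- q / sg) * exp (- sg * ln x)) (fun x => q * exp ((- sg - 1) * ln x))); [exact Hab| | |].
- intros x Hx. apply cder_minus; [apply Aprim_derive; [lra|exact s_neq_1]|].
  apply cder_scal, phi_derive; lra.
- intros x Hx.
  replace (q * exp ((- sg - 1) * ln x)) with ((- q / sg) * (- sg * exp ((- sg - 1) * ln x)))
    by (field; lra).
  apply (is_derive_scal (fun x => exp (- sg * ln x))), exp_ln_derive; lra.
- intros x Hx.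
  replace (kap s * RtoC (bern (x - INR n)) * rp x (s + 3) - kap s * (RtoC (fourier3 N x) * rp x (s + 3)))%C
    with (kap s * RtoC (bern (x - INR n) - fourier3 N (x - INR n)) * rp x (s + 3))%C
    by (rewrite fourier3_periodic, RtoC_minus; ring).
  rewrite !Cmod_mult, Cmod_R, Cmod_rp.
  replace (- Re (s + 3)%C) with (- sg - 1) by (unfold sg, u; autorewrite with cre; ring).
  apply Rmult_le_compat_r; [left; apply exp_pos|].
  apply Rmult_le_compat_l; [apply Cmod_ge_0|apply fourier3_error; lra].
Qed.

(** [kap s] times the integral of bern({x}) x^(-s-3) over [delta, m + 1]. *)
Definition partial (delta : R) (m : nat) : C :=
  (Aprim s 0 1 - Aprim s 0 delta + csum (fun k => emt s (S k)) m)%C.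

(** The errors over successive periods telescope, so the total stays O(1/N) for fixed delta,
    uniformly in m. *)
Lemma partial_phi (N m : nat) (delta : R) : 0 < delta <= 1 ->
  Cmod (partial delta m - kap s * (phi N (INR (S m)) - phi N delta))%C
  <= Cmod (kap s) * (4 * / INR (S N)) / sg *
     (exp (- sg * ln delta) - exp (- sg * ln (INR (S m)))).
Proof.
intros Hdl. induction m as [|m IH].
- assert (H := Aprim_phi N 0 delta 1). simpl INR in *. unfold partial. simpl csum.
  rewrite Cplus_0_r. apply H; lra.
- assert (H := Aprim_phi N (S m) (INR (S m)) (INR (S (S m)))
    ltac:(apply lt_0_INR; lia) ltac:(lra) ltac:(rewrite (S_INR (S m)); lra)
    ltac:(rewrite (S_INR (S m)); lra)).
  replace (partial delta (S m) - kap s * (phi N (INR (S (S m))) - phi N delta))%C with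
    ((partial delta m - kap s * (phi N (INR (S m)) - phi N delta)) +
     (Aprim s (INR (S m)) (INR (S (S m))) - Aprim s (INR (S m)) (INR (S m))
      - kap s * (phi N (INR (S (S m))) - phi N (INR (S m)))))%C
    by (unfold partial, emt; cbn [csum]; ring).
  eapply Rle_trans; [apply Cmod_triangle|]. lra.
Qed.

Definition zsum (N : nat) : C := csum wgt N.

(** Common majorant for both ends: the weights are of size om^(sg - 3), the tails of the transform
    O(om^(- sg)), its initial parts O(om^(1 - sg)). The resulting bounds do not depend on N. *)
Let Z2 := Series (fun n => exp (- (2) * ln (INR (S n)))).

Lemma ln_om_ge (k : nat) : ln (INR (S k)) <= ln (om k).
Proof.
assert (P : 0 < INR (S k)) by (apply lt_0_INR; lia).
apply ln_le; [exact P|]. unfold om. generalize PI2_1. nra.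
Qed.

Lemma Cmod_wgt (k : nat) : Cmod (wgt k) = 2 * exp ((sg - 3) * ln (om k)).
Proof.
assert (P := om_pos k). unfold wgt. rewrite Cmod_mult, Cmod_R, Cmod_rp, Rabs_pos_eq.
- replace (- Re (- u)%C) with sg by (unfold sg; autorewrite with cre; ring).
  replace ((sg - 3) * ln (om k)) with (sg * ln (om k) + - (ln (om k) + (ln (om k) + ln (om k)))) by ring.
  rewrite exp_plus, exp_Ropp, !exp_plus, exp_ln by exact P. field; lra.
- apply Rdiv_le_0_compat; [lra|apply pow_lt, P].
Qed.

Lemma rsum_om_le (c : R) (N : nat) (f : nat -> R) : 0 <= c ->
  (forall k, f k <= c * exp (- (2) * ln (om k))) -> rsum f N <= c * Z2.
Proof.
intros Hc H. apply Rle_trans with (rsum (fun k => c * exp (- (2) * ln (INR (S k)))) N).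
- apply rsum_le; intros k _. eapply Rle_trans; [apply H|].
  apply Rmult_le_compat_l; [exact Hc|]. apply exp_mono. generalize (ln_om_ge k); lra.
- rewrite rsum_scal. apply Rmult_le_compat_l; [exact Hc|].
  apply rsum_le_Series; [intros; left; apply exp_pos|apply ex_series_rpow; lra].
Qed.

Lemma phi_large (N : nat) (Y : R) : 0 < Y ->
  Cmod (phi N Y - Sfun u * zsum N)%C <= 2 / sg * exp (- sg * ln Y) * Z2.
Proof.
intros HY. unfold phi, zsum.
replace (csum (fun k => wgt k * Efun (om k * Y) u)%C N - Sfun u * csum wgt N)%C
  with (csum (fun k => wgt k * (Efun (om k * Y) u - Sfun u))%C N).
- eapply Rle_trans; [apply Cmod_csum|]. apply rsum_om_le.
  + apply Rmult_le_pos; [apply Rdiv_le_0_compat; lra|left; apply exp_pos].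
  + intros k. assert (P := om_pos k). rewrite Cmod_mult, Cmod_wgt.
    assert (HT := Sfun_tail u d (om k * Y) Hd (proj1 Hsg) (Rmult_lt_0_compat _ _ P HY)).
    fold sg in HT. rewrite ln_mult in HT by assumption.
    apply Rle_trans with (2 * exp ((sg - 3) * ln (om k)) * (exp (- sg * (ln (om k) + ln Y)) / sg)).
    * apply Rmult_le_compat_l; [|exact HT]. generalize (exp_pos ((sg - 3) * ln (om k))); lra.
    * replace (2 * exp ((sg - 3) * ln (om k)) * (exp (- sg * (ln (om k) + ln Y)) / sg))
        with (2 / sg * (exp ((sg - 3) * ln (om k)) * exp (- sg * (ln (om k) + ln Y)))) by (field; lra).
      replace (2 / sg * exp (- sg * ln Y) * exp (- (2) * ln (om k)))
        with (2 / sg * (exp (- sg * ln Y) * exp (- (2) * ln (om k)))) by ring.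
      apply Rmult_le_compat_l; [apply Rdiv_le_0_compat; lra|].
      rewrite <- !exp_plus. apply exp_mono.
      generalize (ln_om_ge k) (ln_INR_ge_0 (S k)). nra.
- rewrite <- csum_scal.
  replace (csum (fun k => wgt k * Efun (om k * Y) u)%C N - csum (fun k => Sfun u * wgt k)%C N)%C
    with (csum (fun k => wgt k * Efun (om k * Y) u)%C N + - (1) * csum (fun k => Sfun u * wgt k)%C N)%C by ring.
  rewrite <- csum_scal, <- csum_plus. apply csum_ext; intros; ring.
Qed.

Lemma phi_small (N : nat) (delta : R) : 0 < delta ->
  Cmod (phi N delta) <= 2 / (1 - sg) * exp ((1 - sg) * ln delta) * Z2.
Proof.
intros HY. unfold phi. eapply Rle_trans; [apply Cmod_csum|]. apply rsum_om_le.
- apply Rmult_le_pos; [apply Rdiv_le_0_compat; lra|left; apply exp_pos].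
- intros k. assert (P := om_pos k). rewrite Cmod_mult, Cmod_wgt.
  assert (HT := Efun_le u d (om k * delta) Hd (proj2 Hsg) (Rmult_lt_0_compat _ _ P HY)).
  fold sg in HT. rewrite ln_mult in HT by assumption.
  apply Rle_trans with (2 * exp ((sg - 3) * ln (om k)) *
    (exp ((1 - sg) * (ln (om k) + ln delta)) / (1 - sg))).
  + apply Rmult_le_compat_l; [|exact HT]. generalize (exp_pos ((sg - 3) * ln (om k))); lra.
  + replace (2 * exp ((sg - 3) * ln (om k)) * (exp ((1 - sg) * (ln (om k) + ln delta)) / (1 - sg)))
      with (2 / (1 - sg) * (exp ((sg - 3) * ln (om k)) * exp ((1 - sg) * (ln (om k) + ln delta))))
      by (field; lra).
    rewrite Rmult_assoc. apply Rmult_le_compat_l; [apply Rdiv_le_0_compat; lra|].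
    rewrite <- !exp_plus. apply Req_le. f_equal. ring.
Qed.

(** The weights are 2 (2 pi k)^(-(1 - s)) with k starting at 1, and Re(1 - s) > 2, so zeta(1 - s) is
    given by its Dirichlet series. *)
Lemma zsum_lim : Clim zsum (2 * rp (2 * PI) (1 - s) * zeta (1 - s))%C.
Proof.
assert (P2 : 0 < 2 * PI) by (generalize PI_RGT_0; lra).
apply Clim_ext with (fun N => 2 * rp (2 * PI) (1 - s) * csum (fun k => npow (S k) (1 - s)) N)%C.
- intros N. unfold zsum. rewrite <- csum_scal. apply csum_ext; intros k _.
  assert (P := om_pos k). assert (Pk : 0 < INR (S k)) by (apply lt_0_INR; lia).
  rewrite npow_rp, <- Cmult_assoc, <- rp_mult by assumption. fold (om k). unfold wgt.
  replace (1 - s)%C with (- u + 1 + 1 + 1)%C by (unfold u; ring).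
  assert (Q : forall v, rp (om k) (v + 1) = (RtoC (/ om k) * rp (om k) v)%C)
    by (intros v; rewrite rp_plus, rp_1_r by exact P; ring).
  rewrite !Q. replace (2 / om k ^ 3) with (2 * / om k * / om k * / om k) by (field; lra).
  rewrite !RtoC_mult. ring.
- apply Clim_scal, zeta_series; [exact Hzeta|]. autorewrite with cre; lra.
Qed.

(** N goes to infinity with delta and m fixed: the Fourier error disappears, although its constant
    grows as delta tends to 0, and only the two end contributions remain. *)
Lemma partial_error (m : nat) (delta : R) : 0 < delta <= 1 ->
  Cmod (partial delta m - kap s * Sfun u * (2 * rp (2 * PI) (1 - s) * zeta (1 - s)))%C
  <= Cmod (kap s) * (2 / sg * exp (- sg * ln (INR (S m))) * Z2
     + 2 / (1 - sg) * exp ((1 - sg) * ln delta) * Z2).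
Proof.
intros Hdl.
set (X := Cmod (kap s) * 4 / sg * (exp (- sg * ln delta) - exp (- sg * ln (INR (S m))))).
apply Clim_bound_eps with (fun N => partial delta m - kap s * Sfun u * zsum N)%C
  (fun N => X * / INR (S N)).
- apply Clim_minus; [apply Clim_const|apply Clim_scal, zsum_lim].
- intros N.
  replace (partial delta m - kap s * Sfun u * zsum N)%C with
    ((partial delta m - kap s * (phi N (INR (S m)) - phi N delta)) +
     kap s * ((phi N (INR (S m)) - Sfun u * zsum N) - phi N delta))%C by ring.
  eapply Rle_trans; [apply Cmod_triangle|]. rewrite Cmod_mult, Rplus_comm.
  apply Rplus_le_compat.
  + apply Rmult_le_compat_l; [apply Cmod_ge_0|].
    eapply Rle_trans; [apply Cmod_triangle|]. rewrite Cmod_opp.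
    apply Rplus_le_compat; [apply phi_large, lt_0_INR; lia|apply phi_small; lra].
  + eapply Rle_trans; [apply partial_phi, Hdl|]. apply Req_le. unfold X. unfold Rdiv; ring.
- apply is_lim_seq_scal_0, is_lim_seq_inv_S.
Qed.

(** Since [bern] has a simple zero at 0, every term of the antiderivative contains x^(-s-1), which
    tends to 0 because Re s < -1. *)
Lemma Aprim_vanishes (x : nat -> R) : (forall m, x m = / INR (S m)) ->
  Clim (fun m => Aprim s 0 (x m)) 0.
Proof.
intros Ex. assert (Hx : forall m, 0 < x m)
  by (intros m; rewrite Ex; apply Rinv_0_lt_compat, lt_0_INR; lia).
assert (Lx : Clim (fun m => RtoC (x m)) 0).
{ apply Clim_squeeze with (2 := is_lim_seq_inv_S). intros m.
  replace (RtoC (x m) - 0)%C with (RtoC (x m)) by ring.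
  rewrite Cmod_R, Rabs_pos_eq, Ex by (left; apply Hx). lra. }
assert (Lr : Clim (fun m => rp (x m) (s + 1)) 0).
{ apply Clim_ext with (fun m => rp (INR (S m)) (- (s + 1))).
  - intros m. unfold rp. rewrite Ex, ln_Rinv, RtoC_opp by (apply lt_0_INR; lia). f_equal; ring.
  - apply rp_vanishes. autorewrite with cre; lra. }
apply Clim_ext with (fun m => rp (x m) (s + 1) *
  (s * (s + 1) * (RtoC (/ 6) * RtoC (x m) * RtoC (x m) - RtoC (/ 4) * RtoC (x m) + RtoC (/ 12))
   + s * (RtoC (/ 2) * RtoC (x m) * RtoC (x m) - RtoC (/ 2) * RtoC (x m) + RtoC (/ 12))
   + RtoC (x m) * (RtoC (x m) - RtoC (/ 2)) - / (1 - s) * RtoC (x m) * RtoC (x m)))%C.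
- intros m. assert (P := Hx m). unfold Aprim. rewrite Rminus_0_r.
  replace (rp (x m) (s - 1)) with (RtoC (x m) * (RtoC (x m) * rp (x m) (s + 1)))%C
    by (rewrite rp_succ, <- (rp_succ _ (s - 1)) by exact P; do 2 f_equal; ring).
  rewrite <- (rp_succ _ s P), <- (rp_succ _ (s + 1) P).
  replace (s + 1 + 1)%C with (s + 2)%C by ring.
  replace (bern (x m)) with (/ 6 * x m * x m * x m - / 4 * x m * x m + / 12 * x m) by (unfold bern; field).
  replace (bern1 (x m)) with (/ 2 * x m * x m - / 2 * x m + / 12) by (unfold bern1; field).
  replace (x m - 1 / 2) with (x m - / 2) by field.
  rewrite ?RtoC_plus, ?RtoC_minus, ?RtoC_plus, ?RtoC_minus, !RtoC_mult. ring.
- rewrite <- (Cmult_0_l (s * (s + 1) * (RtoC (/ 6) * 0 * 0 - RtoC (/ 4) * 0 + RtoC (/ 12))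
   + s * (RtoC (/ 2) * 0 * 0 - RtoC (/ 2) * 0 + RtoC (/ 12))
   + 0 * (0 - RtoC (/ 2)) - / (1 - s) * 0 * 0)%C).
  repeat first [apply Clim_mult | apply Clim_minus | apply Clim_plus]; assumption || apply Clim_const.
Qed.

Lemma functional_equation_strip :
  zeta s = (kap s * Sfun u * (2 * rp (2 * PI) (1 - s) * zeta (1 - s)))%C.
Proof.
set (del := fun m => / INR (S m)).
assert (Hdel : forall m, 0 < del m <= 1).
{ intros m. unfold del. assert (1 <= INR (S m)) by (rewrite S_INR; generalize (pos_INR m); lra).
  split; [apply Rinv_0_lt_compat; lra|rewrite <- Rinv_1; apply Rinv_le_contravar; lra]. }
assert (Hln : forall m, ln (del m) = - ln (INR (S m)))
  by (intros m; unfold del; apply ln_Rinv, lt_0_INR; lia).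
(* Both ends move together, delta = 1/(m + 1) and upper limit m + 1. One limit is zeta(s) by
   Euler-Maclaurin, the other the Fourier side. *)
apply Clim_unique with (fun m => partial (del m) m).
- destruct (Esum_spec s) as [_ HE]; [lra|exact s_neq_1|].
  rewrite euler_maclaurin by (lra || exact s_neq_1).
  unfold partial. apply Clim_plus; [|exact HE].
  (* Since [bern] vanishes at 1, the boundary terms at 1 are the antiderivative there; at the lower
     end it tends to 0. *)
  replace (bdry s 1) with (Aprim s 0 1 - 0)%C.
  + apply Clim_minus; [apply Clim_const|].
    apply Aprim_vanishes. reflexivity.
  + unfold Aprim, bdry. rewrite Rminus_0_r, bern_1, bern1_1. simpl INR.
    replace (1 - 1 / 2) with (/ 2) by field. ring.
- set (c1 := Cmod (kap s) * (2 / sg) * Z2). set (c2 := Cmod (kap s) * (2 / (1 - sg)) * Z2).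
  apply Clim_squeeze with (fun m => c1 * exp (- sg * ln (INR (S m))) + c2 * exp (- (1 - sg) * ln (INR (S m)))).
  + intros m. eapply Rle_trans; [apply partial_error, Hdel|]. rewrite Hln. apply Req_le.
    unfold c1, c2.
    replace ((1 - sg) * - ln (INR (S m))) with (- (1 - sg) * ln (INR (S m))) by ring. ring.
  + replace (Finite 0) with (Finite (0 + 0)) by (f_equal; ring).
    apply is_lim_seq_plus'; apply is_lim_seq_scal_0, exp_ln_vanishes; lra.
Qed.

End Strip.

(** * Extension of the functional equation beyond the strip, and reflection of zeros *)

Lemma away_nonreal (z : C) : Im z <> 0 -> exists d, away z d.
Proof. intros Hz. apply away_exists. intros n _ ->. apply Hz; reflexivity. Qed.

(** The excluded points are real: 0 because of the pole of zeta(1 - w), 1, and the poles of the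
    transform. The identity in the strip therefore spreads over the half-plane. *)
Lemma functional_equation (w : C) : -2 < Re w -> w <> 0 -> w <> 1 ->
  (forall n, Nat.odd n = true -> (w + 2)%C <> RtoC (INR n)) ->
  zeta w = (kap w * Sfun (w + 2) * (2 * rp (2 * PI) (1 - w) * zeta (1 - w)))%C.
Proof.
intros Hw Hw0 Hw1 Hodd.
set (f := fun z => (zeta z - kap z * Sfun (z + 2) * (2 * rp (2 * PI) (1 - z) * zeta (1 - z)))%C).
assert (An : forall z d, -2 < Re z -> z <> 0 -> z <> 1 -> away (z + 2) d -> anl f z).
{ intros z d Hz Hz0 Hz1 Hd.
  apply anl_minus; [apply anl_zeta; assumption|].
  apply anl_mult; [apply anl_mult|apply anl_mult; [apply anl_mult|]].
  - unfold kap.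
    apply anl_mult; [apply anl_mult|].
    + apply anl_ext with (fun z => (-(1)) * z)%C; [intros; ring|].
      apply anl_mult; [apply anl_const|apply anl_id].
    + apply anl_plus; [apply anl_id|apply anl_const].
    + apply anl_plus; [apply anl_id|apply anl_const].
  - apply anl_ext with (fun z => Sfun (1 * z + 2)%C); [intros; f_equal; ring|].
    apply anl_comp_affine; [apply Cmod_1|].
    replace (1 * z + 2)%C with (z + 2)%C by ring.
    apply (Sfun_spec _ d Hd). autorewrite with cre; lra.
  - apply anl_const.
  - apply anl_ext with (fun z => rp (2 * PI) 1 * Cexp (RtoC (ln (2 * PI)) * z))%C.
    + intros v. unfold rp. rewrite <- Cexp_plus; f_equal; ring.
    + apply anl_mult; [apply anl_const|apply anl_exp].
  - apply anl_ext with (fun z => zeta ((-(1)) * z + 1)%C); [intros; f_equal; ring|].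
    apply anl_comp_affine; [apply Cmod_m1|].
    apply anl_zeta; [exact Hzeta|]. intros E. apply Hz0.
    replace z with (1 - ((-(1)) * z + 1))%C by ring. rewrite E; ring. }
assert (Z : f w = 0).
{ apply (identity_halfplane f (-2) (-3/2)); [lra| | |exact Hw|].
  - intros z Hz Hi.
    destruct (away_nonreal (z + 2)%C) as [d Hd]; [autorewrite with cre; lra|].
    apply (An z d Hz); [intros ->; apply Hi; reflexivity|intros ->; apply Hi; reflexivity|exact Hd].
  - intros y Hy. 
    (* This radius keeps the disc about -3/2 + i y within the strip and off the real axis. *)
    assert (Hm : 0 < Rmin (1 / 2) (Rabs y)) by (apply Rmin_glb_lt; [lra|apply Rabs_pos_lt, Hy]).
    exists (Rmin (1 / 2) (Rabs y)); split; [exact Hm|]. intros z Hz.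
    assert (H1 := Rlt_le_trans _ _ _ Hz (Rmin_l _ _)).
    assert (H2 := Rlt_le_trans _ _ _ Hz (Rmin_r _ _)).
    assert (R1 := re_le_Cmod (z - ((-3/2)%R, y))%C). assert (I1 := im_le_Cmod (z - ((-3/2)%R, y))%C).
    rewrite Re_minus, Re_pair in R1. rewrite Im_minus, Im_pair in I1.
    assert (R2 : Rabs (Re z - -3 / 2) < 1 / 2) by lra. apply Rabs_def2 in R2.
    destruct (away_nonreal (z + 2)%C) as [d Hd].
    { autorewrite with cre. intros E. replace (Im z - y) with (- y) in I1 by lra.
      rewrite Rabs_Ropp in I1. lra. }
    unfold f. rewrite (functional_equation_strip z ltac:(lra) d Hd) at 1. ring.
  - destruct (away_exists (w + 2)%C Hodd) as [d Hd]. apply (An w d); assumption. }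
unfold f in Z.
match type of Z with (_ - ?x)%C = _ => replace (zeta w) with (zeta w - x + x)%C by ring end.
rewrite Z; ring.
Qed.

End Functional.

Lemma zeta_nonzero_right_half (zeta : C -> C) (Hzeta : is_riemann_zeta zeta) :
  (forall A : R, exists theta : R, A < theta /\ moment_bound zeta theta) ->
  forall w, 1 / 2 < Re w -> w <> 1 -> zeta w <> 0.
Proof.
intros HA w Hw Hw1. set (d := Re w - 1 / 2). assert (Hd : 0 < d) by (unfold d; lra).
(* Any theta above 1/(2 d) makes 1/(2 theta) < d, which puts w inside the zero-free half-plane. *)
destruct (HA (/ (2 * d))) as [theta [Hth Hm]].
assert (P : 0 < / (2 * d)) by (apply Rinv_0_lt_compat; lra).
apply (zero_free_half_plane zeta Hzeta theta); [lra|exact Hm| |exact Hw1].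
assert (1 / (2 * theta) < d); [|unfold d in *; lra].
apply Rlt_div_l; [lra|].
apply (Rmult_lt_compat_l (2 * d)) in Hth; [|lra].
rewrite Rinv_r in Hth by lra. lra.
Qed.

Theorem theorem1 (zeta : C -> C) (Hzeta : is_riemann_zeta zeta) :
  (forall theta : R, 0 < theta -> moment_bound zeta theta ->
     forall s : C, 1 / 2 + 1 / (2 * theta) < Re s -> ~ is_zero zeta s) /\
  ((forall A : R, exists theta : R, A < theta /\ moment_bound zeta theta) ->
     riemann_hypothesis zeta).
Proof.
split.
- intros theta Hth Hm s Hs [Hs1 Hz].
  exact (zero_free_half_plane zeta Hzeta theta Hth Hm s Hs Hs1 Hz).
- intros HA s [Hs1 Hz] Htriv.
  assert (NZ := zeta_nonzero_right_half zeta Hzeta HA).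
  destruct (Rtotal_order (Re s) (1 / 2)) as [Hlt|[Heq|Hgt]].
  (* The reflected point w = 1 - s lies to the right of the line, where zeta has no zeros, whereas
     the functional equation would make zeta(w) vanish. *)
  + exfalso. set (w := (1 - s)%C).
    assert (Hw : 1 / 2 < Re w) by (unfold w; autorewrite with cre; lra).
    assert (Ew : (1 - w)%C = s) by (unfold w; ring).
    assert (Hs0 : s <> 0) by (intros E; apply (zeta_0 zeta Hzeta); rewrite E in Hz; exact Hz).
    assert (Hw1 : w <> 1) by (intros E; apply Hs0; rewrite <- Ew, E; ring).
    apply (NZ w Hw Hw1).
    rewrite (functional_equation zeta Hzeta w).
    * rewrite Ew, Hz. ring.
    * lra.
    * intros E; rewrite E in Hw; simpl in Hw; lra.
    * exact Hw1.
    (* At the poles w + 2 = 2 k + 1 one has s = 2 - 2 k: k = 0 contradicts Re s < 1/2, k = 1 gives s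
       = 0, where zeta is nonzero, and k >= 2 gives the trivial zeros. *)
    * intros n Hn E. apply Nat.odd_spec in Hn. destruct Hn as [k ->].
      assert (Es : s = RtoC (3 - INR (2 * k + 1))).
      { rewrite RtoC_minus, <- E, <- Ew. replace (RtoC 3) with (1 + 2)%C; [ring|].
        rewrite <- RtoC_plus; f_equal; ring. }
      rewrite plus_INR, mult_INR in Es. simpl INR in Es.
      destruct k as [|[|k]].
      -- rewrite Es in Hlt. simpl in Hlt. lra.
      -- apply Hs0. rewrite Es. f_equal. simpl; ring.
      -- apply Htriv. exists k. rewrite Es. f_equal. rewrite !S_INR; ring.
  + exact Heq.
  + exfalso. exact (NZ s Hgt Hs1 Hz).
Qed.
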